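(* Let $m\ge 0$ be an integer, let $g$ be an entire function on $\mathbb{C}$, let $0<p,q<\infty$, and consider $I_gf(z)=\int_0^z f'(w)g(w)\,dw$. (1) If $0<p\le q<\infty$, then $I_g:\mathcal{F}_{\psi_m}^p\to\mathcal{F}_{\psi_m}^q$ is (a) bounded if and only if $g$ is a constant function; (b) compact if and only if $g$ is the zero function. (2) If $0<q<p<\infty$, then the following are equivalent: (a) $I_g:\mathcal{F}_{\psi_m}^p\to\mathcal{F}_{\psi_m}^q$ is bounded; (b) $I_g:\mathcal{F}_{\psi_m}^p\to\mathcal{F}_{\psi_m}^q$ is compact; (c) $g$ is the zero function.
   Context: For an integer $m\ge 0$ let $\psi_m(z)=\frac12|z|^2-m\log(1+|z|)$, $z\in\mathbb{C}$. For $0<p<\infty$, $\mathcal{F}_{\psi_m}^p$ is the space of all entire functions $f$ with $\|f\|_{(p,m)}^p:=\int_{\mathbb{C}}|f(z)|^pe^{-p\psi_m(z)}\,dA(z)<\infty$, where $dA$ is Lebesgue area measure on $\mathbb{C}$. *)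

(* Defs.v *)
(* The complex plane is modelled by R[i]
   (mathcomp-real-closed `complex`) over an arbitrary realType R; complex
   differentiability is MathComp-Analysis' `derivable` for R[i]^o viewed as a
   normed module over itself; area measure is the product Lebesgue measure on
   R * R, via the identification (x, y) <-> x + i y. *)
From mathcomp Require Import all_boot all_order all_algebra.
From mathcomp Require Import all_classical all_reals all_analysis.
From mathcomp Require Export complex.
Import Order.TTheory GRing.Theory Num.Theory.
Import numFieldNormedType.Exports.

Set Implicit Arguments.
Unset Strict Implicit.
Unset Printing Implicit Defensive.

Local Open Scope ring_scope.
Local Open Scope classical_set_scope.
Local Open Scope complex_scope.

Section Fock.
Variable R : realType.

Definition cabs (z : R[i]) : R := Num.sqrt (complex.Re z ^+ 2 + complex.Im z ^+ 2).

Definition entire (f : R[i] -> R[i]) : Prop :=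
  forall z : R[i], derivable (f : R[i]^o -> R[i]^o) z 1.

Definition cderiv (f : R[i] -> R[i]) (z : R[i]) : R[i] :=
  'D_1 (f : R[i]^o -> R[i]^o) z.

Definition psi (m : nat) (z : R[i]) : R :=
  cabs z ^+ 2 / 2 - m%:R * ln (1 + cabs z).

Definition areaC := ((@lebesgue_measure R) \x (@lebesgue_measure R))%E.

Definition Fpow (p : R) (m : nat) (f : R[i] -> R[i]) : \bar R :=
  (\int[areaC]_(xy in [set: R * R])
     ((cabs (f (xy.1 +i* xy.2))) `^ p
        * expR (- (p * psi m (xy.1 +i* xy.2))))%:E)%E.

Definition inF (p : R) (m : nat) (f : R[i] -> R[i]) : Prop :=
  entire f /\ (Fpow p m f < +oo)%E.

Definition Fnorm (p : R) (m : nat) (f : R[i] -> R[i]) : R :=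
  (fine (Fpow p m f)) `^ p^-1.

(* Volterra-type operator I_g f(z) = \int_0^z f'(w) g(w) dw, the path
   integral taken along the segment w = t z, t in [0,1] (dw = z dt). *)
Definition Ig (g f : R[i] -> R[i]) (z : R[i]) : R[i] :=
  (Rintegral (@lebesgue_measure R) `[0, 1]
      (fun t : R => complex.Re (cderiv f (t%:C * z) * g (t%:C * z) * z)))
  +i*
  (Rintegral (@lebesgue_measure R) `[0, 1]
      (fun t : R => complex.Im (cderiv f (t%:C * z) * g (t%:C * z) * z))).

Definition Ig_bounded (p q : R) (m : nat) (g : R[i] -> R[i]) : Prop :=
  (forall f, inF p m f -> inF q m (Ig g f)) /\
  exists C : R, forall f, inF p m f -> Fnorm q m (Ig g f) <= C * Fnorm p m f.

Definition Ig_compact (p q : R) (m : nat) (g : R[i] -> R[i]) : Prop :=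
  (forall f, inF p m f -> inF q m (Ig g f)) /\
  forall u : nat -> (R[i] -> R[i]),
    (forall n, inF p m (u n)) ->
    (exists M : R, forall n, Fnorm p m (u n) <= M) ->
    exists phi : nat -> nat,
      {homo phi : n k / (n < k)%N >-> (n < k)%N} /\
      exists h : R[i] -> R[i], inF q m h /\
        (fun k => Fnorm q m (fun z => Ig g (u (phi k)) z - h z)) @ \oo --> 0.

End Fock.

(* Main.v *)
(* Write w(F)(z) = |F(z)| e^{-psi_m(z)}.  Cauchy's theorem on rectangles, applied on
   squares, gives Cauchy's derivative estimate and the bound of |F(0)| by the mean of
   |F| over a square; the latter passes to |F|^q for every q > 0.  Multiplying F(z + v) by
   e^{- conj(z) v} removes the linear part of psi_m(z + v), so w(F)^q at a point is
   bounded, uniformly in the point, by its integral over a unit box.  Hence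
   |F| <= K e^{psi_m} ||F|| and |F'| <= K (1 + |z|) e^{psi_m} ||F||.

   The kernels k_w(z) = e^{conj(w) z} e^{psi_m(w) - |w|^2} are bounded in every F^p and
   k_w'(w) = conj(w) e^{psi_m(w)}.  Since (I_g f)' = f' g, the derivative bound at z = w
   for I_g k_w shows that g is bounded when I_g is, hence constant.  If I_g is compact, a
   limit of I_g k_{w_n} with |w_n| -> oo is constant (k_{w_n} -> 0 locally uniformly),
   so g -> 0 at infinity and g = 0.  If q < p and g = c, the sum of N kernels centred at
   well separated points has p-norm at most A N^{1/p} while I_g of it has q-norm at least
   |c| B N^{1/q}, which forces c = 0. *)
Require Import Defs.
From mathcomp Require Import all_boot all_order all_algebra.
From mathcomp Require Import all_classical all_reals all_analysis.
From mathcomp Require Import measurable_realfun complex ring lra.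
Import Order.TTheory GRing.Theory Num.Theory.
Import numFieldNormedType.Exports.
Set Implicit Arguments.
Unset Strict Implicit.
Unset Printing Implicit Defensive.
Local Open Scope ring_scope.
Local Open Scope classical_set_scope.
Local Open Scope complex_scope.

(** * Complex differentiability *)

Section Complex.
Variable R : realType.
Local Notation C := R[i].
Implicit Types (x y r : R) (z w : C) (f g : C -> C).

(** Only the existence of constants matters, never their sharp values. This is why the winding
    integral is bounded below rather than evaluated, and why a factor 2 is accepted for integrating
    real and imaginary parts separately. For exponents below 1 there is no triangle inequality, so
    sums and differences are estimated through q-th powers under the integral. Membership in the
    target space includes that I_g f is entire. The formula (I_g f)' = f' g can therefore be read
    off at each z by differentiating along the ray through z, and continuity of f' is all the
    regularity it takes. For p <= q a constant symbol c gives I_g f = c (f - f(0)). Its boundedness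
    reduces to the embedding of F^p into F^q, obtained from the pointwise bound by writing |f|^q =
    |f|^{q-p} |f|^p. For q < p boundedness already makes g constant, so the sums of kernels only
    have to be tested through f - f(0). *)

Definition iu : C := 0 +i* 1.

Lemma normcE z : `|z| = (cabs z)%:C.
Proof. exact: normc_def. Qed.

Lemma cabs_normc z : cabs z = ComplexField.Normc.normc z.
Proof. by case: z. Qed.

Lemma cabs_ge0 z : 0 <= cabs z.
Proof. exact: sqrtr_ge0. Qed.
Hint Resolve cabs_ge0 : core.

Lemma cabsM z w : cabs (z * w) = cabs z * cabs w.
Proof. by rewrite !cabs_normc ComplexField.Normc.normcM. Qed.

Lemma cabsV z : cabs z^-1 = (cabs z)^-1.
Proof. by rewrite !cabs_normc ComplexField.Normc.normcV. Qed.

Lemma cabsX z n : cabs (z ^+ n) = cabs z ^+ n.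
Proof.
elim: n => [|n IH]; last by rewrite !exprS cabsM IH.
by rewrite !expr0 cabs_normc ComplexField.Normc.normc1.
Qed.

Lemma cabsD z w : cabs (z + w) <= cabs z + cabs w.
Proof. rewrite !cabs_normc; exact: le_normcD. Qed.

Lemma cabsN z : cabs (- z) = cabs z.
Proof. by rewrite /cabs; case: z => a b /=; rewrite !sqrrN. Qed.

Lemma cabsB z w : cabs (z - w) <= cabs z + cabs w.
Proof. by rewrite -(cabsN w) cabsD. Qed.

Lemma cabsBC z w : cabs (z - w) = cabs (w - z).
Proof. by rewrite -cabsN opprB. Qed.

Lemma cabs_real x : cabs x%:C = `|x|.
Proof. by rewrite /cabs /= expr0n addr0 sqrtr_sqr. Qed.

Lemma cabs0 : cabs (0 : C) = 0.
Proof. by rewrite (cabs_real 0) normr0. Qed.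

Lemma cabs1 : cabs (1 : C) = 1.
Proof. by rewrite (cabs_real 1) normr1. Qed.

Lemma cabs_i : cabs iu = 1.
Proof. by rewrite /cabs /= expr0n add0r expr1n sqrtr1. Qed.

Lemma cabs_eq0 z : (cabs z == 0) = (z == 0).
Proof.
apply/eqP/eqP => [|->]; last exact: cabs0.
by rewrite cabs_normc; apply: ComplexField.Normc.eq0_normc.
Qed.

Lemma cabs_gt0 z : (0 < cabs z) = (z != 0).
Proof. by rewrite lt_neqAle cabs_ge0 andbT eq_sym cabs_eq0. Qed.

Lemma Re_le_cabs z : `|complex.Re z| <= cabs z.
Proof.
rewrite -sqrtr_sqr /cabs ler_wsqrtr // lerDl; exact: sqr_ge0.
Qed.

Lemma Im_le_cabs z : `|complex.Im z| <= cabs z.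
Proof.
rewrite -sqrtr_sqr /cabs ler_wsqrtr // lerDr; exact: sqr_ge0.
Qed.

Lemma complex_split z : z = (complex.Re z)%:C + iu * (complex.Im z)%:C :> C.
Proof. exact: complexE. Qed.

Lemma cabs_le_ReIm z : cabs z <= `|complex.Re z| + `|complex.Im z|.
Proof.
by rewrite {1}(complex_split z) (le_trans (cabsD _ _)) // cabsM cabs_i mul1r !cabs_real.
Qed.

Lemma cReD z w : complex.Re (z + w) = complex.Re z + complex.Re w.
Proof. by case: z; case: w. Qed.
Lemma cImD z w : complex.Im (z + w) = complex.Im z + complex.Im w.
Proof. by case: z; case: w. Qed.
Lemma cReN z : complex.Re (- z) = - complex.Re z.
Proof. by case: z. Qed.
Lemma cImN z : complex.Im (- z) = - complex.Im z.
Proof. by case: z. Qed.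
Lemma cReM z w : complex.Re (z * w) = complex.Re z * complex.Re w - complex.Im z * complex.Im w.
Proof. by case: z; case: w. Qed.
Lemma cImM z w : complex.Im (z * w) = complex.Re z * complex.Im w + complex.Im z * complex.Re w.
Proof. by case: z; case: w. Qed.

Lemma cabs_sqr z : cabs z ^+ 2 = complex.Re z ^+ 2 + complex.Im z ^+ 2.
Proof. by rewrite /cabs sqr_sqrtr // addr_ge0 // sqr_ge0. Qed.

(** Little-o form of complex differentiability, with real [e] and [r]. The non-strict bound includes
    h = 0, so no punctured neighbourhood appears and the estimates are inequalities between
    reals. *)
Definition cdiff f z (d : C) := forall e, 0 < e -> exists2 r, 0 < r &
  forall h, cabs h < r -> cabs (f (z + h) - f z - d * h) <= e * cabs h.

Lemma ltcR0 (e : C) : 0 < e -> exists2 e', 0 < e' & e = e'%:C.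
Proof.
case: e => a b; rewrite ltcE /= => /andP[/eqP -> a0]; by exists a.
Qed.

(** Bridge to [is_derive]: sum, product and inverse rules are transported through it, while explicit
    estimates use the epsilon form. *)
Lemma cdiffP f z d :
  cdiff f z d <-> is_derive (z : R[i]^o) 1 (f : R[i]^o -> R[i]^o) d.
Proof.
pose q := fun h : R[i]^o => h^-1 *: (((f : R[i]^o -> R[i]^o) \o shift z) (h *: (1 : R[i]^o)) - f z).
have qE h : h != 0 -> q h - d = h^-1 * (f (z + h) - f z - d * h).
  move=> h0; rewrite /q /= /GRing.scale /= mulr1 (addrC h); by field.
have key : cdiff f z d <-> q h @[h --> 0^'] --> (d : R[i]^o).
  split.
    move=> H; apply/cvgrPdist_le => e /ltcR0[e' e0 ->].
    have [r r0 rP] := H _ e0.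
    apply/nbhs_ballP; exists r%:C => /=; first by rewrite ltcR.
    move=> h; rewrite -ball_normE /ball_ /= sub0r normrN normcE ltcR => hr h0.
    rewrite distrC qE // normcE lecR cabsM cabsV.
    by rewrite ler_pdivrMl ?cabs_gt0 // [leRHS]mulrC; exact: rP.
  move=> /cvgrPdist_le H e e0.
  have /H : 0 < e%:C by rewrite ltcR.
  move=> /nbhs_ballP[r' /= /ltcR0[r r0 ->]] rP.
  exists r => // h hr; have [->|h0] := eqVneq h 0.
    by rewrite addr0 mulr0 subrr subr0 cabs0 mulr0.
  have := rP h; rewrite -ball_normE /ball_ /= sub0r normrN normcE ltcR => /(_ hr h0).
  rewrite distrC qE // normcE lecR cabsM cabsV.
  by rewrite ler_pdivrMl ?cabs_gt0 // [leRHS]mulrC.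
rewrite key; split=> [H|[H1 H2]].
  by apply: DeriveDef; [apply/cvg_ex; exists d|apply/cvg_lim].
by rewrite -H2; move: H1; rewrite /derivable.
Qed.

Lemma entireP f : entire f <-> forall z, cdiff f z (cderiv f z).
Proof.
split=> H z; first by apply/cdiffP; apply: derivableP.
by have /cdiffP[] := H z.
Qed.

Lemma cdiff_unique f z d : cdiff f z d -> cderiv f z = d.
Proof. by move=> /cdiffP[]. Qed.

Lemma cdiff_entire f (df : C -> C) : (forall z, cdiff f z (df z)) -> entire f.
Proof. by move=> H z; have /cdiffP[] := H z. Qed.

Lemma cdiff_eq f z d d' : cdiff f z d -> d = d' -> cdiff f z d'.
Proof. by move=> H <-. Qed.

Lemma cdiff_ext f g z d : f =1 g -> cdiff f z d -> cdiff g z d.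
Proof. by move=> /funext ->. Qed.

Lemma cdiff_cst c z : cdiff (fun=> c) z 0.
Proof. by apply/cdiffP; apply: is_derive_cst. Qed.

Lemma cdiff_id z : cdiff (fun w => w) z 1.
Proof. by apply/cdiffP; apply: is_derive_id. Qed.

Lemma cdiffD f g z d d' : cdiff f z d -> cdiff g z d' ->
  cdiff (fun w => f w + g w) z (d + d').
Proof. by move=> /cdiffP Hf /cdiffP Hg; apply/cdiffP; apply: is_deriveD. Qed.

Lemma cdiffB f g z d d' : cdiff f z d -> cdiff g z d' ->
  cdiff (fun w => f w - g w) z (d - d').
Proof. by move=> /cdiffP Hf /cdiffP Hg; apply/cdiffP; apply: is_deriveB. Qed.

Lemma cdiffM f g z d d' : cdiff f z d -> cdiff g z d' ->
  cdiff (fun w => f w * g w) z (f z * d' + g z * d).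
Proof. by move=> /cdiffP Hf /cdiffP Hg; apply/cdiffP; apply: is_deriveM. Qed.

Lemma cdiffV f z d : cdiff f z d -> f z != 0 ->
  cdiff (fun w => (f w)^-1) z (- (f z) ^- 2 * d).
Proof.
move=> /cdiffP[Hf1 Hf2] f0; apply/cdiffP; apply: DeriveDef.
  exact: derivableV.
by rewrite deriveV // Hf2.
Qed.

Lemma cdiff_cont f z d : cdiff f z d ->
  forall e, 0 < e -> exists2 r, 0 < r & forall h, cabs h < r -> cabs (f (z + h) - f z) <= e.
Proof.
move=> H e e0; have [r r0 rP] := H 1 ltr01.
have M0 : 0 < 1 + cabs d by rewrite ltr_pwDl.
exists (Num.min r (e / (1 + cabs d))); first by rewrite lt_min r0 divr_gt0.
move=> h; rewrite lt_min => /andP[h1]; rewrite ltr_pdivlMr // => h2.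
have := rP h h1; rewrite mul1r => h3.
have -> : f (z + h) - f z = (f (z + h) - f z - d * h) + d * h by ring.
rewrite (le_trans (cabsD _ _)) // (le_trans (lerD h3 (lexx _))) // cabsM.
by move: h2; nra.
Qed.

Lemma cdiff_comp f g z d d' : cdiff f z d -> cdiff g (f z) d' ->
  cdiff (fun w => g (f w)) z (d' * d).
Proof.
move=> Hf Hg e e0.
have M0 : 0 < 1 + cabs d by rewrite ltr_pwDl.
have N0 : 0 < 1 + cabs d' by rewrite ltr_pwDl.
have e1 : 0 < e / 2 / (1 + cabs d) by rewrite !divr_gt0.
have e2 : 0 < e / 2 / (1 + cabs d') by rewrite !divr_gt0.
have [r1 r10 P1] := Hg _ e1.
have [r2 r20 P2] := Hf _ e2.
have [r3 r30 P3] := Hf _ ltr01.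
exists (Num.min (Num.min r2 r3) (r1 / (1 + cabs d))).
  by rewrite !lt_min r20 r30 divr_gt0.
move=> h; rewrite !lt_min ltr_pdivlMr // => /andP[/andP[h2 h3] h1].
pose k := f (z + h) - f z.
have kh : cabs k <= (1 + cabs d) * cabs h.
  have := P3 h h3; rewrite mul1r => h4.
  have -> : k = (f (z + h) - f z - d * h) + d * h by rewrite /k; ring.
  by rewrite (le_trans (cabsD _ _)) // mulrDl mul1r lerD // cabsM.
have k1 : cabs k < r1 by rewrite (le_lt_trans kh) // mulrC.
have := P1 k k1; have -> : f z + k = f (z + h) by rewrite /k; ring.
move=> H1; have H2 := P2 h h2.
have -> : g (f (z + h)) - g (f z) - d' * d * h =
  (g (f (z + h)) - g (f z) - d' * k) + d' * (f (z + h) - f z - d * h).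
  by rewrite /k; ring.
rewrite (le_trans (cabsD _ _)) // cabsM.
have h0 := cabs_ge0 h.
have A1 : e / 2 / (1 + cabs d) * cabs k <= e / 2 * cabs h.
  rewrite -mulrA ler_wpM2l ?ler_pdivrMl //; lra.
have A2 : cabs d' * (e / 2 / (1 + cabs d') * cabs h) <= e / 2 * cabs h.
  rewrite mulrA ler_wpM2r // mulrCA ler_piMr; [|lra|] => //.
  by rewrite ler_pdivrMr // mul1r lerDr.
have := ler_wpM2l (cabs_ge0 d') H2.
lra.
Qed.

Lemma entire_cont f : entire f -> forall z e, 0 < e ->
  exists2 r, 0 < r & forall h, cabs h < r -> cabs (f (z + h) - f z) <= e.
Proof. by move=> /entireP H z; apply: cdiff_cont (H z). Qed.

End Complex.
Arguments iu {R}.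
#[export] Hint Extern 0 (is_true (0%R <= cabs _)%R) => solve [apply: cabs_ge0] : core.

(** * Integrals of complex-valued functions of a real variable *)

Section Integral.
Variable R : realType.
Local Notation C := R[i].
Local Notation mu := (@lebesgue_measure R).
Implicit Types (a b c t : R) (phi psi : R -> C).

Definition rint a b (f : R -> R) : R := Rintegral mu `[a, b] f.

Definition cint a b (phi : R -> C) : C :=
  rint a b (fun t => complex.Re (phi t)) +i* rint a b (fun t => complex.Im (phi t)).

(** The increment [s] may lead outside [a, b], so at the endpoints this is two-sided continuity,
    stronger than continuity within the segment. The integrands here are continuous beyond the
    segment, and endpoints then need no separate treatment. *)
Definition ccont a b phi := forall t, a <= t <= b -> forall e, 0 < e ->
  exists2 r, 0 < r & forall s, `|s| < r -> cabs (phi (t + s) - phi t) <= e.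

Lemma ccont_sub a b a' b' phi : a <= a' -> b' <= b -> ccont a b phi -> ccont a' b' phi.
Proof. by move=> aa bb H t /andP[h1 h2]; apply: H; lra. Qed.

Lemma ccont_cst a b (k : C) : ccont a b (fun=> k).
Proof. by move=> t _ e e0; exists 1 => // s _; rewrite subrr cabs0 ltW. Qed.

Lemma ccontD a b phi psi : ccont a b phi -> ccont a b psi ->
  ccont a b (fun t => phi t + psi t).
Proof.
move=> H1 H2 t tab e e0; have e2 : 0 < e / 2 by lra.
have [r1 r10 P1] := H1 t tab _ e2; have [r2 r20 P2] := H2 t tab _ e2.
exists (Num.min r1 r2) => [|s]; rewrite lt_min; first by rewrite r10.
move=> /andP[s1 s2]; have := P1 s s1; have := P2 s s2 => h2 h1.
have -> : phi (t + s) + psi (t + s) - (phi t + psi t) =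
  (phi (t + s) - phi t) + (psi (t + s) - psi t) by ring.
by rewrite (le_trans (cabsD _ _)) //; lra.
Qed.

Lemma ccontZ a b (k : C) phi : ccont a b phi -> ccont a b (fun t => k * phi t).
Proof.
move=> H t tab e e0.
have M0 : 0 < 1 + cabs k by rewrite ltr_pwDl.
have e1 : 0 < e / (1 + cabs k) by rewrite divr_gt0.
have [r r0 rP] := H t tab _ e1; exists r => // s /rP.
rewrite -mulrBr cabsM ler_pdivlMr // => h.
rewrite (le_trans _ h) // mulrC ler_wpM2l //; lra.
Qed.

Lemma ccontB a b phi psi : ccont a b phi -> ccont a b psi ->
  ccont a b (fun t => phi t - psi t).
Proof.
move=> H1 H2; have := ccontD H1 (ccontZ (-1) H2).
by congr ccont; apply/funext => t; rewrite mulN1r.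
Qed.

Lemma ccont_opp a b phi : ccont (- b) (- a) phi -> ccont a b (fun t => phi (- t)).
Proof.
move=> H t /andP[t1 t2] e e0; have [|r r0 rP] := H (- t) _ e e0; first lra.
by exists r => // s sr; rewrite opprD rP // normrN.
Qed.

Lemma ccont_comp (f : C -> C) (z k : C) a b :
  (forall t, a <= t <= b -> exists d, cdiff f (z + k * t%:C) d) ->
  ccont a b (fun t => f (z + k * t%:C)).
Proof.
move=> H t /H[d Hd] e e0; have [r r0 rP] := cdiff_cont Hd e0.
have M0 : 0 < 1 + cabs k by rewrite ltr_pwDl.
exists (r / (1 + cabs k)) => [|s]; first by rewrite divr_gt0.
rewrite ltr_pdivlMr // => sr.
have -> : z + k * (t + s)%:C = z + k * t%:C + k * s%:C by rewrite rmorphD /=; ring.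
apply: rP; rewrite cabsM cabs_real (le_lt_trans _ sr) // mulrC ler_wpM2l //; lra.
Qed.

Lemma within_cont_seg a b (f : R -> R) :
  (forall t, a <= t <= b -> forall e, 0 < e ->
  exists2 r, 0 < r & forall s, `|s| < r -> `|f (t + s) - f t| <= e) ->
  {within `[a, b], continuous f}.
Proof.
move=> H; apply: continuous_in_subspaceT => t /set_mem /= /[!in_itv] /= tab.
apply/cvgrPdist_le => e e0; have [r r0 rP] := H t tab e e0.
apply/nbhs_ballP; exists r => // s; rewrite /= => ts.
by rewrite distrC; have := rP (s - t); rewrite (addrC t) subrK; apply; rewrite distrC.
Qed.

Lemma integrable_seg a b (f : R -> R) :
  {within `[a, b], continuous f} -> mu.-integrable `[a, b] (EFin \o f).
Proof. by move=> H; apply: continuous_compact_integrable => //; exact: segment_compact. Qed.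

Lemma ccont_Re a b phi : ccont a b phi ->
  {within `[a, b], continuous (fun t => complex.Re (phi t))}.
Proof.
move=> H; apply: within_cont_seg => t tab e e0; have [r r0 rP] := H t tab e e0.
exists r => // s sr; rewrite -cReN -cReD; exact: le_trans (Re_le_cabs _) (rP s sr).
Qed.

Lemma ccont_Im a b phi : ccont a b phi ->
  {within `[a, b], continuous (fun t => complex.Im (phi t))}.
Proof.
move=> H; apply: within_cont_seg => t tab e e0; have [r r0 rP] := H t tab e e0.
exists r => // s sr; rewrite -cImN -cImD; exact: le_trans (Im_le_cabs _) (rP s sr).
Qed.

Lemma ccont_cabs a b phi : ccont a b phi ->
  {within `[a, b], continuous (fun t => cabs (phi t))}.
Proof.
move=> H; apply: within_cont_seg => t tab e e0; have [r r0 rP] := H t tab e e0.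
exists r => // s /rP; apply: le_trans; rewrite ler_norml.
have := cabsD (phi (t + s) - phi t) (phi t); rewrite subrK.
have := cabsD (phi t - phi (t + s)) (phi (t + s)); rewrite subrK cabsBC; lra.
Qed.

Lemma itv_measurable a b : measurable (`[a, b]%classic : set R).
Proof. exact: measurable_itv. Qed.
Hint Resolve itv_measurable : core.

Lemma eq_rint a b (f g : R -> R) : (forall t, a <= t <= b -> f t = g t) ->
  rint a b f = rint a b g.
Proof.
by move=> H; apply: eq_Rintegral => t /set_mem /= /[!in_itv] /= /H.
Qed.

Lemma eq_cint a b phi psi : (forall t, a <= t <= b -> phi t = psi t) ->
  cint a b phi = cint a b psi.
Proof. by move=> H; congr (_ +i* _); apply: eq_rint => t /H ->. Qed.

Lemma rint_cst a b k : a <= b -> rint a b (fun=> k) = k * (b - a).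
Proof.
move=> ab; rewrite /rint Rintegral_cst //; congr (_ * _).
rewrite (_ : fine _ = fine (mu `[a, b]%classic)) // lebesgue_measure_itv /= lte_fin.
by move: ab; rewrite le_eqVlt => /orP[/eqP ->|->]; rewrite ?ltxx ?subrr.
Qed.

Lemma le_rint a b (f g : R -> R) :
  {within `[a, b], continuous f} -> {within `[a, b], continuous g} ->
  (forall t, a <= t <= b -> f t <= g t) -> rint a b f <= rint a b g.
Proof.
by move=> cf cg H; apply: le_Rintegral => //; exact: integrable_seg.
Qed.

Lemma cintD a b phi psi : ccont a b phi -> ccont a b psi ->
  cint a b (fun t => phi t + psi t) = cint a b phi + cint a b psi.
Proof.
move=> H1 H2; rewrite /cint; apply/eqP; rewrite eq_complex /= /rint.
under eq_Rintegral do rewrite cReD.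
under [X in _ && (X == _)]eq_Rintegral do rewrite cImD.
rewrite !RintegralD ?eqxx //; apply: integrable_seg;
 solve [exact: ccont_Re|exact: ccont_Im].
Qed.

Lemma cintZ a b (k : C) phi : ccont a b phi ->
  cint a b (fun t => k * phi t) = k * cint a b phi.
Proof.
move=> H; rewrite /cint; apply/eqP; rewrite eq_complex /= /rint.
have iR : mu.-integrable `[a, b] (EFin \o (fun t => complex.Re (phi t))).
  by apply: integrable_seg; exact: ccont_Re.
have iI : mu.-integrable `[a, b] (EFin \o (fun t => complex.Im (phi t))).
  by apply: integrable_seg; exact: ccont_Im.
have iZ (x : R) (f : R -> R) : mu.-integrable `[a, b] (EFin \o f) ->
    mu.-integrable `[a, b] (EFin \o (fun t => x * f t)).
  by move=> i; apply: eq_integrable (integrableZl _ x i) => // t _; rewrite /= EFinM.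
under eq_Rintegral do rewrite cReM.
under [X in _ && (X == _)]eq_Rintegral do rewrite cImM.
rewrite RintegralB ?RintegralD //; try exact: iZ.
rewrite !RintegralZl //.
by case: k => k1 k2 /=; rewrite !eqxx.
Qed.

Lemma cintB a b phi psi : ccont a b phi -> ccont a b psi ->
  cint a b (fun t => phi t - psi t) = cint a b phi - cint a b psi.
Proof.
move=> H1 H2.
transitivity (cint a b (fun t => phi t + (-1) * psi t)).
  by apply: eq_cint => t _; rewrite mulN1r.
by rewrite cintD // ?cintZ // ?mulN1r //; exact: ccontZ.
Qed.

Lemma cint_cst a b (k : C) : a <= b -> cint a b (fun=> k) = k * (b - a)%:C.
Proof.
move=> ab; rewrite /cint !rint_cst //; apply/eqP; rewrite eq_complex.
by rewrite cReM cImM /= !mulr0 subr0 add0r !eqxx.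
Qed.

Lemma rint_split a b c (f : R -> R) : a <= b -> b <= c ->
  {within `[a, c], continuous f} -> rint a c f = rint a b f + rint b c f.
Proof.
move=> ab bc cf.
have := @Rintegral_itvB R f (BLeft a) (BRight c) b (integrable_seg cf).
rewrite !bnd_simp => /(_ ab bc); rewrite Rintegral_itv_obnd_cbnd.
  by rewrite /rint => <-; ring.
apply: integrableS (integrable_seg cf) => //.
by apply: subset_itv => //; rewrite bnd_simp.
Qed.

Lemma cint_split a b c phi : a <= b -> b <= c -> ccont a c phi ->
  cint a c phi = cint a b phi + cint b c phi.
Proof.
move=> ab bc H; rewrite /cint (rint_split ab bc (ccont_Re H)).
by rewrite (rint_split ab bc (ccont_Im H)).
Qed.

(* The factor 2 comes from treating real and imaginary parts separately. *)
Lemma cabs_cint a b phi : ccont a b phi ->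
  cabs (cint a b phi) <= 2 * rint a b (fun t => cabs (phi t)).
Proof.
move=> H; rewrite (le_trans (cabs_le_ReIm _)) //= mulr2n mulrDl mul1r.
have iA : mu.-integrable `[a, b] (EFin \o (fun t => cabs (phi t))).
  by apply: integrable_seg; exact: ccont_cabs.
have iR : mu.-integrable `[a, b] (EFin \o (fun t => complex.Re (phi t))).
  by apply: integrable_seg; exact: ccont_Re.
have iI : mu.-integrable `[a, b] (EFin \o (fun t => complex.Im (phi t))).
  by apply: integrable_seg; exact: ccont_Im.
apply: lerD; (apply: le_trans; [exact: le_normr_Rintegral|]); apply: le_Rintegral => //.
- exact: integrable_norm iR.
- by move=> t _; exact: Re_le_cabs.
- exact: integrable_norm iI.
- by move=> t _; exact: Im_le_cabs.
Qed.

Lemma cint_bound a b phi M : a <= b -> ccont a b phi ->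
  (forall t, a <= t <= b -> cabs (phi t) <= M) ->
  cabs (cint a b phi) <= 2 * M * (b - a).
Proof.
move=> ab H HM; rewrite (le_trans (cabs_cint H)) // -mulrA ler_wpM2l //.
rewrite -rint_cst //; apply: le_rint => //; first exact: ccont_cabs.
by move=> x; exact: cst_continuous.
Qed.

Lemma cint_opp a b phi : a <= b -> ccont (- b) (- a) phi ->
  cint a b (fun t => phi (- t)) = cint (- b) (- a) phi.
Proof.
move=> ab H; rewrite /cint /rint /Rintegral.
rewrite (integration_by_substitution_oppr ab (ccont_Re H)).
by rewrite (integration_by_substitution_oppr ab (ccont_Im H)).
Qed.

End Integral.

(** * Subdivision of rectangles *)

Section Bisection.
Variable R : realType.
Implicit Types (x y l d : R).

Lemma nested_point (u : nat -> R) (L : R) :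
  (forall n, u n <= u n.+1) ->
  (forall n, u n.+1 + L / 2 ^+ n.+1 <= u n + L / 2 ^+ n) -> 0 <= L ->
  exists x, forall n, u n <= x <= u n + L / 2 ^+ n.
Proof.
move=> u1 u2 L0.
have um n k : u n <= u (n + k)%N.
  by elim: k => [|k IH]; [rewrite addn0|rewrite addnS (le_trans IH)].
have vm n k : u (n + k)%N + L / 2 ^+ (n + k) <= u n + L / 2 ^+ n.
  by elim: k => [|k IH]; [rewrite addn0|rewrite addnS (le_trans _ IH)].
have uv n k : u n <= u k + L / 2 ^+ k.
  have [nk|/ltnW kn] := leqP n k.
    by rewrite -(subnKC nk) (le_trans (um n (k - n)%N)) // lerDl divr_ge0 // exprn_ge0.
  rewrite -(subnKC kn); apply: le_trans (vm k (n - k)%N).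
  by rewrite lerDl divr_ge0 // exprn_ge0.
pose S := [set u n | n in setT].
have S0 : S !=set0 by exists (u 0%N); exists 0%N.
exists (sup S) => n; apply/andP; split.
  apply: ub_le_sup; last by exists n.
  by exists (u 0%N + L / 2 ^+ 0) => _ [k _ <-].
by apply: ge_sup => // _ [k _ <-].
Qed.

Variables (A B : R) (A0 : 0 < A) (B0 : 0 < B).

(** Compactness of a rectangle in the form of an induction principle: a failure at scale 1 would
    pass to ever smaller quarters, which shrink to a point where the local hypothesis forbids it.
    Besides Goursat's theorem it gives boundedness and uniform continuity on squares. *)
Lemma bisection (P : R -> R -> R -> Prop) (x0 y0 : R) :
  (forall x y l, 0 < l ->
     P x y (l / 2) -> P (x + A * (l / 2)) y (l / 2) ->
     P x (y + B * (l / 2)) (l / 2) -> P (x + A * (l / 2)) (y + B * (l / 2)) (l / 2) ->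
     P x y l) ->
  (forall x y, x0 <= x <= x0 + A -> y0 <= y <= y0 + B -> exists2 d, 0 < d &
     forall x' y' l, 0 < l < d -> x' <= x <= x' + A * l -> y' <= y <= y' + B * l ->
     P x' y' l) ->
  P x0 y0 1.
Proof.
move=> Hs Hl; apply: contrapT => nP.
(* [Q] asks for a failing quarter [t] only when [s] itself fails, so a total choice function
   exists. *)
pose Q (s : R * R * nat) (t : R * R) :=
  ~ P s.1.1 s.1.2 (1 / 2 ^+ s.2) -> [/\ ~ P t.1 t.2 (1 / 2 ^+ s.2.+1),
   s.1.1 <= t.1 <= s.1.1 + A * (1 / 2 ^+ s.2.+1) &
   s.1.2 <= t.2 <= s.1.2 + B * (1 / 2 ^+ s.2.+1)].
have [f fP] : {f : _ & forall s, Q s (f s)}.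
  apply: boolp.choice => -[[x y] n]; rewrite /Q /=.
  have [p|np] := pselect (P x y (1 / 2 ^+ n)); first by exists (x, y).
  have l0 : 0 < 1 / 2 ^+ n :> R by rewrite divr_gt0 // exprn_gt0.
  have lE : 1 / 2 ^+ n.+1 = (1 / 2 ^+ n) / 2 :> R by rewrite exprSr invfM mulrA.
  rewrite lE; set l := 1 / 2 ^+ n in l0 np *.
  have a0 : 0 < A * (l / 2) by rewrite mulr_gt0 // divr_gt0.
  have b0 : 0 < B * (l / 2) by rewrite mulr_gt0 // divr_gt0.
  apply: contrapT => H; apply: np; apply: Hs => //; apply: contrapT => np; apply: H.
  - by exists (x, y) => _; split => //=; lra.
  - by exists (x + A * (l / 2), y) => _; split => //=; lra.
  - by exists (x, y + B * (l / 2)) => _; split => //=; lra.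
  - by exists (x + A * (l / 2), y + B * (l / 2)) => _; split => //=; lra.
pose s := fix s n := if n is k.+1 then f (s k, k) else (x0, y0).
have sP n : ~ P (s n).1 (s n).2 (1 / 2 ^+ n).
  elim: n => [|n IH]; first by rewrite expr0 divr1.
  by have [] := fP (s n, n) IH.
have s1 n : (s n).1 <= (s n.+1).1 <= (s n).1 + A / 2 ^+ n.+1.
  by have [_] := fP (s n, n) (sP n); rewrite /= mul1r.
have s2 n : (s n).2 <= (s n.+1).2 <= (s n).2 + B / 2 ^+ n.+1.
  by have [_ _] := fP (s n, n) (sP n); rewrite /= mul1r.
have hE (L : R) n : L / 2 ^+ n = L / 2 ^+ n.+1 + L / 2 ^+ n.+1.
  by rewrite exprSr invfM mulrA; lra.
have [||| x xP] := @nested_point (fun n => (s n).1) A.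
- by move=> n; have /andP[] := s1 n.
- by move=> n; rewrite (hE A n); have := s1 n; lra.
- exact: ltW.
have [||| y yP] := @nested_point (fun n => (s n).2) B.
- by move=> n; have /andP[] := s2 n.
- by move=> n; rewrite (hE B n); have := s2 n; lra.
- exact: ltW.
have [||d d0 dP] := Hl x y.
- by have := xP 0%N; rewrite expr0 divr1.
- by have := yP 0%N; rewrite expr0 divr1.
have [n _ /(_ n (leqnn n)) /= nd] := near_infty_natSinv_expn_lt (PosNum d0).
apply: (sP n); apply: dP; first by rewrite nd andbT divr_gt0 // exprn_gt0.
- by rewrite mul1r.
- by rewrite mul1r.
Qed.

End Bisection.

(** * Goursat's theorem on rectangles *)

Section Goursat.
Variable R : realType.
Local Notation C := R[i].
Implicit Types (x y a b s t u v : R) (f h K T : C -> C).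

Lemma ccont_horizontal h a b y :
  (forall t, a <= t <= b -> exists d, cdiff h (t +i* y) d) ->
  ccont a b (fun t => h (t +i* y)).
Proof.
have E t : t +i* y = (0 +i* y) + 1 * t%:C :> C.
  by apply/eqP; rewrite eq_complex /=; apply/andP; split; apply/eqP; ring.
move=> H; have -> : (fun t => h (t +i* y)) = (fun t => h ((0 +i* y) + 1 * t%:C)).
  by apply/funext => t; rewrite E.
by apply: ccont_comp => t /H[d Hd]; exists d; rewrite -E.
Qed.

Lemma ccont_vertical h a b x :
  (forall t, a <= t <= b -> exists d, cdiff h (x +i* t) d) ->
  ccont a b (fun t => h (x +i* t)).
Proof.
have E t : x +i* t = (x +i* 0) + iu * t%:C :> C.
  by apply/eqP; rewrite eq_complex /=; apply/andP; split; apply/eqP; ring.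
move=> H; have -> : (fun t => h (x +i* t)) = (fun t => h ((x +i* 0) + iu * t%:C)).
  by apply/funext => t; rewrite E.
by apply: ccont_comp => t /H[d Hd]; exists d; rewrite -E.
Qed.

Definition diff_on_rect h x y a b := forall u v, x <= u <= x + a -> y <= v <= y + b ->
  exists d, cdiff h (u +i* v) d.

(** The counterclockwise boundary integral of [h], with opposite sides paired under one integral
    sign. *)
Definition rect_int h x y a b : C :=
  cint x (x + a) (fun t => h (t +i* y) - h (t +i* (y + b))) +
  iu * cint y (y + b) (fun t => h ((x + a) +i* t) - h (x +i* t)).

Lemma rect_ccont_h h x y a b v : diff_on_rect h x y a b -> y <= v <= y + b ->
  ccont x (x + a) (fun t => h (t +i* v)).
Proof. by move=> H yv; apply: ccont_horizontal => t xt; exact: H. Qed.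

Lemma rect_ccont_v h x y a b u : diff_on_rect h x y a b -> x <= u <= x + a ->
  ccont y (y + b) (fun t => h (u +i* t)).
Proof. by move=> H xu; apply: ccont_vertical => t yt; exact: H. Qed.

Lemma rect_int_splitx h x y a a' b : 0 <= a -> 0 <= a' -> 0 <= b ->
  diff_on_rect h x y (a + a') b ->
  rect_int h x y (a + a') b = rect_int h x y a b + rect_int h (x + a) y a' b.
Proof.
move=> a0 a'0 b0 H; rewrite /rect_int.
have cv u : x <= u <= x + (a + a') -> ccont y (y + b) (fun t => h (u +i* t)).
  exact: rect_ccont_v.
rewrite (@cint_split _ x (x + a) (x + (a + a'))); [|lra|lra|]; last first.
  by apply: ccontB; apply: (rect_ccont_h H); lra.
rewrite (addrA x a a').
have -> : cint y (y + b) (fun t => h ((x + a + a') +i* t) - h (x +i* t)) =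
  cint y (y + b) (fun t => h ((x + a) +i* t) - h (x +i* t)) +
  cint y (y + b) (fun t => h ((x + a + a') +i* t) - h ((x + a) +i* t)).
  rewrite -cintD; [by apply: eq_cint => t _; ring| |]; apply: ccontB; apply: cv; lra.
ring.
Qed.

Lemma rect_int_splity h x y a b b' : 0 <= a -> 0 <= b -> 0 <= b' ->
  diff_on_rect h x y a (b + b') ->
  rect_int h x y a (b + b') = rect_int h x y a b + rect_int h x (y + b) a b'.
Proof.
move=> a0 b0 b'0 H; rewrite /rect_int.
have ch v : y <= v <= y + (b + b') -> ccont x (x + a) (fun t => h (t +i* v)).
  exact: rect_ccont_h.
rewrite (@cint_split _ y (y + b) (y + (b + b'))); [|lra|lra|]; last first.
  by apply: ccontB; apply: (rect_ccont_v H); lra.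
rewrite (addrA y b b').
have -> : cint x (x + a) (fun t => h (t +i* y) - h (t +i* (y + b + b'))) =
  cint x (x + a) (fun t => h (t +i* y) - h (t +i* (y + b))) +
  cint x (x + a) (fun t => h (t +i* (y + b)) - h (t +i* (y + b + b'))).
  rewrite -cintD; [by apply: eq_cint => t _; ring| |]; apply: ccontB; apply: ch; lra.
ring.
Qed.

Lemma diff_on_rect_sub h x y a b x' y' a' b' : diff_on_rect h x y a b ->
  x <= x' -> x' + a' <= x + a -> y <= y' -> y' + b' <= y + b ->
  diff_on_rect h x' y' a' b'.
Proof. move=> H h1 h2 h3 h4 u v hu hv; apply: H; lra. Qed.

Lemma cdiff_remainder h z d e : cdiff h z d -> 0 < e -> exists2 r, 0 < r &
  forall w, cabs (w - z) < r -> cabs (h w - h z - d * (w - z)) <= e * cabs (w - z).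
Proof.
move=> H e0; have [r r0 rP] := H e e0; exists r => // w /rP.
by rewrite (addrC z) subrK.
Qed.

(** The affine function w -> h(z) + d (w - z) has boundary integral 0, so only the remainder counts.
    Each paired integrand is then at most 2 M, and the factor 2 of [cint_bound] makes this 4 M. *)
Lemma rect_int_local h x y a b z d M :
  0 <= a -> 0 <= b -> diff_on_rect h x y a b ->
  (forall u v, x <= u <= x + a -> y <= v <= y + b ->
     cabs (h (u +i* v) - h z - d * ((u +i* v) - z)) <= M) ->
  cabs (rect_int h x y a b) <= 4 * M * (a + b).
Proof.
move=> a0 b0 H HM.
have chy : ccont x (x + a) (fun t => h (t +i* y) - h (t +i* (y + b))).
  by apply: ccontB; apply: (rect_ccont_h H); lra.
have cvx : ccont y (y + b) (fun t => h ((x + a) +i* t) - h (x +i* t)).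
  by apply: ccontB; apply: (rect_ccont_v H); lra.
(* [k1] and [k2] are the differences of the affine part across the two pairs of sides; the
   contributions a [k1] and i b [k2] cancel. *)
pose k1 : C := - (iu * b%:C * d); pose k2 : C := a%:C * d.
have -> : rect_int h x y a b =
   cint x (x + a) (fun t => h (t +i* y) - h (t +i* (y + b)) - k1) +
  iu * cint y (y + b) (fun t => h ((x + a) +i* t) - h (x +i* t) - k2).
  rewrite (cintB chy (@ccont_cst _ _ _ k1)) (cintB cvx (@ccont_cst _ _ _ k2)).
  rewrite !cint_cst; [|lra|lra]; rewrite /rect_int /k1 /k2.
  have -> : x + a - x = a by ring.
  have -> : y + b - y = b by ring.
  ring.
have B1 : cabs (cint x (x + a) (fun t => h (t +i* y) - h (t +i* (y + b)) - k1))
    <= 2 * (M + M) * (x + a - x).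
  apply: cint_bound; [lra|by apply: ccontB => //; exact: ccont_cst|move=> t tx].
  have -> : h (t +i* y) - h (t +i* (y + b)) - k1 =
     (h (t +i* y) - h z - d * ((t +i* y) - z)) -
     (h (t +i* (y + b)) - h z - d * ((t +i* (y + b)) - z)).
    have -> : t +i* (y + b) = t +i* y + iu * b%:C :> C.
      by apply/eqP; rewrite eq_complex /=; apply/andP; split; apply/eqP; ring.
    rewrite /k1; ring.
  by apply: le_trans (cabsB _ _) _; apply: lerD; apply: HM; lra.
have B2 : cabs (cint y (y + b) (fun t => h ((x + a) +i* t) - h (x +i* t) - k2))
    <= 2 * (M + M) * (y + b - y).
  apply: cint_bound; [lra|by apply: ccontB => //; exact: ccont_cst|move=> t tx].
  have -> : h ((x + a) +i* t) - h (x +i* t) - k2 =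
     (h ((x + a) +i* t) - h z - d * (((x + a) +i* t) - z)) -
     (h (x +i* t) - h z - d * ((x +i* t) - z)).
    have -> : (x + a) +i* t = x +i* t + a%:C :> C.
      by apply/eqP; rewrite eq_complex /=; apply/andP; split; apply/eqP; ring.
    rewrite /k2; ring.
  by apply: le_trans (cabsB _ _) _; apply: lerD; apply: HM; lra.
apply: le_trans (cabsD _ _) _; rewrite cabsM cabs_i mul1r.
have -> : 4 * M * (a + b) = 2 * (M + M) * (x + a - x) + 2 * (M + M) * (y + b - y) by ring.
exact: lerD.
Qed.

Lemma le_eps_eq0 x k : 0 <= x -> (forall e, 0 < e -> x <= k * e) -> x = 0.
Proof.
move=> x0 H; apply/eqP; rewrite eq_le x0 andbT leNgt; apply/negP => xp.
have k1 : 0 < 1 + `|k| by rewrite ltr_pwDl.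
have e0 : 0 < x / (2 * (1 + `|k|)) by rewrite divr_gt0 // mulr_gt0.
have := H _ e0; rewrite mulrA ler_pdivlMr ?mulr_gt0 //.
have := ler_norm k; nra.
Qed.

Theorem goursat h x y a b : 0 < a -> 0 < b -> diff_on_rect h x y a b ->
  rect_int h x y a b = 0.
Proof.
move=> a0 b0 H; apply/eqP; rewrite -cabs_eq0; apply/eqP.
apply: (@le_eps_eq0 _ 1) => // e e0.
(* The bound is proportional to the area, so four quarters with e (l/2)^2 add up to e l^2.
   Containment in the original rectangle is a premise of [P] because [bisection] ranges over all
   rectangles. *)
pose P x' y' l := x <= x' -> x' + a * l <= x + a -> y <= y' -> y' + b * l <= y + b ->
  cabs (rect_int h x' y' (a * l) (b * l)) <= e * l ^+ 2.
suff : P x y 1 by rewrite /P !mulr1 expr1n mulr1 mul1r; apply.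
apply: (bisection a0 b0).
- move=> x' y' l l0 P1 P2 P3 P4 h1 h2 h3 h4.
  have al : 0 < a * (l / 2) by rewrite mulr_gt0 // divr_gt0.
  have bl : 0 < b * (l / 2) by rewrite mulr_gt0 // divr_gt0.
  have aE : a * l = a * (l / 2) + a * (l / 2) by rewrite -mulrDr -splitr.
  have bE : b * l = b * (l / 2) + b * (l / 2) by rewrite -mulrDr -splitr.
  rewrite aE bE in h2 h4 *.
  have {}P1 : cabs (rect_int h x' y' (a * (l / 2)) (b * (l / 2))) <= e * (l / 2) ^+ 2.
    by apply: P1 => {P2 P3 P4}; lra.
  have {}P2 : cabs (rect_int h (x' + a * (l / 2)) y' (a * (l / 2)) (b * (l / 2)))
      <= e * (l / 2) ^+ 2.
    by apply: P2 => {P3 P4}; lra.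
  have {}P3 : cabs (rect_int h x' (y' + b * (l / 2)) (a * (l / 2)) (b * (l / 2)))
      <= e * (l / 2) ^+ 2.
    by apply: P3 => {P4}; lra.
  have {}P4 : cabs (rect_int h (x' + a * (l / 2)) (y' + b * (l / 2)) (a * (l / 2)) (b * (l / 2)))
      <= e * (l / 2) ^+ 2.
    by apply: P4; lra.
  have l2 : e * l ^+ 2 =
      e * (l / 2) ^+ 2 + e * (l / 2) ^+ 2 + (e * (l / 2) ^+ 2 + e * (l / 2) ^+ 2).
    by field.
  rewrite l2 {l2 aE bE}; move: {P} al bl h2 h4 P1 P2 P3 P4.
  set al := a * (l / 2); set bl := b * (l / 2); move: al bl => al bl al0 bl0 h2 h4 P1 P2 P3 P4.
  have d1 : diff_on_rect h x' y' (al + al) (bl + bl) by apply: (diff_on_rect_sub H) => //; lra.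
  have d2 : diff_on_rect h x' y' al (bl + bl) by apply: (diff_on_rect_sub d1) => //; lra.
  have d3 : diff_on_rect h (x' + al) y' al (bl + bl) by apply: (diff_on_rect_sub d1) => //; lra.
  have al1 := ltW al0; have bl1 := ltW bl0.
  rewrite rect_int_splitx // ?addr_ge0 // rect_int_splity // [X in _ + X]rect_int_splity //.
  by apply: le_trans (cabsD _ _) _; apply: lerD;
   (apply: le_trans (cabsD _ _) _; apply: lerD).
- move=> u v hu hv; have [d Hd] := H u v hu hv.
  have ab0 : 0 < a + b by lra.
  (* Points of a rectangle of scale l are within l (a + b) of each other, so the local bound with
     this remainder comes out as exactly e l^2. *)
  have e1 : 0 < e / (4 * (a + b) ^+ 2) by rewrite divr_gt0 // mulr_gt0 // exprn_gt0.
  have [r r0 rP] := cdiff_remainder Hd e1.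
  exists (r / (a + b)); first by rewrite divr_gt0.
  move=> x' y' l /andP[l0]; rewrite ltr_pdivlMr // => lr hu' hv' h1 h2 h3 h4.
  have al : 0 < a * l by rewrite mulr_gt0.
  have bl : 0 < b * l by rewrite mulr_gt0.
  have dsub := diff_on_rect_sub H h1 h2 h3 h4.
  have -> : e * l ^+ 2 = 4 * (e / (4 * (a + b) ^+ 2) * (l * (a + b))) * (a * l + b * l).
    by field; lra.
  apply: (@rect_int_local h x' y' _ _ (u +i* v) d); [lra|lra|exact: dsub|].
  move=> u' v' hu1 hv1.
  have D : cabs ((u' +i* v') - (u +i* v)) <= l * (a + b).
    apply: le_trans (cabs_le_ReIm _) _ => /=.
    have : `|u' - u| <= a * l by rewrite ler_norml; lra.
    have : `|v' - v| <= b * l by rewrite ler_norml; lra.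
    lra.
  apply: le_trans (rP _ _) _; first by apply: le_lt_trans D _.
  by rewrite ler_wpM2l // ltW.
Qed.

End Goursat.

(** * Integrals over the boundary of a square *)

Section CauchySquare.
Variable R : realType.
Local Notation C := R[i].
Implicit Types (x y a b s t u : R) (v : C) (f h K T : C -> C).

Definition side_int T s : C := cint (- s) s (fun t => T (s +i* t)).

(* The boundary of the square of half-side s is the side s + i[-s, s] and its images under
   multiplication by powers of i; so -i times the boundary integral of K is the integral
   of symm4 K over the single side s + i[-s, s]. *)
Definition symm4 K (v : C) : C := K v + iu * K (iu * v) - K (- v) - iu * K (- (iu * v)).

Lemma i_mul_i (v : C) : iu * (iu * v) = - v.
Proof. by case: v => a b; apply/eqP; rewrite eq_complex /=; apply/andP; split; apply/eqP; ring. Qed.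

Lemma i_neq0 : (iu : R[i]) != 0.
Proof. by rewrite -cabs_gt0 cabs_i ltr01. Qed.

Lemma symm4_i K v : iu * symm4 K (iu * v) = symm4 K v.
Proof.
rewrite /symm4 !i_mul_i opprK !(mulrDr, mulrN, i_mul_i).
ring.
Qed.

(** The frame between the squares of half-sides s' and s is a pinwheel of four rectangles, the
    images of [s', s] + i[-s, s'] under powers of i. By the symmetry of [T], Goursat on this one
    rectangle is enough: its bottom side completes the right side to s + i[-s, s], and its top side
    trims the left side to s' + i[-s', s']. *)
Lemma side_int_const T s s' : (forall v, v != 0 -> exists d, cdiff T v d) ->
  (forall v, iu * T (iu * v) = T v) -> 0 < s' -> s' < s -> side_int T s = side_int T s'.
Proof.
move=> dT Ti s'0 s's.
have H : diff_on_rect T s' (- s) (s - s') (s + s').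
  move=> u w hu hw; apply: dT; rewrite eq_complex /= negb_and.
  by apply/orP; left; apply/eqP; lra.
have /(_ _ _ H) := @goursat R T s' (- s) (s - s') (s + s').
move=> /(_ ltac:(lra) ltac:(lra)).
rewrite /rect_int.
have -> : s' + (s - s') = s by ring.
have -> : - s + (s + s') = s' by ring.
have cv u : s' <= u <= s -> ccont (- s) s (fun t => T (u +i* t)).
  move=> hu; apply: ccont_vertical => t _; apply: dT; rewrite eq_complex /= negb_and.
  by apply/orP; left; apply/eqP; lra.
have cs : ccont (- s) s (fun t => T (s +i* t)) by apply: cv; lra.
have cs' : ccont (- s) s (fun t => T (s' +i* t)) by apply: cv; lra.
have cs0 : ccont s' s (fun t => T (s +i* t)) by apply: ccont_sub cs; lra.
have cs2 : ccont s' s (fun t => T (s' +i* (- t))).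
  by apply: (@ccont_opp _ s' s (fun t => T (s' +i* t))); apply: ccont_sub cs'; lra.
have -> : cint s' s (fun t => T (t +i* (- s)) - T (t +i* s')) =
   cint s' s (fun t => iu * T (s +i* t) + iu * T (s' +i* (- t))).
  apply: eq_cint => t _.
  have -> : s +i* t = iu * (t +i* (- s)) :> C.
    by apply/eqP; rewrite eq_complex /=; apply/andP; split; apply/eqP; ring.
  have -> : t +i* s' = iu * (s' +i* (- t)) :> C.
    by apply/eqP; rewrite eq_complex /=; apply/andP; split; apply/eqP; ring.
  have := Ti (s' +i* (- t)); set w := s' +i* (- t) => <-.
  by rewrite Ti i_mul_i.
rewrite (cintD (ccontZ iu cs0) (ccontZ iu cs2)) (cintZ iu cs0) (cintZ iu cs2).
rewrite (@cint_opp R s' s (fun t => T (s' +i* t))) ?ltW //; last by apply: ccont_sub cs'; lra.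
rewrite cintB; [|by apply: ccont_sub cs; lra|by apply: ccont_sub cs'; lra].
rewrite /side_int.
rewrite (@cint_split R (- s) s' s (fun t => T (s +i* t))); [|lra|lra|exact: cs].
rewrite (@cint_split R (- s) (- s') s' (fun t => T (s' +i* t))); [|lra|lra|].
  move=> H0; apply/eqP; rewrite -subr_eq0; apply/eqP; apply: (mulfI i_neq0).
  rewrite mulr0 -[RHS]H0; ring.
by apply: ccont_sub cs'; lra.
Qed.

Lemma symm4_cdiff K : (forall v, v != 0 -> exists d, cdiff K v d) ->
  forall v, v != 0 -> exists d, cdiff (symm4 K) v d.
Proof.
move=> dK v v0.
have nv0 : - v != 0 by rewrite oppr_eq0.
have iv0 : iu * v != 0 by rewrite mulf_neq0 ?i_neq0.
have niv0 : - (iu * v) != 0 by rewrite oppr_eq0.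
have [d1 D1] := dK v v0; have [d2 D2] := dK _ iv0.
have [d3 D3] := dK _ nv0; have [d4 D4] := dK _ niv0.
have Di : cdiff (fun w => iu * w) v iu.
  by apply: cdiff_eq (cdiffM (cdiff_cst _ _) (cdiff_id v)) _; ring.
have Dn : cdiff (fun w => - w) v (-1).
  apply: cdiff_ext (cdiff_eq (cdiffM (cdiff_cst (-1) _) (cdiff_id v)) _).
    by move=> w; rewrite mulN1r.
  ring.
have Dni : cdiff (fun w => - (iu * w)) v (- iu).
  apply: cdiff_ext (cdiff_eq (cdiffM (cdiff_cst (- iu) _) (cdiff_id v)) _).
    by move=> w; rewrite mulNr.
  ring.
by eexists; apply: cdiffB; [apply: cdiffB; [apply: cdiffD; [exact: D1|
  apply: cdiffM; [exact: cdiff_cst|exact: cdiff_comp Di D2]]|exact: cdiff_comp Dn D3]|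
  apply: cdiffM; [exact: cdiff_cst|exact: cdiff_comp Dni D4]].
Qed.

Lemma symm4_le K v : cabs (symm4 K v) <=
  cabs (K v) + cabs (K (iu * v)) + cabs (K (- v)) + cabs (K (- (iu * v))).
Proof.
rewrite /symm4; apply: le_trans (cabsB _ _) _; rewrite cabsM cabs_i mul1r lerD2r.
apply: le_trans (cabsB _ _) _; rewrite lerD2r.
by apply: le_trans (cabsD _ _) _; rewrite cabsM cabs_i mul1r.
Qed.

Lemma cabs_iM v : cabs (iu * v : C) = cabs v.
Proof. by rewrite cabsM cabs_i mul1r. Qed.

(** On the side and its rotates s <= |v| <= 2 s. The constant 16 collects 4 terms of [symm4], the
    length 2 s and the factor 2 of [cint_bound]. *)
Lemma side_int_symm4_bound K s M : 0 < s ->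
  (forall v, v != 0 -> exists d, cdiff K v d) ->
  (forall v, s <= cabs v <= 2 * s -> cabs (K v) <= M) ->
  cabs (side_int (symm4 K) s) <= 16 * M * s.
Proof.
move=> s0 dK HM.
have -> : 16 * M * s = 2 * (M + M + M + M) * (s - - s) by ring.
apply: cint_bound; first lra.
  apply: ccont_vertical => t _; apply: symm4_cdiff => //; rewrite eq_complex /= negb_and.
  by rewrite gt_eqF.
move=> t ht; apply: le_trans (symm4_le _ _) _.
have h1 : s <= cabs (s +i* t) <= 2 * s.
  apply/andP; split.
    by apply: le_trans (Re_le_cabs _); rewrite /= ger0_norm // ltW.
  apply: le_trans (cabs_le_ReIm _) _ => /=; rewrite (ger0_norm (ltW s0)).
  have : `|t| <= s by rewrite ler_norml.
  lra.
by rewrite !lerD //; apply: HM; rewrite ?cabsN ?cabs_iM.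
Qed.

(** A singularity of size o(1/|v|) is invisible to the integral: the square may be shrunk without
    changing the value, while the length times the sup tends to 0. *)
Lemma side_int_symm4_eq0 K s : 0 < s ->
  (forall v, v != 0 -> exists d, cdiff K v d) ->
  (forall e, 0 < e -> exists2 r, 0 < r &
     forall v, 0 < cabs v < r -> cabs v * cabs (K v) <= e) ->
  side_int (symm4 K) s = 0.
Proof.
move=> s0 dK HK; apply/eqP; rewrite -cabs_eq0; apply/eqP.
apply: (@le_eps_eq0 _ _ 16) => // e e0; have [r r0 rP] := HK e e0.
(* This gives s' < s for the deformation and 2 s' < r, so that all four rotated sides lie in the
   punctured disc where the hypothesis applies. *)
pose s' := Num.min (s / 2) (r / 3).
have s'0 : 0 < s' by rewrite lt_min !divr_gt0.
have s's : s' <= s / 2 by rewrite ge_min lexx.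
have s'r : s' <= r / 3 by rewrite ge_min lexx orbT.
rewrite (@side_int_const _ s s') //; [|exact: symm4_cdiff|exact: symm4_i|lra].
have -> : 16 * e = 16 * (e / s') * s' by field; rewrite gt_eqF.
apply: side_int_symm4_bound => // v /andP[v1 v2].
have v0 : 0 < cabs v by lra.
rewrite ler_pdivlMr //; apply: le_trans (_ : cabs v * cabs (K v) <= e).
  by rewrite mulrC ler_wpM2r.
apply: rP; lra.
Qed.

Lemma symm4_inv (v : C) : v != 0 -> symm4 (fun w => w^-1) v = 4 * v^-1.
Proof.
move=> v0; rewrite /symm4; field; rewrite v0; exact: i_neq0.
Qed.

(* Replaces the value 2 pi i of the winding integral: a lower bound is enough. *)
Lemma side_int_symm4_inv_ge s : 0 < s ->
  4 <= cabs (side_int (symm4 (fun w => w^-1)) s).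
Proof.
move=> s0.
have n0 t : s +i* t != 0 by rewrite eq_complex /= negb_and gt_eqF.
apply: le_trans (Re_le_cabs _); apply: le_trans (ler_norm _).
have cV : ccont (- s) s (fun t => symm4 (fun w => w^-1) (s +i* t)).
  apply: ccont_vertical => t _; apply: symm4_cdiff => // v v0.
  by eexists; apply: (cdiffV (cdiff_id v)).
(* The real part of the integrand is 4 s / (s^2 + t^2), at least 2 / s because |t| <= s. *)
have -> : 4 = 2 / s * (s - - s) by field; rewrite gt_eqF.
rewrite -rint_cst; last by lra.
apply: le_rint; [by move=> ?; exact: cst_continuous|exact: ccont_Re|].
move=> t ht; rewrite symm4_inv //.
have P : 0 < s ^+ 2 + t ^+ 2 by rewrite ltr_pwDl ?sqr_ge0 // exprn_gt0.
have -> : complex.Re (4 * (s +i* t)^-1) = 4 * (s / (s ^+ 2 + t ^+ 2)).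
  have -> : (4 : C) = (4 : R)%:C by rewrite rmorph_nat.
  by rewrite cReM /= mul0r subr0.
rewrite ler_pdivrMr // mulrA mulrAC ler_pdivlMr //.
nra.
Qed.

End CauchySquare.

(** * Cauchy estimates *)

Section Entire.
Variable R : realType.
Local Notation C := R[i].
Local Notation mu := (@lebesgue_measure R).
Implicit Types (x y s t u e : R) (z w a v d : C) (f g K : C -> C).

Lemma cdiff_shift f a z d : cdiff f (a + z) d -> cdiff (fun w => f (a + w)) z d.
Proof.
move=> H; apply: cdiff_eq (cdiff_comp (cdiffD (cdiff_cst a z) (cdiff_id z)) H) _; ring.
Qed.

Lemma entire_shift f a : entire f -> entire (fun w => f (a + w)).
Proof.
move=> /entireP H; apply: (@cdiff_entire _ _ (fun w => cderiv f (a + w))) => z.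
exact: cdiff_shift.
Qed.

Lemma cauchy_quotient_cdiff f a v : entire f -> v != 0 ->
  exists d, cdiff (fun w => (f (a + w) - f a) * (w ^+ 2)^-1) v d.
Proof.
move=> /entireP ef v0; eexists; apply: cdiffM.
  by apply: cdiffB; [apply: cdiff_shift; exact: ef|exact: cdiff_cst].
by apply: (@cdiffV _ (fun w => w ^+ 2)); [apply: cdiffM; exact: cdiff_id|rewrite expf_neq0].
Qed.

(** The quotient (f(a + w) - f(a)) / w^2 equals f'(a) / w up to o(1/|w|). The error has zero
    integral, so the integral is f'(a) times that of 1/w, whose modulus is at least 4. *)
Lemma cauchy_deriv_side f a s : entire f -> 0 < s ->
  4 * cabs (cderiv f a) <=
  cabs (side_int (symm4 (fun w => (f (a + w) - f a) * (w ^+ 2)^-1)) s).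
Proof.
move=> ef s0.
pose K := fun w => (f (a + w) - f a) * (w ^+ 2)^-1.
pose K0 := fun w => K w - cderiv f a * w^-1.
have dK w : w != 0 -> exists d, cdiff K w d by exact: cauchy_quotient_cdiff.
have dV w : w != 0 -> exists d, cdiff (fun w => w^-1) w d.
  by move=> w0; eexists; apply: (cdiffV (cdiff_id w)).
have dK0 w : w != 0 -> exists d, cdiff K0 w d.
  move=> w0; have [d1 D1] := dK w w0; have [d2 D2] := dV w w0.
  by eexists; apply: cdiffB; [exact: D1|apply: cdiffM; [exact: cdiff_cst|exact: D2]].
have n0 t : s +i* t != 0 by rewrite eq_complex /= negb_and gt_eqF.
have cK : ccont (- s) s (fun t => symm4 K (s +i* t)).
  by apply: ccont_vertical => t _; exact: symm4_cdiff.
have cV : ccont (- s) s (fun t => symm4 (fun w => w^-1) (s +i* t)).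
  by apply: ccont_vertical => t _; exact: symm4_cdiff.
have : side_int (symm4 K0) s = 0.
  apply: side_int_symm4_eq0 => // e e0.
  have /entireP/(_ a)/(_ e e0) [r r0 rP] := ef.
  exists r => // v /andP[v0 vr]; have vn0 : v != 0 by rewrite -cabs_gt0.
  have -> : K0 v = (f (a + v) - f a - cderiv f a * v) * (v ^+ 2)^-1.
    by rewrite /K0 /K; field.
  rewrite cabsM cabsV cabsX.
  have -> : cabs v * (cabs (f (a + v) - f a - cderiv f a * v) / cabs v ^+ 2) =
     cabs (f (a + v) - f a - cderiv f a * v) / cabs v by field; rewrite gt_eqF.
  by rewrite ler_pdivrMr // rP.
have -> : side_int (symm4 K0) s = side_int (symm4 K) s -
   cderiv f a * side_int (symm4 (fun w => w^-1)) s.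
  rewrite /side_int -(cintZ (cderiv f a) cV) -(cintB cK (ccontZ (cderiv f a) cV)).
  by apply: eq_cint => t _; rewrite /symm4 /K0; ring.
move=> /eqP; rewrite subr_eq0 => /eqP ->; rewrite cabsM mulrC ler_wpM2l //.
exact: side_int_symm4_inv_ge.
Qed.

Lemma cauchy_deriv f a s M : entire f -> 0 < s ->
  (forall v, cabs v <= 2 * s -> cabs (f (a + v) - f a) <= M) ->
  cabs (cderiv f a) <= 4 * M / s.
Proof.
move=> ef s0 HM; have := cauchy_deriv_side a ef s0.
have : cabs (side_int (symm4 (fun w => (f (a + w) - f a) * (w ^+ 2)^-1)) s) <=
   16 * (M / s ^+ 2) * s.
  apply: side_int_symm4_bound => // [v|v /andP[v1 v2]]; first exact: cauchy_quotient_cdiff.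
  have v0 : 0 < cabs v by apply: lt_le_trans v1.
  rewrite cabsM cabsV cabsX; apply: ler_pM => //; [by rewrite invr_ge0 exprn_ge0|exact: HM|].
  by rewrite lef_pV2 ?posrE ?exprn_gt0 // ler_pXn2r // nnegrE // ltW.
have -> : 16 * (M / s ^+ 2) * s = 4 * (4 * M / s) by field; rewrite gt_eqF.
move=> h1 h2; have := le_trans h2 h1; lra.
Qed.

Definition symm_abs f z :=
  cabs (f z) + cabs (f (iu * z)) + cabs (f (- z)) + cabs (f (- (iu * z))).

Lemma entire_ccont_symm f s r : entire f ->
  {within `[- r, r], continuous (fun t => symm_abs f (s +i* t))}.
Proof.
move=> /entireP ef.
have cf (k : C) (h : C -> C) : (forall w, k * w = h w) -> ccont (- r) r (fun t => f (h (s +i* t))).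
  move=> /funext <-; apply: (@ccont_vertical _ (fun w => f (k * w))) => t _; eexists.
  apply: cdiff_comp; [|exact: ef].
  by apply: cdiffM; [exact: cdiff_cst|exact: cdiff_id].
have c1 := ccont_cabs (cf 1 (fun w => w) (@mul1r _)).
have c2 := ccont_cabs (cf iu (fun w => iu * w) (fun w => erefl)).
have c3 := ccont_cabs (cf (-1) (fun w => - w) (@mulN1r _)).
have c4 := ccont_cabs (cf (- iu) (fun w => - (iu * w)) (@mulNr _ _)).
move=> t; apply: cvgD; [apply: cvgD; [apply: cvgD|]|].
- exact: c1.
- exact: c2.
- exact: c3.
- exact: c4.
Qed.

(* The derivative at 0 of [w * f w] is [f 0]. *)
Lemma value_bound f s : entire f -> 0 < s ->
  2 * s * cabs (f 0) <= rint (- s) s (fun t => symm_abs f (s +i* t)).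
Proof.
move=> ef s0; pose g w := w * f w; have df := (entireP f).1 ef.
have dg w : cdiff g w (w * cderiv f w + f w * 1).
  by apply: cdiffM; [exact: cdiff_id|exact: df].
have eg : entire g by exact: cdiff_entire dg.
have g0 : cderiv g 0 = f 0 by rewrite (cdiff_unique (dg 0)); ring.
have := cauchy_deriv_side 0 eg s0; rewrite g0.
pose K w := (g (0 + w) - g 0) * (w ^+ 2)^-1.
rewrite -/K; have n0 t : s +i* t != 0 by rewrite eq_complex /= negb_and gt_eqF.
have KE w : w != 0 -> K w = f w * w^-1.
  by move=> w0; rewrite /K /g add0r mul0r subr0; field.
have cK : ccont (- s) s (fun t => symm4 K (s +i* t)).
  apply: ccont_vertical => t _; apply: symm4_cdiff => // w w0.
  exact: cauchy_quotient_cdiff.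
move=> h; have {h} := le_trans h (cabs_cint cK).
have cc := @entire_ccont_symm f s s ef.
move=> h.
have h2 : rint (- s) s (fun t => cabs (symm4 K (s +i* t))) <=
    rint (- s) s (fun t => s^-1 * symm_abs f (s +i* t)).
  apply: le_rint; [exact: ccont_cabs|by move=> t; apply: cvgM; [exact: cvg_cst|exact: cc]|].
  move=> t _; apply: le_trans (symm4_le _ _) _.
  have iv0 : iu * (s +i* t) != 0 by rewrite mulf_neq0 ?i_neq0.
  rewrite !KE // ?oppr_eq0 // !cabsM !cabsV !cabsN !cabs_iM.
  have : (cabs (s +i* t))^-1 <= s^-1.
    rewrite lef_pV2 ?posrE ?cabs_gt0 //.
    by apply: le_trans (Re_le_cabs _); rewrite /= ger0_norm // ltW.
  set k := (cabs (s +i* t))^-1 => hk.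
  by rewrite -!mulrDl mulrC; apply: (ler_wpM2r _ hk); rewrite !addr_ge0.
rewrite [X in _ <= X]RintegralZl // in h2; last exact: integrable_seg.
move: h2 h; rewrite /rint; set I := (X in _ <= s^-1 * X -> _); set J := Rintegral _ _ _.
rewrite -/I ler_pdivlMl // => h2 h1.
have := ler_wpM2l (ltW s0) h1; rewrite -/I; lra.
Qed.

End Entire.

(** * Regularity of entire functions and Liouville's theorem *)

Section Regularity.
Variable R : realType.
Local Notation C := R[i].
Local Notation mu := (@lebesgue_measure R).
Implicit Types (x y s t u e : R) (z w a v d : C) (f g K : C -> C).

Lemma complex_eta z : z = complex.Re z +i* complex.Im z.
Proof. by case: z. Qed.

Lemma cabs_sub_le x y u (v : R) : cabs ((x +i* y) - (u +i* v)) <= `|x - u| + `|y - v|.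
Proof. by apply: le_trans (cabs_le_ReIm _) _. Qed.

Lemma entire_bounded_square f s : entire f -> 0 < s ->
  exists M, forall x y, - s <= x <= s -> - s <= y <= s -> cabs (f (x +i* y)) <= M.
Proof.
move=> ef s0; have ss0 : 0 < 2 * s by lra.
pose P x y l := exists M, forall u (v : R), x <= u <= x + 2 * s * l -> y <= v <= y + 2 * s * l ->
   cabs (f (u +i* v)) <= M.
have : P (- s) (- s) 1.
  apply: (bisection ss0 ss0).
  - move=> x y l l0 [M1 H1] [M2 H2] [M3 H3] [M4 H4].
    exists (Num.max (Num.max M1 M2) (Num.max M3 M4)) => u v hu hv.
    have lE : 2 * s * l = 2 * s * (l / 2) + 2 * s * (l / 2) by rewrite -mulrDr -splitr.
    rewrite lE in hu hv; rewrite !le_max.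
    have [u1|/ltW u1] := leP u (x + 2 * s * (l / 2));
    have [v1|/ltW v1] := leP v (y + 2 * s * (l / 2)).
    + by rewrite H1 //; [case/andP: hu => -> _; rewrite u1|case/andP: hv => -> _; rewrite v1].
    + rewrite H3 ?orbT //; first by case/andP: hu => -> _; rewrite u1.
      by case/andP: hv => _ v2; rewrite v1 -addrA.
    + rewrite H2 ?orbT //; last by case/andP: hv => -> _; rewrite v1.
      by case/andP: hu => _ u2; rewrite u1 -addrA.
    + rewrite H4 ?orbT //.
        by case/andP: hu => _ u2; rewrite u1 -addrA.
      by case/andP: hv => _ v2; rewrite v1 -addrA.
  - move=> x y _ _; have [r r0 rP] := entire_cont ef (x +i* y) ltr01.
    exists (r / (4 * s)); first by rewrite divr_gt0 // mulr_gt0.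
    move=> x' y' l /andP[l0]; rewrite ltr_pdivlMr ?mulr_gt0 // => lr hx hy.
    exists (1 + cabs (f (x +i* y))) => u v hu hv.
    have := rP ((u +i* v) - (x +i* y)); rewrite (addrC (x +i* y)) subrK => /(_ _) H.
    have := cabsD (f (u +i* v) - f (x +i* y)) (f (x +i* y)); rewrite subrK.
    suff /H : cabs ((u +i* v) - (x +i* y)) < r by lra.
    apply: le_lt_trans (cabs_sub_le _ _ _ _) _.
    have : `|u - x| <= 2 * s * l by rewrite ler_norml; lra.
    have : `|v - y| <= 2 * s * l by rewrite ler_norml; lra.
    lra.
case=> M HM; exists M => x y hx hy; apply: HM; lra.
Qed.

Lemma entire_unif_cont f a s e : entire f -> 0 < s -> 0 < e ->
  exists2 r, 0 < r & forall v h, cabs v <= s -> cabs h < r ->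
    cabs (f (a + v + h) - f (a + v)) <= e.
Proof.
move=> ef s0 e0; have ss0 : 0 < 2 * s by lra.
pose P x y l := exists2 r, 0 < r & forall u (v : R) h,
   x <= u <= x + 2 * s * l -> y <= v <= y + 2 * s * l ->
   cabs h < r -> cabs (f ((u +i* v) + h) - f (u +i* v)) <= e.
have : P (complex.Re a - s) (complex.Im a - s) 1.
  apply: (bisection ss0 ss0).
  - move=> x y l l0 [r1 r10 H1] [r2 r20 H2] [r3 r30 H3] [r4 r40 H4].
    exists (Num.min (Num.min r1 r2) (Num.min r3 r4)) => [|u v h hu hv].
      by rewrite !lt_min r10 r20 r30.
    have lE : 2 * s * l = 2 * s * (l / 2) + 2 * s * (l / 2) by rewrite -mulrDr -splitr.
    rewrite lE in hu hv; rewrite !lt_min => /andP[/andP[h1 h2] /andP[h3 h4]].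
    have [u1|/ltW u1] := leP u (x + 2 * s * (l / 2));
    have [v1|/ltW v1] := leP v (y + 2 * s * (l / 2)).
    + by apply: H1 => //; [case/andP: hu => -> _; rewrite u1|case/andP: hv => -> _; rewrite v1].
    + apply: H3 => //; first by case/andP: hu => -> _; rewrite u1.
      by case/andP: hv => _ v2; rewrite v1 -addrA.
    + apply: H2 => //; last by case/andP: hv => -> _; rewrite v1.
      by case/andP: hu => _ u2; rewrite u1 -addrA.
    + apply: H4 => //.
        by case/andP: hu => _ u2; rewrite u1 -addrA.
      by case/andP: hv => _ v2; rewrite v1 -addrA.
  - move=> x y _ _; have e2 : 0 < e / 2 by lra.
    have [r r0 rP] := entire_cont ef (x +i* y) e2.
    have s8 : 0 < 8 * s by lra.
    exists (r / (8 * s)); first by rewrite divr_gt0.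
    move=> x' y' l /andP[l0]; rewrite ltr_pdivlMr // => lr hx hy.
    exists (r / 2) => [|u v h hu hv hr]; first lra.
    have hw : cabs ((u +i* v) - (x +i* y)) < r / 2.
      apply: le_lt_trans (cabs_sub_le _ _ _ _) _.
      have : `|u - x| <= 2 * s * l by rewrite ler_norml; lra.
      have : `|v - y| <= 2 * s * l by rewrite ler_norml; lra.
      lra.
    have h1 := rP ((u +i* v) - (x +i* y)); rewrite (addrC (x +i* y)) subrK in h1.
    have h2 := rP ((u +i* v) - (x +i* y) + h); rewrite addrA (addrC (x +i* y)) subrK in h2.
    have {}h1 : cabs (f (u +i* v) - f (x +i* y)) <= e / 2 by apply: h1; lra.
    have {}h2 : cabs (f ((u +i* v) + h) - f (x +i* y)) <= e / 2.
      by apply: h2; apply: le_lt_trans (cabsD _ _) _; lra.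
    have -> : f ((u +i* v) + h) - f (u +i* v) =
      (f ((u +i* v) + h) - f (x +i* y)) - (f (u +i* v) - f (x +i* y)) by ring.
    by apply: le_trans (cabsB _ _) _; lra.
case=> r r0 H; exists r => // v h vs hr.
have := H (complex.Re (a + v)) (complex.Im (a + v)) h.
rewrite -complex_eta; apply => //; rewrite ?cReD ?cImD.
  have := le_trans (Re_le_cabs v) vs; rewrite ler_norml; lra.
have := le_trans (Im_le_cabs v) vs; rewrite ler_norml; lra.
Qed.

(** The Cauchy estimate at z is applied to w -> f(h + w) - f(w), which is uniformly small near z and
    has derivative f'(z + h) - f'(z) there. *)
Lemma cderiv_cont f z e : entire f -> 0 < e ->
  exists2 r, 0 < r & forall h, cabs h < r -> cabs (cderiv f (z + h) - cderiv f z) <= e.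
Proof.
(* With s = 1 the estimate reads 4 (e/8 + e/8) = e and uses the disc of radius 2 around z. *)
move=> ef e0; have e8 : 0 < e / 8 by lra.
have [r r0 rP] := entire_unif_cont z ef (ltr0n _ 2) e8.
exists r => // h hr; have /entireP df := ef.
pose g w := f (h + w) - f w.
have dg w : cdiff g w (cderiv f (h + w) - cderiv f w).
  by apply: cdiffB; [apply: cdiff_shift; exact: df|exact: df].
have eg := cdiff_entire dg.
have := @cauchy_deriv R g z 1 (e / 8 + e / 8) eg ltr01.
rewrite (cdiff_unique (dg z)) divr1 (addrC h) => H.
have -> : e = 4 * (e / 8 + e / 8) by lra.
apply: H => v; rewrite mulr1 => v2.
apply: le_trans (cabsB _ _) _; apply: lerD.
  have -> : g (z + v) = f (z + v + h) - f (z + v) by rewrite /g (addrC h).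
  exact: rP.
have -> : g z = f (z + 0 + h) - f (z + 0) by rewrite /g (addrC h) addr0.
by apply: rP => //; rewrite cabs0.
Qed.

(** * Integration of the derivative along segments *)

Lemma is_derive_eps (F : R -> R) t (d : R) :
  (forall e, 0 < e -> exists2 r, 0 < r & forall h, `|h| < r ->
     `|F (t + h) - F t - d * h| <= e * `|h|) -> is_derive t (1 : R) F d.
Proof.
move=> H; pose q := fun h : R => h^-1 *: ((F \o shift t) (h *: (1 : R)) - F t).
have qE h : h != 0 -> q h - d = h^-1 * (F (t + h) - F t - d * h).
  by move=> h0; rewrite /q /= /GRing.scale /= mulr1 (addrC h); field.
have key : q h @[h --> 0^'] --> d.
  apply/cvgrPdist_le => e e0; have [r r0 rP] := H _ e0.
  apply/nbhs_ballP; exists r => // h; rewrite -ball_normE /ball_ /= sub0r normrN => hr h0.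
  rewrite distrC qE // normrM normfV ler_pdivrMl ?normr_gt0 // [leRHS]mulrC.
  exact: rP.
by apply: DeriveDef; [apply/cvg_ex; exists d|apply/cvg_lim].
Qed.

Lemma cdiff_path f z t d : cdiff f (t%:C * z) d -> forall e, 0 < e ->
  exists2 r, 0 < r & forall h : R, `|h| < r ->
    cabs (f ((t + h)%:C * z) - f (t%:C * z) - d * z * h%:C) <= e * `|h|.
Proof.
move=> H e e0; have M0 : 0 < 1 + cabs z by rewrite ltr_pwDl.
have e1 : 0 < e / (1 + cabs z) by rewrite divr_gt0.
have [r r0 rP] := H _ e1; exists (r / (1 + cabs z)) => [|h]; first by rewrite divr_gt0.
rewrite ltr_pdivlMr // => hr.
have hz : cabs (h%:C * z) = `|h| * cabs z by rewrite cabsM cabs_real.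
have := rP (h%:C * z); rewrite hz.
have -> : (t + h)%:C * z = t%:C * z + h%:C * z by rewrite rmorphD /=; ring.
have -> : d * z * h%:C = d * (h%:C * z) by ring.
have h0 : 0 <= `|h| by [].
have z0 := cabs_ge0 z.
move=> H1; apply: le_trans (H1 _) _; first by nra.
rewrite mulrAC ler_pdivrMr // mulrA; nra.
Qed.

Lemma cdiff_path_Re f z t d : cdiff f (t%:C * z) d ->
  is_derive t (1 : R) (fun t : R => complex.Re (f (t%:C * z))) (complex.Re (d * z)).
Proof.
move=> /cdiff_path H; apply: is_derive_eps => e /H[r r0 rP]; exists r => // h /rP.
apply: le_trans; apply: le_trans (Re_le_cabs _); rewrite !cReD !cReN.
by rewrite [complex.Re (_ * h%:C)]cReM /= mulr0 subr0.
Qed.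

Lemma cdiff_path_Im f z t d : cdiff f (t%:C * z) d ->
  is_derive t (1 : R) (fun t : R => complex.Im (f (t%:C * z))) (complex.Im (d * z)).
Proof.
move=> /cdiff_path H; apply: is_derive_eps => e /H[r r0 rP]; exists r => // h /rP.
apply: le_trans; apply: le_trans (Im_le_cabs _); rewrite !cImD !cImN.
by rewrite [complex.Im (_ * h%:C)]cImM /= mulr0 add0r.
Qed.

Lemma rint_FTC (F F' : R -> R) : (forall t, is_derive t (1 : R) F (F' t)) ->
  {within `[0, 1], continuous F'} -> rint 0 1 F' = F 1 - F 0.
Proof.
move=> dF cF'; rewrite /rint /Rintegral (@continuous_FTC2 R F' F 0 1) //.
- have cF t : {for t, continuous F}.
    apply: differentiable_continuous; apply/derivable1_diffP.
    by have [] := dF t.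
  split.
  + by move=> t _; have [] := dF t.
  + exact/cvg_at_right_filter/cF.
  + exact/cvg_at_left_filter/cF.
- by move=> t _; rewrite derive1E; have [] := dF t.
Qed.

Lemma ccont_cderiv_path f z (a b : R) : entire f ->
  ccont a b (fun t => cderiv f (t%:C * z)).
Proof.
move=> ef t _ e e0; have [r r0 rP] := cderiv_cont (t%:C * z) ef e0.
have M0 : 0 < 1 + cabs z by rewrite ltr_pwDl.
exists (r / (1 + cabs z)) => [|h]; first by rewrite divr_gt0.
rewrite ltr_pdivlMr // => hr.
have -> : (t + h)%:C * z = t%:C * z + h%:C * z by rewrite rmorphD /=; ring.
apply: rP; rewrite cabsM cabs_real; have h0 : 0 <= `|h| by [].
nra.
Qed.

Lemma ccontM (a b : R) (phi psi : R -> C) : ccont a b phi -> ccont a b psi ->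
  ccont a b (fun t => phi t * psi t).
Proof.
move=> H1 H2 t tab e e0.
pose M := 1 + cabs (phi t) + cabs (psi t).
have h1 := cabs_ge0 (phi t); have h2 := cabs_ge0 (psi t).
have M0 : 0 < 1 + M by rewrite /M; lra.
have e1 : 0 < Num.min 1 (e / (1 + M)) by rewrite lt_min ltr01 divr_gt0.
have [r1 r10 P1] := H1 t tab _ e1; have [r2 r20 P2] := H2 t tab _ e1.
exists (Num.min r1 r2) => [|s]; rewrite lt_min ?r10 // => /andP[/P1 s1 /P2 s2].
move: s1 s2; rewrite !le_min => /andP[s1 s1'] /andP[s2 s2'].
set A := phi (t + s) - phi t in s1 s1'; set B := psi (t + s) - psi t in s2 s2'.
have -> : phi (t + s) * psi (t + s) - phi t * psi t = A * B + A * psi t + phi t * B.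
  by rewrite /A /B; ring.
apply: le_trans (cabsD _ _) _; apply: le_trans (lerD (cabsD _ _) (lexx _)) _.
rewrite !cabsM; have a0 := cabs_ge0 A; have b0 := cabs_ge0 B.
move: s1' s2'; rewrite !ler_pdivlMr // /M => s1' s2'.
have B1 : cabs A * cabs B <= cabs A by rewrite ler_piMr.
have : cabs A * cabs (psi t) <= e / (1 + M) * cabs (psi t).
  by rewrite ler_wpM2r // ler_pdivlMr.
have : cabs (phi t) * cabs B <= cabs (phi t) * (e / (1 + M)).
  by rewrite ler_wpM2l // ler_pdivlMr.
have : cabs A <= e / (1 + M) by rewrite ler_pdivlMr.
set k := e / (1 + M) => k1 k2 k3.
have -> : e = k * (1 + M) by rewrite /k divfK // gt_eqF.
have k0 : 0 <= k by rewrite divr_ge0 // ltW.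
rewrite /M; nra.
Qed.

Lemma FTC_segment f z : entire f ->
  cint 0 1 (fun t => cderiv f (t%:C * z) * z) = f z - f 0.
Proof.
move=> ef; have /entireP df := ef.
have c0 : ccont 0 1 (fun t : R => cderiv f (t%:C * z) * z).
  by apply: ccontM; [exact: ccont_cderiv_path|exact: ccont_cst].
have HR := rint_FTC (fun t => cdiff_path_Re (df (t%:C * z))) (ccont_Re c0).
have HI := rint_FTC (fun t => cdiff_path_Im (df (t%:C * z))) (ccont_Im c0).
rewrite mul0r mul1r in HR HI.
by apply/eqP; rewrite eq_complex /= cReD cReN cImD cImN HR HI !eqxx.
Qed.

Lemma Liouville f M : entire f -> (forall z, cabs (f z) <= M) -> forall z, f z = f 0.
Proof.
move=> ef HM z; have d0 w : cderiv f w = 0.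
  apply/eqP; rewrite -cabs_eq0; apply/eqP.
  (* The Cauchy estimate with s = 1/e and oscillation at most 2 M gives 8 M e. *)
  apply: (@le_eps_eq0 _ _ (8 * M)) => // e e0.
  have -> : 8 * M * e = 4 * (M + M) / e^-1 by rewrite invrK; ring.
  apply: cauchy_deriv => //; first by rewrite invr_gt0.
  by move=> v _; apply: le_trans (cabsB _ _) _; apply: lerD.
have := FTC_segment z ef.
have -> : cint 0 1 (fun t : R => cderiv f (t%:C * z) * z) = 0.
  transitivity (cint 0 1 (fun _ : R => 0 : C)).
    by apply: eq_cint => t _; rewrite d0 mul0r.
  by rewrite cint_cst // mul0r.
by move=> /esym/eqP; rewrite subr_eq0 => /eqP.
Qed.

End Regularity.

(** * The operator [Ig] *)

Section Volterra.
Variable R : realType.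
Local Notation C := R[i].
Local Notation mu := (@lebesgue_measure R).
Implicit Types (x y s t u e : R) (z w a v d : C) (f g K : C -> C).

Lemma IgE g f z :
  Ig g f z = cint 0 1 (fun t => cderiv f (t%:C * z) * g (t%:C * z) * z).
Proof. by []. Qed.

Lemma Ig_cst g f z d : entire f -> (forall w, g w = d) -> Ig g f z = d * (f z - f 0).
Proof.
move=> ef gd; rewrite IgE -FTC_segment // -cintZ.
  by apply: eq_cint => t _; rewrite gd; ring.
by apply: ccontM; [exact: ccont_cderiv_path|exact: ccont_cst].
Qed.

Lemma rint_scale (F : R -> R) r : 0 < r -> {within `[0, r], continuous F} ->
  rint 0 r F = rint 0 1 (fun t => F (r * t) * r).
Proof.
move=> r0 cF; rewrite /rint /Rintegral.
have dr : ( *%R r)^`() = cst r.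
  apply/funext => t; rewrite derive1E deriveM // derive_cst scaler0 addr0 derive_id.
  by rewrite /GRing.scale /= mulr1.
have := @integration_by_substitution_increasing R ( *%R r) F 0 1 ler01.
rewrite mulr0 mulr1 dr => -> //; last 5 first.
- by move=> x y _ _; rewrite ltr_pM2l.
- by move=> t _; exact: cvg_cst.
- exact: is_cvg_cst.
- exact: is_cvg_cst.
- have cr t : {for t, continuous ( *%R r)} by exact: mulrl_continuous.
  split => //.
  + exact/cvg_at_right_filter/cr.
  + exact/cvg_at_left_filter/cr.
Qed.

Lemma entire_ccont_path f z (a b : R) : entire f -> ccont a b (fun t => f (t%:C * z)).
Proof.
move=> /entireP ef; have : ccont a b (fun t => f (0 + z * t%:C)).
  by apply: ccont_comp => t _; eexists; exact: ef.
by congr ccont; apply/funext => t; rewrite add0r mulrC.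
Qed.

(** The interval ends at 2 so that 1 is an interior point. *)
Lemma rint_derive (F : R -> R) : {within `[0, 2], continuous F} ->
  {for 1, continuous F} -> is_derive (1 : R) (1 : R) (fun r : R => rint 0 r F) (F 1).
Proof.
move=> cF c1.
have [] := @continuous_FTC1_closed R F 0 1 2 _ (integrable_seg cF) _ c1.
- by rewrite ltr1n.
- exact: ltr01.
by rewrite derive1E => D E; apply: DeriveDef.
Qed.

(** After rescaling, I_g f(r z) is the integral over [0, r] of G(t) = f'(t z) g(t z) z. Since I_g f
    is assumed differentiable, its derivative along the ray at r = 1 is (I_g f)'(z) z on one side
    and G(1) on the other; z is then cancelled. *)
Lemma Ig_deriv f g z : entire f -> entire g -> entire (Ig g f) -> z != 0 ->
  cderiv (Ig g f) z = cderiv f z * g z.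
Proof.
move=> ef eg eI z0; pose G t := cderiv f (t%:C * z) * g (t%:C * z) * z.
have cG (a b : R) : ccont a b G.
  apply: ccontM; last exact: ccont_cst.
  by apply: ccontM; [exact: ccont_cderiv_path|exact: entire_ccont_path].
have cG1 e : 0 < e -> exists2 r, 0 < r & forall s, `|s| < r -> cabs (G (1 + s) - G 1) <= e.
  by apply: (cG 1 1); rewrite lexx.
have HI r : 0 < r -> Ig g f (r%:C * z) = cint 0 r G.
  move=> r0; rewrite IgE /cint (rint_scale r0 (ccont_Re (cG 0 r))).
  rewrite (rint_scale r0 (ccont_Im (cG 0 r))).
  have E t : cderiv f (t%:C * (r%:C * z)) * g (t%:C * (r%:C * z)) * (r%:C * z) = G (r * t) * r%:C.
    rewrite /G (_ : (r * t)%:C * z = t%:C * (r%:C * z)); last by rewrite rmorphM /=; ring.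
    ring.
  congr (_ +i* _); apply: eq_rint => t _; rewrite E ?cReM ?cImM /= !mulr0.
    by rewrite subr0.
  by rewrite add0r.
have near0 : \forall r \near (1 : R), 0 < r.
  by apply: lt_nbhsr; exact: ltr01.
have /entireP/(_ (1%:C * z)) dI := eI.
have cFor (h : R -> R) : (forall e, 0 < e -> exists2 r, 0 < r &
    forall s, `|s| < r -> `|h (1 + s) - h 1| <= e) -> {for 1, continuous h}.
  move=> H; apply/cvgrPdist_le => e e0; have [r r0 rP] := H e e0.
  apply/nbhs_ballP; exists r => // s; rewrite /= => ts.
  by rewrite distrC; have := rP (s - 1); rewrite (addrC 1) subrK; apply; rewrite distrC.
have eR : complex.Re (cderiv (Ig g f) z * z) = complex.Re (G 1).
  have [_ D1] := cdiff_path_Re dI.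
  have [] := @rint_derive (fun t => complex.Re (G t)) (ccont_Re (cG 0 2)) _.
    apply: cFor => e /cG1[r r0 rP]; exists r => // s /rP.
    by apply: le_trans; rewrite -cReN -cReD; exact: Re_le_cabs.
  move=> _ <-; rewrite mul1r in D1; rewrite -D1.
  apply: near_eq_derive.
  by near=> r; rewrite HI //; near: r.
have eIm : complex.Im (cderiv (Ig g f) z * z) = complex.Im (G 1).
  have [_ D1] := cdiff_path_Im dI.
  have [] := @rint_derive (fun t => complex.Im (G t)) (ccont_Im (cG 0 2)) _.
    apply: cFor => e /cG1[r r0 rP]; exists r => // s /rP.
    by apply: le_trans; rewrite -cImN -cImD; exact: Im_le_cabs.
  move=> _ <-; rewrite mul1r in D1; rewrite -D1.
  apply: near_eq_derive.
  by near=> r; rewrite HI //; near: r.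
apply: (mulIf z0); transitivity (G 1); last by rewrite /G mul1r.
by apply/eqP; rewrite eq_complex eR eIm !eqxx.
Unshelve. all: by end_near. Qed.

End Volterra.

(** * Area integrals *)

Section Area.
Variable R : realType.
Local Notation mu := (@lebesgue_measure R).
Local Notation T1 := (measurableTypeR R).
Implicit Types (x y r a b : R).

Definition cont2 (phi : T1 * T1 -> R) := forall p e, 0 < e -> exists2 r, 0 < r &
  forall x y, `|x - p.1| < r -> `|y - p.2| < r -> `|phi (x, y) - phi p| <= e.

(** The set where [phi] exceeds c is the union of the rectangles with rational corners contained in
    it. They are enumerated by [unpickle], and indices that encode no such rectangle contribute the
    empty set. *)
Lemma measurable_cont2 (phi : T1 * T1 -> R) : cont2 phi -> measurable_fun setT phi.
Proof.
move=> cphi _; apply: (measurability _ (RGenOInfty.measurableE R)) => //.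
move=> /= _ [_ [c ->] <-]; rewrite setTI.
pose rect (q : (rat * rat) * (rat * rat)) : set (T1 * T1) :=
  `]ratr q.1.1, ratr q.1.2[ `*` `]ratr q.2.1, ratr q.2.2[.
pose F (n : nat) : set (T1 * T1) := if unpickle n is Some q then
   (if `[< rect q `<=` phi @^-1` `]c, +oo[ >] then rect q else set0) else set0.
have -> : phi @^-1` `]c, +oo[ = \bigcup_n F n.
  apply/seteqP; split => [[u v] /=|p [n _]]; last first.
    rewrite /F; case: unpickle => // q; case: asboolP => // H pq; exact: H.
  rewrite in_itv /= andbT => cp.
  have e0 : 0 < (phi (u, v) - c) / 2 by rewrite divr_gt0 // subr_gt0.
  have [r r0 rP] := cphi (u, v) _ e0.
  have [q1 /[!in_itv] /= /andP[q11 q12]] := @rat_in_itvoo R (u - r) u ltac:(lra).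
  have [q2 /[!in_itv] /= /andP[q21 q22]] := @rat_in_itvoo R u (u + r) ltac:(lra).
  have [q3 /[!in_itv] /= /andP[q31 q32]] := @rat_in_itvoo R (v - r) v ltac:(lra).
  have [q4 /[!in_itv] /= /andP[q41 q42]] := @rat_in_itvoo R v (v + r) ltac:(lra).
  pose q := ((q1, q2), (q3, q4)).
  apply: (ex_intro2 _ _ (pickle q) I); rewrite /F pickleK.
  case: asboolP => [_|[]].
    by split; rewrite /= in_itv /= ?q12 ?q21 ?q32 ?q41.
  move=> [x y] [] /=; rewrite !in_itv /= => /andP[x1 x2] /andP[y1 y2].
  have := rP x y; rewrite /= => H.
  have {}H : `|phi (x, y) - phi (u, v)| <= (phi (u, v) - c) / 2.
    by apply: H; rewrite ltr_norml; lra.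
  by move: H; rewrite andbT ler_norml => /andP[H1 H2]; lra.
apply: bigcupT_measurable => n; rewrite /F; case: unpickle => [q|]; last exact: measurable0.
by case: asboolP => _; [apply: measurableX; exact: measurable_itv|exact: measurable0].
Qed.

(** The pushforward of Lebesgue measure under [phi] agrees with it on half-open intervals, hence
    everywhere. *)
Lemma integral_lebesgue_invariant (phi : T1 -> T1) : measurable_fun setT phi ->
  (forall u v, mu (phi @^-1` `]u, v]) = mu `]u, v]%classic) ->
  forall f : T1 -> \bar R, measurable_fun setT f -> (forall x, 0 <= f x)%E ->
  (\int[mu]_x f (phi x) = \int[mu]_x f x)%E.
Proof.
move=> mphi H f mf f0.
rewrite -[LHS]/(\int[mu]_(x in phi @^-1` setT) (f \o phi) x)%E.
rewrite -(@ge0_integral_pushforward _ _ _ _ R phi mphi mu setT f) //.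
apply: eq_measure_integral => A mA _.
apply/esym; apply: lebesgue_measure_unique => //.
by move=> _ [[u v] _ <-]; exact: esym (H u v).
Qed.

Lemma lebesgue_integral_shift (f : T1 -> \bar R) a :
  measurable_fun setT f -> (forall x, 0 <= f x)%E ->
  (\int[mu]_x f (x + a)%R = \int[mu]_x f x)%E.
Proof.
apply: (@integral_lebesgue_invariant (fun x : T1 => x + a)).
  by apply: measurable_funD.
move=> u v; have -> : (fun x => x + a) @^-1` `]u, v] = `](u - a), (v - a)]%classic.
  by apply/seteqP; split => x /=; rewrite !in_itv /= => /andP[h1 h2]; apply/andP; split; lra.
rewrite !lebesgue_measure_itv /= !lte_fin ltrD2r.
by case: ifP => // _; rewrite -!EFinD; congr EFin; ring.
Qed.

Lemma lebesgue_integral_opp (f : T1 -> \bar R) :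
  measurable_fun setT f -> (forall x, 0 <= f x)%E ->
  (\int[mu]_x f (- x)%R = \int[mu]_x f x)%E.
Proof.
apply: (@integral_lebesgue_invariant (fun x : T1 => - x)).
  exact: oppr_measurable.
move=> u v; have -> : (fun x => - x) @^-1` `]u, v] = `[(- v), (- u)[%classic.
  by apply/seteqP; split => x /=; rewrite !in_itv /= => /andP[h1 h2]; apply/andP; split; lra.
rewrite !lebesgue_measure_itv /= !lte_fin ltrN2.
by case: ifP => // _; rewrite -!EFinD; congr EFin; ring.
Qed.

Lemma area_fubini (f : T1 * T1 -> \bar R) : measurable_fun setT f -> (forall p, 0 <= f p)%E ->
  (\int[@areaC R]_p f p = \int[mu]_x \int[mu]_y f (x, y))%E.
Proof. by move=> mf f0; rewrite /areaC (fubini_tonelli1 f). Qed.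

Lemma area_fubini2 (f : T1 * T1 -> \bar R) : measurable_fun setT f -> (forall p, 0 <= f p)%E ->
  (\int[@areaC R]_p f p = \int[mu]_y \int[mu]_x f (x, y))%E.
Proof. by move=> mf f0; rewrite /areaC (fubini_tonelli2 f). Qed.

Lemma measurable_section1 (f : T1 * T1 -> \bar R) x : measurable_fun setT f ->
  measurable_fun setT (fun y => f (x, y)).
Proof. by move=> mf; apply: measurableT_comp mf _; exact: pair1_measurable. Qed.

Lemma measurable_shift2 a b : measurable_fun setT (fun p : T1 * T1 => (p.1 + a, p.2 + b)).
Proof.
by apply: measurable_fun_pair; apply: measurable_funD.
Qed.

Lemma area_shift (f : T1 * T1 -> \bar R) a b : measurable_fun setT f -> (forall p, 0 <= f p)%E ->
  (\int[@areaC R]_p f (p.1 + a, p.2 + b)%R = \int[@areaC R]_p f p)%E.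
Proof.
move=> mf f0.
have ms : measurable_fun setT (fun p : T1 * T1 => f (p.1 + a, p.2 + b)%R).
  exact: measurableT_comp mf (measurable_shift2 a b).
rewrite area_fubini // area_fubini //=.
transitivity (\int[mu]_x \int[mu]_y f ((x + a)%R, y))%E.
  apply: eq_integral => x _.
  rewrite (lebesgue_integral_shift (f := fun y => f ((x + a)%R, y))) //.
  exact: measurable_section1.
rewrite (lebesgue_integral_shift (f := fun x => \int[mu]_y f (x, y))%E) //.
  exact: measurable_fun_fubini_tonelli_F.
by move=> x; exact: integral_ge0.
Qed.

(** A quarter turn is an exchange of coordinates followed by a reflection: Tonelli in the other
    order does the first, [lebesgue_integral_opp] the second. *)
Lemma area_rot (f : T1 * T1 -> \bar R) : measurable_fun setT f -> (forall p, 0 <= f p)%E ->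
  (\int[@areaC R]_p f (- p.2, p.1)%R = \int[@areaC R]_p f p)%E.
Proof.
move=> mf f0.
have ms : measurable_fun setT (fun p : T1 * T1 => f (- p.2, p.1)%R).
  apply: measurableT_comp mf _; apply: measurable_fun_pair; last exact: measurable_fst.
  by apply: measurableT_comp; [exact: oppr_measurable|exact: measurable_snd].
rewrite area_fubini2 // area_fubini //=.
rewrite (lebesgue_integral_opp (f := fun x => \int[mu]_y f (x, y))%E) //.
  exact: measurable_fun_fubini_tonelli_F.
by move=> x; exact: integral_ge0.
Qed.

End Area.

(** * The area mean value inequality *)

Section AreaMean.
Variable R : realType.
Local Notation C := R[i].
Local Notation mu := (@lebesgue_measure R).
Local Notation T1 := (measurableTypeR R).
Implicit Types (x y r s t : R) (phi psi : T1 * T1 -> R) (f : C -> C).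

Definition AI phi : \bar R := (\int[@areaC R]_p (phi p)%:E)%E.

Lemma AI_ge0 phi : (forall p, 0 <= phi p) -> (0 <= AI phi)%E.
Proof. by move=> h; apply: integral_ge0 => p _; rewrite lee_fin. Qed.

Lemma AI_le phi psi : measurable_fun setT phi -> measurable_fun setT psi ->
  (forall p, 0 <= phi p) -> (forall p, phi p <= psi p) -> (AI phi <= AI psi)%E.
Proof.
move=> m1 m2 h1 h2; apply: ge0_le_integral => //.
- by move=> p _; rewrite lee_fin.
- exact/measurable_EFinP.
- exact/measurable_EFinP.
- by move=> p _; rewrite lee_fin.
Qed.

Lemma AI_D phi psi : measurable_fun setT phi -> measurable_fun setT psi ->
  (forall p, 0 <= phi p) -> (forall p, 0 <= psi p) ->
  (AI (fun p => (phi p + psi p)%R) = AI phi + AI psi)%E.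
Proof.
move=> m1 m2 h1 h2; rewrite /AI -ge0_integralD //.
- by move=> p _; rewrite lee_fin.
- exact/measurable_EFinP.
- by move=> p _; rewrite lee_fin.
- exact/measurable_EFinP.
Qed.

Lemma AI_Z k phi : measurable_fun setT phi -> 0 <= k -> (forall p, 0 <= phi p) ->
  (AI (fun p => (k * phi p)%R) = k%:E * AI phi)%E.
Proof.
move=> m1 k0 h1; rewrite /AI -ge0_integralZl //.
- exact/measurable_EFinP.
- by move=> p _; rewrite lee_fin.
Qed.

Lemma AI_shift phi x y : measurable_fun setT phi -> (forall p, 0 <= phi p) ->
  AI (fun p => phi (p.1 + x, p.2 + y)) = AI phi.
Proof.
move=> m1 h1; rewrite /AI (@area_shift R (fun p => (phi p)%:E)) //.
exact/measurable_EFinP.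
Qed.

Lemma AI_rot phi : measurable_fun setT phi -> (forall p, 0 <= phi p) ->
  AI (fun p => phi (- p.2, p.1)) = AI phi.
Proof.
move=> m1 h1; rewrite /AI (@area_rot R (fun p => (phi p)%:E)) //.
exact/measurable_EFinP.
Qed.

Definition seg r : R -> R := fun x => \1_(`[- r, r]%classic : set R) x.

Lemma segE r x : seg r x = (`|x| <= r)%R%:R.
Proof.
rewrite /seg indicE; congr (_ %:R); rewrite ler_norml.
by rewrite mem_setE in_itv.
Qed.

Lemma seg_ge0 r x : 0 <= seg r x. Proof. by rewrite segE. Qed.

Lemma seg_in r x : `|x| <= r -> seg r x = 1. Proof. by rewrite segE => ->. Qed.

Lemma seg_out r x : ~~ (`|x| <= r) -> seg r x = 0. Proof. by rewrite segE => /negbTE ->. Qed.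

Lemma measurable_seg r : measurable_fun setT (seg r : T1 -> R).
Proof. by apply: measurable_indic; exact: measurable_itv. Qed.

Definition box r : T1 * T1 -> R := fun p => seg r p.1 * seg r p.2.

Lemma box_ge0 r p : 0 <= box r p.
Proof. by rewrite /box mulr_ge0 // seg_ge0. Qed.

Lemma measurable_box r : measurable_fun setT (box r).
Proof.
by apply: measurable_funM; apply: measurableT_comp (measurable_seg r) _;
  [exact: measurable_fst|exact: measurable_snd].
Qed.

Lemma boxP r p : (box r p = 1 /\ `|p.1| <= r /\ `|p.2| <= r) \/
  (box r p = 0 /\ ~~ ((`|p.1| <= r) && (`|p.2| <= r))).
Proof.
rewrite /box; have [h1|h1] := boolP (`|p.1| <= r); last by right; rewrite seg_out // mul0r.
have [h2|h2] := boolP (`|p.2| <= r); last by right; rewrite [seg r p.2]seg_out // mulr0.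
by left; rewrite !seg_in // mulr1.
Qed.

Lemma integral_seg r : 0 <= r -> (\int[mu]_x (seg r x)%:E = (2 * r)%:E)%E.
Proof.
move=> r0; rewrite integral_indic //= setIT lebesgue_measure_itv /= lte_fin.
case: ltP => h; first by rewrite -EFinD; congr EFin; ring.
by congr EFin; lra.
Qed.

Lemma AI_box r : 0 <= r -> AI (box r) = (4 * r ^+ 2)%:E.
Proof.
move=> r0; rewrite /AI area_fubini //=; last 2 first.
- by apply/measurable_EFinP; exact: measurable_box.
- by move=> p; rewrite lee_fin box_ge0.
transitivity (\int[mu]_x ((2 * r)%:E * (seg r x)%:E))%E.
  apply: eq_integral => x _; rewrite /box /=.
  under eq_integral do rewrite EFinM.
  rewrite ge0_integralZl ?integral_seg //; first by rewrite muleC.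
  - by apply/measurable_EFinP; exact: measurable_seg.
  - by move=> y _; rewrite lee_fin seg_ge0.
  - by rewrite lee_fin seg_ge0.
rewrite ge0_integralZl ?integral_seg //.
- by rewrite -EFinM; congr EFin; ring.
- by apply/measurable_EFinP; exact: measurable_seg.
- by move=> y _; rewrite lee_fin seg_ge0.
- by rewrite lee_fin mulr_ge0.
Qed.

Definition cpt (p : T1 * T1) : C := p.1 +i* p.2.

Lemma cont2_cabs f : entire f -> cont2 (fun p => cabs (f (cpt p))).
Proof.
move=> ef p e e0; have [r r0 rP] := entire_cont ef (cpt p) e0.
exists (r / 2) => [|x y hx hy]; first by rewrite divr_gt0.
have hr : cabs ((x +i* y) - cpt p) < r.
  by apply: le_lt_trans (cabs_sub_le _ _ _ _) _; lra.
have := rP _ hr; rewrite (addrC (cpt p)) subrK /cpt /= => H.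
apply: le_trans H; rewrite ler_norml.
have := cabsD (f (x +i* y) - f (p.1 +i* p.2)) (f (p.1 +i* p.2)); rewrite subrK.
have := cabsD (f (p.1 +i* p.2) - f (x +i* y)) (f (x +i* y)); rewrite subrK cabsBC.
rewrite /cpt /=; lra.
Qed.

Lemma measurable_cabs f : entire f -> measurable_fun setT (fun p => cabs (f (cpt p))).
Proof. by move=> ef; apply: measurable_cont2; exact: cont2_cabs. Qed.

Lemma entire_mulk (k : C) : entire (fun z => k * z).
Proof.
by apply: cdiff_entire => z; apply: cdiffM; [exact: cdiff_cst|exact: cdiff_id].
Qed.

Lemma entire_comp f g : entire f -> entire g -> entire (fun z => g (f z)).
Proof.
move=> /entireP ef /entireP eg; apply: (@cdiff_entire _ _ (fun z => cderiv g (f z) * cderiv f z)).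
by move=> z; apply: cdiff_comp.
Qed.

Lemma AI_box_rot f r : entire f ->
  AI (fun p => box r p * cabs (f (iu * cpt p))) = AI (fun p => (box r p * cabs (f (cpt p)))%R).
Proof.
move=> ef; rewrite -(@AI_rot (fun p => box r p * cabs (f (cpt p)))).
- congr AI; apply/funext => p; rewrite /box /= [seg r (- _)]segE normrN -segE mulrC [in RHS]mulrC.
  rewrite [in RHS](mulrC (seg r p.2)); congr (cabs (f _) * _).
  by apply/eqP; rewrite eq_complex /=; apply/andP; split; apply/eqP; ring.
- by apply: measurable_funM; [exact: measurable_box|exact: measurable_cabs].
- by move=> p; rewrite mulr_ge0 // box_ge0.
Qed.

Lemma symm_abs_ge0 f z : 0 <= symm_abs f z.
Proof. by rewrite !addr_ge0. Qed.

(** The box is invariant under multiplication by i, so the four rotates of |f| have the same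
    integral over it. *)
Lemma AI_box_symm f r : entire f ->
  (AI (fun p => (box r p * symm_abs f (cpt p))%R) =
    4%:E * AI (fun p => (box r p * cabs (f (cpt p)))%R))%E.
Proof.
move=> ef; pose f1 z := f (iu * z); pose f2 z := f1 (iu * z); pose f3 z := f2 (iu * z).
have ei := @entire_mulk iu.
have e1 : entire f1 := entire_comp ei ef.
have e2 : entire f2 := entire_comp ei e1.
have e3 : entire f3 := entire_comp ei e2.
have m h : entire h -> measurable_fun setT (fun p => box r p * cabs (h (cpt p))).
  by move=> eh; apply: measurable_funM; [exact: measurable_box|exact: measurable_cabs].
have n h p : 0 <= box r p * cabs (h (cpt p)) by rewrite mulr_ge0 // box_ge0.
transitivity (AI (fun p => ((box r p * cabs (f (cpt p)) + box r p * cabs (f1 (cpt p))) +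
   box r p * cabs (f2 (cpt p))) + box r p * cabs (f3 (cpt p)))).
  congr AI; apply/funext => p; rewrite /symm_abs !mulrDr /f3 /f2 /f1 !i_mul_i.
  by rewrite mulrN.
have m01 := measurable_funD (m _ ef) (m _ e1).
have m012 := measurable_funD m01 (m _ e2).
rewrite AI_D //; [|exact: m|by move=> p; rewrite !addr_ge0].
rewrite AI_D //; [|exact: m|by move=> p; rewrite !addr_ge0].
rewrite AI_D //; [|exact: m|exact: m].
have -> : AI (fun p => (box r p * cabs (f3 (cpt p)))%R) =
    AI (fun p => (box r p * cabs (f2 (cpt p)))%R).
  exact: AI_box_rot.
have -> : AI (fun p => (box r p * cabs (f2 (cpt p)))%R) =
    AI (fun p => (box r p * cabs (f1 (cpt p)))%R).
  exact: AI_box_rot.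
have -> : AI (fun p => (box r p * cabs (f1 (cpt p)))%R) =
    AI (fun p => (box r p * cabs (f (cpt p)))%R).
  exact: AI_box_rot.
have : (0 <= AI (fun p => (box r p * cabs (f (cpt p)))%R))%E by exact: AI_ge0.
case: AI => [a|_|//]; last by rewrite mulry gtr0_sg // mul1e.
by rewrite lee_fin => a0; rewrite -!EFinD -EFinM; congr EFin; ring.
Qed.

Lemma measurable_symm f : entire f -> measurable_fun setT (fun p => symm_abs f (cpt p)).
Proof.
move=> ef; have ei := @entire_mulk iu; have en := @entire_mulk (-1).
have e2 : entire (fun z => f (- z)).
  by have := entire_comp en ef; under eq_fun do rewrite mulN1r.
have e3 : entire (fun z => f (- (iu * z))) by exact: entire_comp ei e2.
exact: (measurable_funD (measurable_funD (measurable_funD (measurable_cabs ef)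
  (measurable_cabs (entire_comp ei ef))) (measurable_cabs e2)) (measurable_cabs e3)).
Qed.

(** [value_bound] is integrated over the sides s + i[-s, s] with r/2 <= s <= r, all inside the box
    of half-side r. This gives r |f(0)| r/2 <= 4 times the integral of |f|, hence the constant 8. *)
Lemma area_value_bound f r : entire f -> 0 < r ->
  ((r ^+ 2 * cabs (f 0))%:E <= 8%:E * AI (fun p => (box r p * cabs (f (cpt p)))%R))%E.
Proof.
move=> ef r0.
have H4 := AI_box_symm r ef.
have mS : measurable_fun setT (fun p => box r p * symm_abs f (cpt p)).
  by apply: measurable_funM; [exact: measurable_box|exact: measurable_symm].
have S0 p : 0 <= box r p * symm_abs f (cpt p) by rewrite mulr_ge0 ?box_ge0 ?symm_abs_ge0.
have mSE : measurable_fun setT (fun p => (box r p * symm_abs f (cpt p))%:E).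
  exact/measurable_EFinP.
pose D : set R := `[(r / 2), r]%classic.
(* Restricting to s >= r/2 turns the factor 2 s of [value_bound] into r; elsewhere the indicator
   makes the left side 0. *)
have key s : ((r * cabs (f 0) * \1_D s)%:E <=
    \int[mu]_t (box r (s, t) * symm_abs f (cpt (s, t)))%:E)%E.
  rewrite indicE; have [/set_mem|_] := boolP (s \in D); last first.
    by rewrite mulr0; apply: integral_ge0 => t _; rewrite lee_fin.
  rewrite /D /= in_itv /= mulr1 => /andP[s1 s2].
  have s0 : 0 < s by lra.
  have := value_bound ef s0; rewrite -lee_fin /rint /Rintegral => h.
  have iS := integrable_seg (@entire_ccont_symm R f s s ef).
  rewrite fineK in h; last exact: integrable_fin_num iS.
  apply: le_trans (le_trans h _).
    by rewrite lee_fin ler_wpM2r //; lra.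
  rewrite integral_mkcond; apply: ge0_le_integral => //.
  - move=> t _; rewrite patchE; case: ifP => // _.
    by rewrite lee_fin; exact: (symm_abs_ge0 f (s +i* t)).
  - by apply/(measurable_restrictT _ _).1 => //; exact: measurable_int iS.
  - exact: (measurable_section1 s mSE).
  - move=> t _; rewrite patchE; case: ifPn => [/set_mem|_]; last by rewrite lee_fin.
    rewrite /= in_itv /= => ht; rewrite lee_fin /box /= !seg_in ?mul1r //.
      by rewrite ler_norml; lra.
    by rewrite ger0_norm // ltW.
have : (\int[mu]_s (r * cabs (f 0) * \1_D s)%:E <=
    AI (fun p => (box r p * symm_abs f (cpt p))%R))%E.
  rewrite /AI area_fubini //.
  apply: ge0_le_integral => //.
  - by move=> s _; rewrite lee_fin mulr_ge0 // mulr_ge0 // ltW.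
  - by apply/measurable_EFinP; apply: measurable_funM => //; apply: measurable_indic; exact: measurable_itv.
  - have S0E p : (0 <= (box r p * symm_abs f (cpt p))%:E)%E by rewrite lee_fin.
    exact: (measurable_fun_fubini_tonelli_F (m2 := mu) _ mSE S0E).
rewrite H4; under eq_integral do rewrite EFinM.
rewrite ge0_integralZl //; last 2 first.
- by apply/measurable_EFinP; apply: measurable_indic; exact: measurable_itv.
- by rewrite lee_fin mulr_ge0 // ltW.
rewrite integral_indic //; last exact: measurable_itv.
have mD : mu D = (r - r / 2)%:E.
  by rewrite lebesgue_measure_itv /= lte_fin ifT; [rewrite -EFinD|lra].
rewrite setIT [X in (_ * X)%E]mD -EFinM => h.
have : (2%:E * (r * cabs (f 0) * (r - r / 2))%:E <=
   2%:E * (4%:E * AI (fun p => (box r p * cabs (f (cpt p)))%R)))%E by rewrite lee_pmul2l.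
rewrite muleA -!EFinM (_ : 2 * 4 = 8 :> R); last by ring.
by apply: le_trans; rewrite lee_fin; have := cabs_ge0 (f 0); nra.
Qed.

End AreaMean.

(** * The mean value inequality for powers *)

Section PowerMean.
Variable R : realType.
Local Notation C := R[i].
Local Notation T1 := (measurableTypeR R).
Implicit Types (x y r s t : R) (phi psi : T1 * T1 -> R) (f : C -> C).

Lemma measurable_cabs_pow f q : entire f ->
  measurable_fun setT (fun p : T1 * T1 => cabs (f (cpt p)) `^ q).
Proof. by move=> ef; apply: measurableT_comp (measurable_powR q) (measurable_cabs ef). Qed.

Lemma ler_powR2 q (a b : R) : 0 <= q -> 0 <= a -> a <= b -> a `^ q <= b `^ q.
Proof.
by move=> q0 a0 ab; apply: ge0_ler_powR => //; rewrite nnegrE //; exact: le_trans ab.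
Qed.

(* A power of |f| is not handled by the mean value inequality directly when q < 1.  We
   apply it at a near-maximizer of depth^k |f|: on a box of half-side depth/2 around that
   point |f| is at most 2^(k+1) times its value at the centre, which allows to trade |f|
   for |f|^q. *)
Definition depth (p : T1 * T1) : R := 1 - Num.max `|p.1| `|p.2|.

(** The supremum of depth^k |f| over the unit square is finite, and positive because at the origin
    the quantity is |f(0)|. Hence some point exceeds half of it, whether or not it is attained. *)
Lemma max_depth f k : entire f -> 0 < cabs (f 0) -> exists p : T1 * T1,
  [/\ 0 <= depth p & forall p', 0 <= depth p' ->
     depth p' ^+ k * cabs (f (cpt p')) <= 2 * (depth p ^+ k * cabs (f (cpt p)))].
Proof.
move=> ef f0.
pose S := [set v | exists2 p : T1 * T1, 0 <= depth p & v = depth p ^+ k * cabs (f (cpt p))].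
have [M HM] := entire_bounded_square ef (@ltr01 R).
have ubS : ubound S M.
  move=> _ [p dp ->]; have h1 : Num.max `|p.1| `|p.2| <= 1 by rewrite -subr_ge0.
  move: (h1); rewrite ge_max !ler_norml => /andP[hx hy].
  apply: le_trans (HM _ _ hx hy); rewrite ler_piMl // exprn_ile1 //.
  by rewrite /depth gerBl le_max normr_ge0.
have S0 : S (cabs (f 0)).
  exists (0, 0); rewrite /depth /= normr0 maxxx subr0 ?ler01 //.
  by rewrite expr1n mul1r; congr (cabs (f _)); apply/eqP; rewrite eq_complex /= !eqxx.
have supS : has_sup S by split; [exists (cabs (f 0))|exists M].
have sup0 : 0 < sup S by apply: lt_le_trans f0 (ub_le_sup _ S0); exists M.
have e0 : 0 < sup S / 2 by lra.
have [_ [p dp ->] hp] := sup_adherent e0 supS.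
exists p; split => // p' dp'; apply: le_trans (_ : sup S <= _); last by lra.
by apply: ub_le_sup; [exists M|exists p'].
Qed.

(** Trades a first power for a q-th power: values up to e are absorbed in the first summand, and for
    a >= e the factor (a/e)^q is at least 1. The summand e is later absorbed in the left side of the
    mean value inequality. *)
Lemma le_power_split q (a e B : R) : 0 < q -> 0 < e -> 0 <= a -> a <= B ->
  a <= e + B / e `^ q * a `^ q.
Proof.
move=> q0 e0 a0 aB; have B0 := le_trans a0 aB.
have p0 := powR_gt0 q e0.
have [ae|/ltW ea] := leP a e.
  by rewrite ler_wpDr // mulr_ge0 ?powR_ge0 // divr_ge0 // ltW.
have h : B <= B / e `^ q * a `^ q.
  rewrite mulrAC ler_pdivlMr // ler_wpM2l //.
  exact: ler_powR2 (ltW q0) (ltW e0) ea.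
by apply: le_trans aB (le_trans h _); rewrite lerDr ltW.
Qed.

Lemma area_power_bound_max f q k p : 0 < q -> entire f -> 0 < depth p -> 0 < cabs (f (cpt p)) ->
  (forall p', 0 <= depth p' ->
     depth p' ^+ k * cabs (f (cpt p')) <= 2 * (depth p ^+ k * cabs (f (cpt p)))) ->
  (((cabs (f (cpt p)) / 64) `^ q * depth p ^+ 2)%:E <=
    (2 ^+ (k + 7))%:E * AI (fun p => box 1 p * cabs (f (cpt p)) `^ q)%R)%E.
Proof.
move=> q0 ef d0 G0 HG; set d := depth p in d0 HG *; set G := cabs (f (cpt p)) in G0 HG *.
pose g v := f (cpt p + v); have eg : entire g by exact: entire_shift.
have r0 : 0 < d / 2 by lra.
set r := d / 2 in r0.
have gE p' : g (cpt p') = f (cpt (p'.1 + p.1, p'.2 + p.2)).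
  by congr f; apply/eqP; rewrite eq_complex /= (addrC p'.1) (addrC p'.2) !eqxx.
have g0 : g 0 = f (cpt p) by rewrite /g addr0.
have gB p' : `|p'.1| <= r -> `|p'.2| <= r -> cabs (g (cpt p')) <= 2 ^+ k.+1 * G.
  move=> h1 h2; rewrite gE; set p'' := (_, _).
  have dp'' : d / 2 <= depth p''.
    rewrite /depth /= lerBrDr -lerBrDl ge_max.
    have := ler_normD p'.1 p.1; have := ler_normD p'.2 p.2.
    have dE : d = 1 - Num.max `|p.1| `|p.2| by [].
    have : `|p.1| <= 1 - d by rewrite dE opprB addrC subrK le_max lexx.
    have : `|p.2| <= 1 - d by rewrite dE opprB addrC subrK le_max lexx orbT.
    by rewrite /r in h1 h2; lra.
  have := HG p'' (le_trans (ltW r0) dp'').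
  have : (d / 2) ^+ k * cabs (f (cpt p'')) <= depth p'' ^+ k * cabs (f (cpt p'')).
    by rewrite ler_wpM2r // lerXn2r // nnegrE // ?(le_trans (ltW r0)) // ltW.
  move=> h3 h4; have := le_trans h3 h4.
  rewrite expr_div_n mulrAC ler_pdivrMr ?exprn_gt0 //.
  rewrite -mulrA -mulrA (mulrCA 2) ler_pM2l ?exprn_gt0 // => h5.
  by apply: le_trans h5 _; rewrite exprS; nra.
(* In r^2 G <= 8 (4 e r^2 + L j) the choice e = G/64 makes the first summand half of the left side,
   leaving r^2 G <= 16 L j. *)
pose e := G / 64; have e0 : 0 < e by rewrite divr_gt0.
pose L := 2 ^+ k.+1 * G / e `^ q.
have L0 : 0 <= L by rewrite /L divr_ge0 ?powR_ge0 // mulr_ge0 ?exprn_ge0 // ltW.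
have mgq : measurable_fun setT (fun p => box r p * cabs (g (cpt p)) `^ q).
  by apply: measurable_funM; [exact: measurable_box|exact: measurable_cabs_pow].
have mg : measurable_fun setT (fun p => box r p * cabs (g (cpt p))).
  by apply: measurable_funM; [exact: measurable_box|exact: measurable_cabs].
have ngq p' : 0 <= box r p' * cabs (g (cpt p')) `^ q by rewrite mulr_ge0 ?box_ge0 ?powR_ge0.
have A1 : (AI (fun p => (box r p * cabs (g (cpt p)))%R) <=
   (e * (4 * r ^+ 2))%:E + L%:E * AI (fun p => (box r p * cabs (g (cpt p)) `^ q)%R))%E.
  rewrite EFinM -AI_box ?(ltW r0) // -AI_Z //;
    [|exact: measurable_box|exact: ltW|by move=> ?; exact: box_ge0].
  rewrite -AI_Z // -AI_D.
  - apply: AI_le => //.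
    + apply: measurable_funD; [by apply: measurable_funM => //; exact: measurable_box|].
      exact: measurable_funM.
    + by move=> p'; rewrite mulr_ge0 // box_ge0.
    + move=> p'; case: (boxP r p') => [[-> [h1 h2]]|[-> _]]; last by rewrite !mul0r !mulr0 addr0.
      by rewrite !mul1r mulr1; apply: le_power_split => //; exact: gB.
  - by apply: measurable_funM => //; exact: measurable_box.
  - exact: measurable_funM.
  - by move=> p'; rewrite mulr_ge0 ?box_ge0 // ltW.
  - by move=> p'; rewrite mulr_ge0.
(* Both coordinates of [p] are at most 1 - d in modulus, so the box of half-side d/2 around [p]
   stays in the unit box. *)
have A2 : (AI (fun p => (box r p * cabs (g (cpt p)) `^ q)%R) <=
    AI (fun p => box 1 p * cabs (f (cpt p)) `^ q)%R)%E.
  pose phi (p' : T1 * T1) := box r (p'.1 + - p.1, p'.2 + - p.2) * cabs (f (cpt p')) `^ q.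
  have mphi : measurable_fun setT phi.
    apply: measurable_funM; last exact: measurable_cabs_pow.
    exact: measurableT_comp (measurable_box r) (measurable_shift2 (- p.1) (- p.2)).
  have nphi p' : 0 <= phi p' by rewrite mulr_ge0 ?box_ge0 ?powR_ge0.
  have -> : (fun p => box r p * cabs (g (cpt p)) `^ q) = (fun p' => phi (p'.1 + p.1, p'.2 + p.2)).
    by apply/funext => p'; rewrite /phi /= !addrK gE; case: p'.
  rewrite AI_shift //; apply: AI_le => //.
    by apply: measurable_funM; [exact: measurable_box|exact: measurable_cabs_pow].
  move=> p'; rewrite /phi ler_wpM2r ?powR_ge0 //.
  case: (boxP r (p'.1 - p.1, p'.2 - p.2)) => [[-> /= [h1 h2]]|[-> _]]; last exact: box_ge0.
  rewrite /box !seg_in ?mulr1 //.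
    have : `|p.2| <= 1 - d by rewrite /d /depth opprB addrC subrK le_max lexx orbT.
    have := ler_normD (p'.2 - p.2) p.2; rewrite subrK /r in h2 *; lra.
  have : `|p.1| <= 1 - d by rewrite /d /depth opprB addrC subrK le_max lexx.
  have := ler_normD (p'.1 - p.1) p.1; rewrite subrK /r in h1 *; lra.
have A0 := area_value_bound eg r0; rewrite g0 -/G in A0.
have P0 := powR_gt0 q e0.
move: A2 A1 A0; have := AI_ge0 ngq.
(* If this integral is infinite then so is the right side of the claim; otherwise the inequalities
   are between reals. *)
case: (AI (fun p => box r p * cabs (g (cpt p)) `^ q)) => [j|_|//]; last first.
  by rewrite leye_eq => /eqP -> _ _; rewrite gt0_muley ?lte_fin ?exprn_gt0 // leey.
rewrite lee_fin => j0 A2 A1 A0.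
have {A0}A0 : ((r ^+ 2 * G)%:E <= 8%:E * ((e * (4 * r ^+ 2))%:E + L%:E * j%:E))%E.
  by apply: le_trans A0 _; rewrite lee_pmul2l.
move: A0; rewrite -[(L%:E * _)%E]EFinM -EFinD -EFinM lee_fin => A0.
apply: le_trans (_ : (2 ^+ (k + 7) * j)%:E <= _)%E; last first.
  by rewrite EFinM lee_pmul2l // lte_fin exprn_gt0.
rewrite lee_fin.
have GE : G = 64 * e by rewrite /e; field.
have dr : d = 2 * r by rewrite /r; field.
have H1 : r ^+ 2 * G <= 16 * (L * j) by move: A0; rewrite GE; lra.
have LE : 16 * (L * j) = (16 * 2 ^+ k.+1 * j) * G / e `^ q by rewrite /L; field; rewrite gt_eqF.
move: H1; rewrite LE -/e.
rewrite ler_pdivlMr // mulrAC ler_pM2r // => H2.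
have -> : 2 ^+ (k + 7) = 4 * (16 * 2 ^+ k.+1) :> R by rewrite exprD (exprS _ k); ring.
by rewrite dr exprMn; lra.
Qed.

Theorem area_power_bound q : 0 < q -> exists2 K, 0 < K & forall f, entire f ->
  ((cabs (f 0) `^ q)%:E <= K%:E * AI (fun p => box 1 p * cabs (f (cpt p)) `^ q)%R)%E.
Proof.
(* With k q >= 2 and depth <= 1 one has depth^{k q} <= depth^2, so the weight of the maximization is
   paid by the area factor depth^2. In the constant, 128 = 2 * 64 joins the loss of the
   near-maximizer with the divisor 64. *)
move=> q0; pose k := (Num.truncn (2 / q)).+1.
have kq : 2 <= k%:R * q by rewrite -ler_pdivrMr // ltW // truncnS_gt.
exists (128 `^ q * 2 ^+ (k + 7)); first by rewrite mulr_gt0 ?powR_gt0 // exprn_gt0.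
move=> f ef; have AI0 : (0 <= AI (fun p => box 1 p * cabs (f (cpt p)) `^ q)%R)%E.
  by apply: AI_ge0 => p; rewrite mulr_ge0 ?box_ge0 ?powR_ge0.
have [f0|f0] := eqVneq (cabs (f 0)) 0.
  rewrite f0 powR0 ?gt_eqF // mule_ge0 // lee_fin mulr_ge0 ?powR_ge0 // exprn_ge0 //.
have {}f0 : 0 < cabs (f 0) by rewrite lt_neqAle eq_sym f0 cabs_ge0.
have [p [dp Hp]] := max_depth k ef f0.
have H0 : cabs (f 0) <= 2 * (depth p ^+ k * cabs (f (cpt p))).
  have d0 : depth (0, 0) = 1 by rewrite /depth /= normr0 maxxx subr0.
  have c0 : cpt (0, 0) = 0 by [].
  by have := Hp (0, 0); rewrite d0 c0 expr1n mul1r; apply.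
have G0 : 0 < cabs (f (cpt p)).
  rewrite lt_neqAle cabs_ge0 andbT eq_sym; apply/eqP => G0.
  by move: H0; rewrite G0 !mulr0 leNgt f0.
have d0 : 0 < depth p.
  rewrite lt_neqAle dp andbT eq_sym; apply/eqP => d0.
  by move: H0; rewrite d0 expr0n /= mul0r mulr0 leNgt f0.
have d1 : depth p <= 1 by rewrite /depth gerBl le_max normr_ge0.
have H := area_power_bound_max q0 ef d0 G0 Hp.
rewrite EFinM -muleA; apply: le_trans (_ : _ <= (128 `^ q)%:E *
   ((cabs (f (cpt p)) / 64) `^ q * depth p ^+ 2)%:E)%E _; last first.
  by rewrite lee_pmul2l // lte_fin powR_gt0.
rewrite -EFinM lee_fin; apply: le_trans (ler_powR2 (ltW q0) (cabs_ge0 _) H0) _.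
have -> : 2 * (depth p ^+ k * cabs (f (cpt p))) = 128 * ((cabs (f (cpt p)) / 64) * depth p ^+ k).
  by field.
rewrite powRM //; last by rewrite mulr_ge0 ?exprn_ge0 // divr_ge0.
rewrite ler_pM2l ?powR_gt0 // powRM ?exprn_ge0 // ?divr_ge0 //.
rewrite ler_wpM2l ?powR_ge0 //.
rewrite -powR_mulrn // -powRrM -powR_mulrn // ger_powR // d0 d1 //.
Qed.

End PowerMean.

(** * Pointwise bounds in the weighted spaces *)

Section Weighted.
Variable R : realType.
Local Notation C := R[i].
Local Notation T1 := (measurableTypeR R).
Implicit Types (x y r s t q : R) (phi : T1 * T1 -> R) (f F : C -> C) (z v w : C) (m : nat).

Lemma is_derive_epsP (h : R -> R) t d : is_derive t (1 : R) h d ->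
  forall e, 0 < e -> exists2 r, 0 < r & forall s, `|s| < r ->
    `|h (t + s) - h t - d * s| <= e * `|s|.
Proof.
move=> [/cvgrPdist_le H D] e e0; rewrite -D.
have /nbhs_ballP[r /= r0 rP] := H e e0.
exists r => // s sr; have [->|s0] := eqVneq s 0.
  by rewrite addr0 mulr0 subrr subr0 normr0 mulr0.
have := rP s; rewrite -ball_normE /ball_ /= sub0r normrN => /(_ sr s0).
rewrite -/('D_1 h t) /GRing.scale /= mulr1 (addrC s) distrC.
have -> : s^-1 * (h (t + s) - h t) - 'D_1 h t = s^-1 * (h (t + s) - h t - 'D_1 h t * s) by field.
by rewrite normrM normfV ler_pdivrMl ?normr_gt0 // [leRHS]mulrC.
Qed.

(** * The complex exponential *)

Definition cexp z : C := (expR (complex.Re z) * cos (complex.Im z)) +i*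
  (expR (complex.Re z) * sin (complex.Im z)).

Lemma cexpD z w : cexp (z + w) = cexp z * cexp w.
Proof.
rewrite /cexp cReD cImD expRD cosD sinD; apply/eqP; rewrite eq_complex /=.
by apply/andP; split; apply/eqP; ring.
Qed.

Lemma cexp0 : cexp 0 = 1.
Proof. by rewrite /cexp /= expR0 cos0 sin0 mulr0 mulr1. Qed.

Lemma cabs_cexp z : cabs (cexp z) = expR (complex.Re z).
Proof.
by rewrite /cabs /= !exprMn -mulrDr cos2Dsin2 mulr1 sqrtr_sqr ger0_norm // expR_ge0.
Qed.

Lemma cexp_cdiff0 : cdiff cexp 0 1.
Proof.
(* The errors below add up to e |x| + 8 e |y|, at most 9 e |h|. The cap e <= 1 forces |x| < 1, which
   yields expR x <= 3. *)
move=> e0 e00; pose e := Num.min (e0 / 9) 1.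
have e1 : 0 < e by rewrite lt_min ltr01 divr_gt0.
have e_1 : e <= 1 by rewrite ge_min lexx orbT.
have ee0 : 9 * e <= e0.
  have : e <= e0 / 9 by rewrite ge_min lexx.
  lra.
clearbody e.
have [r1 r10 P1] := is_derive_epsP (is_derive_expR (0 : R)) e1.
have [r2 r20 P2] := is_derive_epsP (is_derive_cos (0 : R)) e1.
have [r3 r30 P3] := is_derive_epsP (is_derive_sin (0 : R)) e1.
exists (Num.min (Num.min r1 r2) (Num.min r3 e)); first by rewrite !lt_min r10 r20 r30 e1.
move=> h; rewrite !lt_min => /andP[/andP[h1 h2] /andP[h3 h4]].
rewrite add0r cexp0 mul1r; apply: le_trans (cabs_le_ReIm _) _.
have xh := Re_le_cabs h; have yh := Im_le_cabs h.
case: h h1 h2 h3 h4 xh yh => x y /= h1 h2 h3 h4 xh yh.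
have {}P1 := P1 x (le_lt_trans xh h1); have {}P2 := P2 y (le_lt_trans yh h2).
have {}P3 := P3 y (le_lt_trans yh h3).
rewrite add0r expR0 mul1r in P1; rewrite add0r cos0 sin0 oppr0 mul0r subr0 in P2.
rewrite add0r sin0 cos0 mul1r subr0 in P3.
have x0 : 0 <= `|x| by []. have y0 : 0 <= `|y| by [].
have E0 := expR_gt0 x.
have X1 : `|expR x - 1| <= 2 * `|x|.
  have -> : expR x - 1 = (expR x - 1 - x) + x by ring.
  apply: le_trans (ler_normD _ _) _; nra.
have X3 : expR x <= 3.
  have : `|x| <= 1 by lra.
  move: X1; rewrite ler_norml => /andP[_]; lra.
have A1 : `|expR x * cos y - 1 - x| <= e * `|x| + 3 * (e * `|y|).
  have -> : expR x * cos y - 1 - x = (expR x - 1 - x) + expR x * (cos y - 1) by ring.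
  apply: le_trans (ler_normD _ _) _; apply: lerD => //.
  rewrite normrM (ger0_norm (ltW E0)); apply: ler_pM => //; exact: ltW.
have A2 : `|expR x * sin y - y| <= 3 * (e * `|y|) + 2 * e * `|y|.
  have -> : expR x * sin y - y = expR x * (sin y - y) + (expR x - 1) * y by ring.
  apply: le_trans (ler_normD _ _) _; apply: lerD.
    rewrite normrM (ger0_norm (ltW E0)); apply: ler_pM => //; exact: ltW.
  rewrite normrM ler_wpM2r //; lra.
rewrite subr0; apply: le_trans (lerD A1 A2) _.
have := ler_wpM2r (cabs_ge0 (x +i* y)) ee0.
have := ler_wpM2l (ltW e1) xh; have := ler_wpM2l (ltW e1) yh.
lra.
Qed.

Lemma cexp_cdiff z : cdiff cexp z (cexp z).
Proof.
move=> e e0; have E0 := expR_gt0 (complex.Re z).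
have e1 : 0 < e / expR (complex.Re z) by rewrite divr_gt0.
have [r r0 rP] := cexp_cdiff0 e1; exists r => // h /rP.
rewrite add0r cexp0 mul1r => H.
have -> : cexp (z + h) - cexp z - cexp z * h = cexp z * (cexp h - 1 - h).
  by rewrite cexpD; ring.
rewrite cabsM cabs_cexp mulrC -ler_pdivlMr //.
by apply: le_trans H _; rewrite mulrAC.
Qed.

Lemma cexp_lin_cdiff (k : C) z : cdiff (fun v => cexp (k * v)) z (k * cexp (k * z)).
Proof.
apply: cdiff_eq (cdiff_comp (cdiffM (cdiff_cst k z) (cdiff_id z)) (cexp_cdiff _)) _; ring.
Qed.

Lemma expR_powR (x q : R) : expR x `^ q = expR (q * x).
Proof. by rewrite /powR gt_eqF ?expR_gt0 // expRK. Qed.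

Definition dot z v : R := complex.Re z * complex.Re v + complex.Im z * complex.Im v.

Definition conj z : C := complex.Re z +i* (- complex.Im z).

Lemma Re_conjM z v : complex.Re (conj z * v) = dot z v.
Proof. by rewrite cReM /dot /=; ring. Qed.

Lemma cabs_sqrD z v : cabs (z + v) ^+ 2 = cabs z ^+ 2 + 2 * dot z v + cabs v ^+ 2.
Proof. by rewrite !cabs_sqr cReD cImD /dot; ring. Qed.

Lemma cabs_conj z : cabs (conj z) = cabs z.
Proof. by rewrite /cabs /= sqrrN. Qed.

Lemma dot_le z v : dot z v <= cabs z * cabs v.
Proof. by rewrite -Re_conjM -(cabs_conj z) -cabsM (le_trans (ler_norm _)) // Re_le_cabs. Qed.

Lemma one_cabs_gt0 z : 0 < 1 + cabs z.
Proof. by rewrite ltr_pwDl. Qed.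

Lemma one_cabsD z v : 1 + cabs z <= (1 + cabs (z + v)) * (1 + cabs v).
Proof.
have := cabsB (z + v) v; rewrite addrK.
have := cabs_ge0 (z + v); have := cabs_ge0 v; nra.
Qed.

(** The quadratic part expands exactly. For the logarithm, 1 + |z| <= (1 + |z + v|)(1 + |v|) and
    ln(1 + |v|) <= |v|, so translation by v costs at most m |v|. *)
Lemma psi_shift m z v : psi m (z + v) <= psi m z + dot z v + cabs v ^+ 2 / 2 + m%:R * cabs v.
Proof.
rewrite /psi cabs_sqrD.
have : ln (1 + cabs z) <= ln (1 + cabs (z + v)) + cabs v.
  have P := one_cabs_gt0.
  apply: le_trans (_ : ln ((1 + cabs (z + v)) * (1 + cabs v)) <= _).
    by rewrite ler_ln ?posrE ?mulr_gt0 // one_cabsD.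
  rewrite lnM ?posrE // lerD2l -[leRHS]expRK ler_ln ?posrE ?expR_gt0 //.
  exact: expR_ge1Dx.
have : 0 <= m%:R :> R by [].
nra.
Qed.

Definition wint q m F : T1 * T1 -> R := fun p =>
  cabs (F (cpt p)) `^ q * expR (- (q * psi m (cpt p))).

Lemma Fpow_AI q m F : Fpow q m F = AI (wint q m F).
Proof. by []. Qed.

Lemma wint_ge0 q m F p : 0 <= wint q m F p.
Proof. by rewrite /wint mulr_ge0 ?powR_ge0 ?expR_ge0. Qed.

Lemma measurable_psi m : measurable_fun setT (fun p : T1 * T1 => psi m (cpt p)).
Proof.
have mc : measurable_fun setT (fun p : T1 * T1 => cabs (cpt p)).
  by apply: (@measurable_cabs R (fun z => z)); apply: cdiff_entire => z; exact: cdiff_id.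
apply: measurable_funB.
  by apply: measurable_funM => //; exact: measurable_funX.
apply: measurable_funM => //.
apply: measurableT_comp; first exact: measurable_ln.
exact: measurable_funD.
Qed.

Lemma measurable_wint q m F : entire F -> measurable_fun setT (wint q m F).
Proof.
move=> eF; apply: measurable_funM; first exact: measurable_cabs_pow.
apply: measurableT_comp; first exact: measurable_expR.
apply: measurableT_comp; first exact: oppr_measurable.
by apply: measurable_funM => //; exact: measurable_psi.
Qed.

Definition boxat r (c p : T1 * T1) : R := box r (p.1 - c.1, p.2 - c.2).

Lemma measurable_boxat r c : measurable_fun setT (boxat r c).
Proof. exact: measurableT_comp (measurable_box r) (measurable_shift2 (- c.1) (- c.2)). Qed.

Lemma boxat_ge0 r c p : 0 <= boxat r c p. Proof. exact: box_ge0. Qed.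

Lemma boxat_le1 r c p : boxat r c p <= 1.
Proof.
by rewrite /boxat; case: (boxP r (p.1 - c.1, p.2 - c.2)) => [[-> _]|[-> _]].
Qed.

(* Translating by z and multiplying by e^{- conj(z) v} turns the weight at z + v into
   e^{psi(z)}, up to a factor that is bounded for |v| <= 2. *)
Theorem local_bound q m : 0 < q -> exists2 K, 0 < K & forall F c, entire F ->
  ((wint q m F c)%:E <= K%:E * AI (fun p => boxat 1 c p * wint q m F p)%R)%E.
Proof.
move=> q0; have [K K0 HK] := area_power_bound q0.
(* In the unit box |v| <= 2, so the terms |v|^2 / 2 and m |v| of [psi_shift] are at most 2 and 2
   m. *)
pose k := expR (q * (2 + m%:R * 2)).
have k0 : 0 < k by exact: expR_gt0.
exists (k * K) => [|F c eF]; first by rewrite mulr_gt0.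
pose z := cpt c.
pose G v := F (z + v) * cexp (- conj z * v).
have eG : entire G.
  have /entireP dF := eF.
  apply: cdiff_entire => v; apply: cdiffM; first exact: cdiff_shift (dF _).
  exact: cexp_lin_cdiff.
have G0 : cabs (G 0) = cabs (F z) by rewrite /G addr0 mulr0 cexp0 mulr1.
have cE p : z + cpt p = cpt (p.1 + c.1, p.2 + c.2).
  by apply/eqP; rewrite eq_complex /= (addrC p.1) (addrC p.2) !eqxx.
have GE p : cabs (G (cpt p)) = cabs (F (cpt (p.1 + c.1, p.2 + c.2))) * expR (- dot z (cpt p)).
  by rewrite /G cabsM cabs_cexp cE mulNr cReN Re_conjM.
have mw := measurable_wint q m eF.
have mbw : measurable_fun setT (fun p => boxat 1 c p * wint q m F p).
  by apply: measurable_funM => //; exact: measurable_boxat.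
have nbw p : 0 <= boxat 1 c p * wint q m F p by rewrite mulr_ge0 ?wint_ge0 ?boxat_ge0.
have key : (AI (fun p => (box 1 p * cabs (G (cpt p)) `^ q * expR (- (q * psi m z)))%R) <=
    k%:E * AI (fun p => boxat 1 c p * wint q m F p)%R)%E.
  rewrite -(AI_shift c.1 c.2 mbw nbw) -AI_Z //; last 2 first.
  - exact: measurableT_comp mbw (measurable_shift2 _ _).
  - exact: ltW.
  apply: AI_le.
  - apply: measurable_funM => //; apply: measurable_funM; first exact: measurable_box.
    exact: measurable_cabs_pow.
  - apply: measurable_funM => //.
    exact: measurableT_comp mbw (measurable_shift2 _ _).
  - by move=> p; rewrite !mulr_ge0 ?box_ge0 ?powR_ge0 ?expR_ge0.
  - move=> p; rewrite /boxat /= !addrK; case: p => x y /=.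
    case: (boxP 1 (x, y)) => [[-> [/= h1 h2]]|[-> _]]; last by rewrite !mul0r mulr0.
    have E := cE (x, y); rewrite /= in E.
    rewrite !mul1r GE powRM ?expR_ge0 // /wint /= -E.
    rewrite -mulrA [leRHS]mulrCA ler_wpM2l ?powR_ge0 //.
    rewrite /k expR_powR -!expRD ler_expR.
    have hv : cabs (cpt (x, y)) <= 2 by apply: le_trans (cabs_le_ReIm _) _ => /=; lra.
    have := psi_shift m z (cpt (x, y)); set v := cpt (x, y) in hv *.
    have := cabs_ge0 v; have m0 : 0 <= m%:R :> R by [].
    move=> v0 H; have v2 : cabs v ^+ 2 <= 4 by nra.
    have mv : m%:R * cabs v <= m%:R * 2 by rewrite ler_wpM2l.
    have H2 : psi m (z + v) <= psi m z + dot z v + (2 + m%:R * 2) by lra.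
    have := ler_wpM2l (ltW q0) H2; lra.
rewrite (mulrC k) (EFinM K k) -muleA.
have H1 := HK G eG; rewrite G0 in H1.
have -> : (wint q m F c)%:E =
    ((cabs (F z) `^ q)%:E * (expR (- (q * psi m z)))%:E)%E by rewrite -EFinM.
apply: le_trans (lee_wpmul2r _ H1) _; first by rewrite lee_fin expR_ge0.
rewrite -muleA (muleC (AI _)) -AI_Z ?expR_ge0 //; last 2 first.
- by apply: measurable_funM; [exact: measurable_box|exact: measurable_cabs_pow].
- by move=> p; rewrite mulr_ge0 ?box_ge0 ?powR_ge0.
rewrite lee_pmul2l //; apply: le_trans key.
by rewrite le_eqVlt; apply/orP; left; apply/eqP; congr AI; apply/funext => p; rewrite mulrC.
Qed.

Lemma Fpow_ge0 q m F : (0 <= Fpow q m F)%E.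
Proof. by apply: AI_ge0 => p; exact: wint_ge0. Qed.

Lemma Fnorm_ge0 q m F : 0 <= Fnorm q m F.
Proof. exact: powR_ge0. Qed.

Lemma Fpow_Fnorm q m F : 0 < q -> (Fpow q m F < +oo)%E -> Fpow q m F = (Fnorm q m F `^ q)%:E.
Proof.
move=> q0 fin; rewrite /Fnorm -powRrM mulVf ?gt_eqF // powRr1.
  by rewrite fineK // ge0_fin_numE // Fpow_ge0.
exact: fine_ge0 (Fpow_ge0 _ _ _).
Qed.

Lemma powR_le_inv q (a b : R) : 0 < q -> 0 <= a -> 0 <= b -> a `^ q <= b `^ q -> a <= b.
Proof.
move=> q0 a0 b0; apply: contraTT; rewrite -!ltNge => ba.
by apply: gt0_ltr_powR => //; rewrite nnegrE.
Qed.

Lemma wintE q m F p : 0 < q -> wint q m F p = (cabs (F (cpt p)) * expR (- psi m (cpt p))) `^ q.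
Proof.
move=> q0; rewrite powRM ?expR_ge0 // /wint; congr (_ * _).
by rewrite expR_powR mulrN.
Qed.

Theorem point_bound q m : 0 < q -> exists2 K, 0 < K & forall F z, entire F ->
  (Fpow q m F < +oo)%E -> cabs (F z) <= K * expR (psi m z) * Fnorm q m F.
Proof.
move=> q0; have [K K0 HK] := local_bound m q0.
exists (K `^ q^-1) => [|F z eF fin]; first exact: powR_gt0.
pose c : T1 * T1 := (complex.Re z, complex.Im z).
have zE : cpt c = z by rewrite [RHS]complex_eta.
have := HK F c eF; rewrite wintE // zE => H.
have {}H : (((cabs (F z) * expR (- psi m z)) `^ q)%:E <= K%:E * Fpow q m F)%E.
  apply: le_trans H _; rewrite lee_pmul2l // Fpow_AI; apply: AI_le.
  - by apply: measurable_funM; [exact: measurable_boxat|exact: measurable_wint].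
  - exact: measurable_wint.
  - by move=> p; rewrite mulr_ge0 ?boxat_ge0 ?wint_ge0.
  - by move=> p; rewrite ler_piMl ?boxat_le1 ?wint_ge0.
move: H; rewrite Fpow_Fnorm // -EFinM lee_fin.
have KE : K = (K `^ q^-1) `^ q by rewrite -powRrM mulVf ?gt_eqF // powRr1 // ltW.
rewrite {1}KE -powRM ?powR_ge0 ?Fnorm_ge0 // => H.
have {}H : cabs (F z) * expR (- psi m z) <= K `^ q^-1 * Fnorm q m F.
  by apply: (powR_le_inv q0) => //; rewrite mulr_ge0 ?expR_ge0 ?powR_ge0 ?Fnorm_ge0.
by rewrite mulrAC; move: H; rewrite expRN ler_pdivrMr ?expR_gt0.
Qed.

(** On the disc |v| <= 1/(1 + |z|) the linear term of psi(z + v) is at most |z| |v| <= 1, so the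
    weight changes by a bounded factor there. Cauchy's estimate on this disc costs the inverse
    radius, which is the factor 1 + |z|. *)
Theorem deriv_bound q m : 0 < q -> exists2 K, 0 < K & forall F z, entire F ->
  (Fpow q m F < +oo)%E -> cabs (cderiv F z) <= K * (1 + cabs z) * expR (psi m z) * Fnorm q m F.
Proof.
move=> q0; have [K K0 HK] := point_bound m q0.
pose k := expR (2 + m%:R) : R; have k0 : 0 < k by exact: expR_gt0.
exists (16 * (K * k)) => [|F z eF fin]; first by rewrite !mulr_gt0.
have P := one_cabs_gt0 z; have N0 := Fnorm_ge0 q m F.
pose s := (2 * (1 + cabs z))^-1; have s0 : 0 < s by rewrite invr_gt0 mulr_gt0.
have s2 : 2 * s = (1 + cabs z)^-1 by rewrite /s; field; rewrite gt_eqF.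
pose M := K * k * expR (psi m z) * Fnorm q m F.
have HM v : cabs v <= 2 * s -> cabs (F (z + v)) <= M.
  rewrite s2 => hv; apply: le_trans (HK F (z + v) eF fin) _.
  rewrite /M ler_wpM2r // -mulrA ler_wpM2l ?(ltW K0) // -expRD ler_expR.
  have v0 := cabs_ge0 v; have z0 := cabs_ge0 z.
  have h1 : cabs v * (1 + cabs z) <= 1 by rewrite -ler_pdivlMr ?mul1r.
  have h2 := psi_shift m z v; have h3 := dot_le z v.
  have m0 : 0 <= m%:R :> R by [].
  have v1 : cabs v <= 1 by nra.
  have : m%:R * cabs v <= m%:R by rewrite ler_piMr.
  have : cabs v ^+ 2 <= 1 by rewrite expr_le1.
  have : cabs z * cabs v <= 1 by nra.
  lra.
have := @cauchy_deriv R F z s (M + M) eF s0.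
have -> : 4 * (M + M) / s = 16 * (K * k) * (1 + cabs z) * expR (psi m z) * Fnorm q m F.
  by rewrite /s /M; field; rewrite gt_eqF.
apply => v hv; apply: le_trans (cabsB _ _) _; apply: lerD; first exact: HM.
by have := HM 0; rewrite addr0 cabs0; apply; rewrite mulr_ge0 ?ltW.
Qed.

End Weighted.

(** * Kernels *)

Section TestFunctions.
Variable R : realType.
Local Notation C := R[i].
Local Notation mu := (@lebesgue_measure R).
Local Notation T1 := (measurableTypeR R).
Implicit Types (x y r s t q : R) (phi : T1 * T1 -> R) (f F : C -> C) (z v w : C) (m : nat).

(** q e^{-q|x|} is at most the exponential density plus its reflection, and each of these has
    integral 1. *)
Lemma integral_exp_abs q : 0 < q ->
  (\int[mu]_x (expR (- (q * `|x|)))%:E <= (2 / q)%:E)%E.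
Proof.
move=> q0; pose h := exponential_pdf q.
have mh : measurable_fun setT (h : T1 -> R) by exact: measurable_exponential_pdf.
have h0 x : 0 <= h x by apply: exponential_pdf_ge0; exact: ltW.
have mh' : measurable_fun setT ((fun x => h (- x)) : T1 -> R).
  by apply: measurableT_comp mh _; exact: oppr_measurable.
have mE : measurable_fun setT (fun x : T1 => (h x)%:E) by exact/measurable_EFinP.
have mE' : measurable_fun setT (fun x : T1 => (h (- x))%:E) by exact/measurable_EFinP.
have I1 : (\int[mu]_x (h x)%:E = 1)%E by exact: integral_exponential_pdf.
have I2 : (\int[mu]_x (h (- x))%:E = 1)%E.
  by rewrite (lebesgue_integral_opp (f := fun x => (h x)%:E)) // => x; rewrite lee_fin.
apply: le_trans (_ : \int[mu]_x ((q^-1)%:E * ((h x)%:E + (h (- x))%:E)) <= _)%E; last first.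
  rewrite ge0_integralZl //.
  - rewrite ge0_integralD //; [|by move=> x _; rewrite lee_fin|by move=> x _; rewrite lee_fin].
    by rewrite [X in (_ * (X + _))%E]I1 [X in (_ * (_ + X))%E]I2 -EFinD -EFinM mulrC.
  - exact: emeasurable_funD.
  - by move=> x _; rewrite adde_ge0 // lee_fin.
  - by rewrite lee_fin invr_ge0 ltW.
apply: ge0_le_integral => //.
- apply/measurable_EFinP; apply: measurableT_comp; first exact: measurable_expR.
  apply: measurableT_comp; first exact: oppr_measurable.
  by apply: measurable_funM => //; exact: normr_measurable.
- by apply: measurable_funeM; exact: emeasurable_funD.
- move=> x _; rewrite -EFinD -EFinM lee_fin ler_pdivlMl //.
  have [x0|x0] := leP 0 x.
    by rewrite ger0_norm // /h exponential_pdfE // mulNr lerDl; exact: h0.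
  have -> : h (- x) = q * expR (- q * - x) by apply: exponential_pdfE; rewrite oppr_ge0 ltW.
  by rewrite ltr0_norm // mulNr lerDr; exact: h0.
Qed.

(** A majorant replacing the Gaussian decay of the kernels: its powers split into one-variable
    exponentials, whose integrals are bounded through the exponential distribution. *)
Definition decay (p : T1 * T1) : R := expR (- (`|p.1| + `|p.2|)).

Lemma measurable_decay_pow q : measurable_fun setT (fun p => decay p `^ q).
Proof.
have m2 : measurable_fun setT (fun p : T1 * T1 => - (`|p.1| + `|p.2|)).
  apply: measurable_cont2 => p e e0; exists (e / 2) => [|x y hx hy]; first by rewrite divr_gt0.
  have h1 := ler_dist_dist p.1 x; have h2 := ler_dist_dist p.2 y.
  have -> : - (`|x| + `|y|) - - (`|p.1| + `|p.2|) = (`|p.1| - `|x|) + (`|p.2| - `|y|) by ring.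
  rewrite distrC in hx; rewrite distrC in hy.
  by apply: le_trans (ler_normD _ _) _; lra.
exact: measurableT_comp (measurable_powR q) (measurableT_comp (@measurable_expR R) m2).
Qed.

Lemma AI_decay q : 0 < q -> (AI (fun p => (decay p `^ q)%R) <= ((2 / q) ^+ 2)%:E)%E.
Proof.
move=> q0; rewrite /AI area_fubini //; last 2 first.
- by apply/measurable_EFinP; exact: measurable_decay_pow.
- by move=> p; rewrite lee_fin powR_ge0.
pose e x : R := expR (- (q * `|x|)).
have me : measurable_fun setT (e : T1 -> R).
  apply: measurableT_comp; first exact: measurable_expR.
  apply: measurableT_comp; first exact: oppr_measurable.
  by apply: measurable_funM => //; exact: normr_measurable.
have mE : measurable_fun setT (fun x : T1 => (e x)%:E) by exact/measurable_EFinP.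
have e0 x : (0 <= (e x)%:E)%E by rewrite lee_fin expR_ge0.
have I := integral_exp_abs q0; rewrite -/(e _) in I.
have I0 : (0 <= \int[mu]_x (e x)%:E)%E by exact: integral_ge0.
have -> : (\int[mu]_x \int[mu]_y (decay (x, y) `^ q)%:E =
    \int[mu]_x ((\int[mu]_y (e y)%:E) * (e x)%:E))%E.
  apply: eq_integral => x _; rewrite muleC -ge0_integralZl //.
  apply: eq_integral => y _; rewrite /decay expR_powR /e -EFinM -expRD /=.
  by congr (expR _)%:E; ring.
rewrite ge0_integralZl // expr2 EFinM; apply: lee_pmul => //.
Qed.

(** For m = 0 this is, up to a constant, the normalized reproducing kernel of the classical Fock
    space. The real factor is chosen so that |k_w(w)| = e^{psi(w)}. *)
Definition kern m w z : C := cexp (conj w * z) * (expR (psi m w - cabs w ^+ 2))%:C.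

Lemma cabs_kern m w z : cabs (kern m w z) = expR (dot w z + psi m w - cabs w ^+ 2).
Proof.
rewrite /kern cabsM cabs_cexp cabs_real ger0_norm ?expR_ge0 // -expRD Re_conjM.
by congr expR; ring.
Qed.

Lemma dotzz z : dot z z = cabs z ^+ 2.
Proof. by rewrite cabs_sqr /dot !expr2. Qed.

Lemma cabs_kern_diag m w : cabs (kern m w w) = expR (psi m w).
Proof. by rewrite cabs_kern dotzz; congr expR; ring. Qed.

Lemma kern_cdiff m w z : cdiff (kern m w) z (conj w * kern m w z).
Proof.
apply: cdiff_eq (cdiffM (cexp_lin_cdiff (conj w) z) (cdiff_cst _ _)) _.
by rewrite /kern; ring.
Qed.

Lemma kern_entire m w : entire (kern m w).
Proof. exact: cdiff_entire (kern_cdiff m w). Qed.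

Definition kC m : R := expR ((m%:R + 4) ^+ 2 / 2).

(** With r = |w - z|, [psi_shift] from z to w bounds the exponent on the left by -r^2/2 + m r. The
    squared decay loses at most 4 r, and completing the square leaves (m + 4)^2 / 2. The square is
    there so that, for sums of kernels, one factor controls the overlap and the other the
    integral. *)
Lemma kern_decay m w p : cabs (kern m w (cpt p)) * expR (- psi m (cpt p)) <=
  kC m * decay (p.1 - complex.Re w, p.2 - complex.Im w) ^+ 2.
Proof.
rewrite cabs_kern /kC /decay /= (expr2 (expR (- _))) -!expRD ler_expR.
set z := cpt p; set a := `|_|; set b := `|p.2 - _|.
have H := psi_shift m z (w - z).
rewrite addrC subrK in H.
have D : dot z (w - z) = dot w z - cabs z ^+ 2.
  by rewrite /dot cReD cImD cReN cImN cabs_sqr; ring.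
have D2 : cabs (w - z) ^+ 2 = cabs w ^+ 2 - 2 * dot w z + cabs z ^+ 2.
  by rewrite !cabs_sqr /dot cReD cImD cReN cImN; ring.
have a1 : a <= cabs (w - z).
  by apply: le_trans (Re_le_cabs _); rewrite cReD cReN distrC.
have b1 : b <= cabs (w - z).
  by apply: le_trans (Im_le_cabs _); rewrite cImD cImN distrC.
rewrite D in H; move: H a1 b1 D2; set r := cabs (w - z) => H a1 b1 D2.
have := sqr_ge0 (r - (m%:R + 4)); nra.
Qed.

(* The bound holds for small and large q alike because sum a_k^2 <= (max a_k) (sum a_k). *)
Lemma le_sum_sq_pow (N : nat) (a : nat -> R) q B : 0 < q -> (forall k, 0 <= a k) ->
  \sum_(k < N) a k <= B ->
  (\sum_(k < N) a k ^+ 2) `^ q <= B `^ q * \sum_(k < N) a k `^ q.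
Proof.
move=> q0 a0 SB.
(* [M] is the maximum of the a_k, with value 0 for the empty family; its q-th power is one term of
   the right-hand sum. *)
have [M [M0 HM MS]] : exists M, [/\ 0 <= M, forall k : 'I_N, a k <= M &
    M `^ q <= \sum_(k < N) a k `^ q].
  elim: N {SB} => [|N [M [M0 HM MS]]].
    by exists 0; split => // [[]|] //; rewrite powR0 ?gt_eqF // big_ord0.
  exists (Num.max M (a N)); split.
  - by rewrite le_max M0.
  - move=> k; rewrite le_max; have [kN|kN] := ltnP k N.
      by rewrite (HM (Ordinal kN)).
    have /eqP -> : k == N :> nat by rewrite eqn_leq kN andbT -ltnS.
    by rewrite lexx orbT.
  - rewrite big_ord_recr /=; have [_|_] := leP M (a N).
      by rewrite lerDr sumr_ge0 // => k _; exact: powR_ge0.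
    by apply: le_trans MS _; rewrite lerDl powR_ge0.
apply: le_trans (_ : (M * B) `^ q <= _).
  apply: ler_powR2; [exact: ltW|by rewrite sumr_ge0 // => k _; rewrite sqr_ge0|].
  apply: le_trans (_ : M * \sum_(k < N) a k <= _); last by rewrite ler_wpM2l.
  by rewrite mulr_sumr ler_sum // => k _; rewrite expr2 ler_wpM2r.
have B0 : 0 <= B by apply: le_trans SB; rewrite sumr_ge0.
by rewrite powRM // mulrC ler_wpM2l ?powR_ge0.
Qed.

Lemma sum_exp_le (N : nat) x : \sum_(k < N) expR (- `|x - 4 * k%:R|) <= 6.
Proof.
(* [phi] satisfies e^{-|x|} + phi (x - 4) <= phi x, so it bounds the sum by induction. *)
pose phi x : R := if x <= 0 then 2 * expR x else 6 - 2 * expR (- x).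
have phi6 y : phi y <= 6.
  rewrite /phi; case: ifP => [y0|_]; last by have := expR_gt0 (- y); lra.
  have : expR y <= 1 by rewrite -[leRHS]expR0 ler_expR.
  lra.
apply: le_trans (phi6 x); elim: N x => [|N IH] x.
  rewrite big_ord0 /phi; case: ifP => [_|/negbT]; first by rewrite mulr_ge0 ?expR_ge0.
  rewrite -ltNge => x0; have : expR (- x) <= 1 by (rewrite -[leRHS]expR0 ler_expR; lra).
  lra.
rewrite big_ord_recl /= mulr0 subr0.
have -> : \sum_(k < N) expR (- `|x - 4 * (bump 0 k)%:R|) =
    \sum_(k < N) expR (- `|(x - 4) - 4 * k%:R|).
  by apply: eq_bigr => k _; congr (expR (- `|_|)); rewrite /bump /= add1n -natr1; ring.
apply: le_trans (lerD (lexx _) (IH (x - 4))) _; rewrite /phi.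
have e4 : 5 <= expR 4 :> R by apply: le_trans (expR_ge1Dx _); lra.
have Ex : expR x = expR 4 * expR (x - 4) by rewrite -expRD; congr expR; ring.
have En : expR (- (x - 4)) = expR 4 * expR (- x) by rewrite -expRD; congr expR; ring.
have p1 := expR_gt0 x; have p2 := expR_gt0 (- x); have p3 := expR_gt0 (x - 4).
have [x4|x4] := leP (x - 4) 0; have [x0|x0] := leP x 0.
- by rewrite ler0_norm // opprK; nra.
- rewrite (ger0_norm (ltW x0)).
  have : expR (- x) <= 1 by (rewrite -[leRHS]expR0 ler_expR; lra).
  have : expR (x - 4) <= 1 by rewrite -[leRHS]expR0 ler_expR.
  lra.
- lra.
- rewrite (ger0_norm (ltW x0)) En; nra.
Qed.

Lemma sum_seg_le (N : nat) x : \sum_(k < N) seg 1 (x - 4 * k%:R) <= 1.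
Proof.
(* 4 N - 3 is the right end of the last segment, centred at 4 (N - 1). The added claim shows that a
   point of the next segment meets none of the previous ones. *)
suff: \sum_(k < N) seg 1 (x - 4 * k%:R) <= 1 /\
  (4 * N%:R - 3 < x -> \sum_(k < N) seg 1 (x - 4 * k%:R) = 0) by case.
elim: N => [|N [IH1 IH2]]; first by rewrite big_ord0.
have NE : N.+1%:R = N%:R + 1 :> R by rewrite natr1.
rewrite big_ord_recr /= NE.
have [h|h] := boolP (`|x - 4 * N%:R| <= 1).
  move: (h); rewrite ler_norml => /andP[h1 h2].
  rewrite IH2; last by lra.
  by rewrite seg_in // add0r; split => // h3; lra.
rewrite seg_out // addr0; split => // h3; apply: IH2; lra.
Qed.

End TestFunctions.

(** * Boundedness and compactness for a general symbol *)

Section Operators.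
Variable R : realType.
Local Notation C := R[i].
Local Notation T1 := (measurableTypeR R).
Implicit Types (x y r s t q : R) (phi : T1 * T1 -> R) (f g h F : C -> C) (z v w c : C) (m N : nat).

(** Stands in for the triangle inequality, uniformly in q > 0. *)
Lemma powRD_le q (a b : R) : 0 < q -> 0 <= a -> 0 <= b ->
  (a + b) `^ q <= 2 `^ q * (a `^ q + b `^ q).
Proof.
move=> q0 a0 b0; wlog ab : a b a0 b0 / a <= b => [H|].
  have [|/ltW] := leP a b; first exact: H.
  by move=> /(H _ _ b0 a0); rewrite addrC (addrC (a `^ q)).
apply: le_trans (_ : (2 * b) `^ q <= _).
  by apply: ler_powR2; [exact: ltW|exact: addr_ge0|lra].
by rewrite powRM // ler_wpM2l ?powR_ge0 // lerDr powR_ge0.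
Qed.

Lemma Fpow_le q m F phi k : entire F -> 0 <= k -> measurable_fun setT phi ->
  (forall pt, 0 <= phi pt) -> (forall pt, wint q m F pt <= k * phi pt) ->
  (Fpow q m F <= k%:E * AI phi)%E.
Proof.
move=> eF k0 mphi phi0 H; rewrite -AI_Z // Fpow_AI; apply: AI_le => //.
- exact: measurable_wint.
- exact: measurable_funM.
- by move=> p; exact: wint_ge0.
Qed.

Lemma Fnorm_le q m F k : 0 < q -> 0 <= k -> (Fpow q m F <= (k `^ q)%:E)%E ->
  (Fpow q m F < +oo)%E /\ Fnorm q m F <= k.
Proof.
move=> q0 k0 H; have fin : (Fpow q m F < +oo)%E by apply: le_lt_trans H _; rewrite ltry.
split => //; apply: (powR_le_inv q0) => //; first exact: Fnorm_ge0.
by move: H; rewrite Fpow_Fnorm // lee_fin.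
Qed.

(** [Fnorm] goes through [fine], which sends +oo to 0. A small norm of a difference therefore says
    something only once its integral is known to be finite. *)
Lemma Fpow_fin_sub q m F h : 0 < q -> entire F -> entire h ->
  (Fpow q m F < +oo)%E -> (Fpow q m h < +oo)%E -> (Fpow q m (fun z => (F z - h z)%R) < +oo)%E.
Proof.
move=> q0 eF eh fF fh.
have e : entire (fun z => F z - h z).
  have /entireP dF := eF; have /entireP dh := eh.
  by apply: cdiff_entire => z; apply: cdiffB; [exact: dF|exact: dh].
have mF := measurable_wint q m eF; have mh := measurable_wint q m eh.
apply: le_lt_trans (@Fpow_le q m _ (fun p : T1 * T1 => wint q m F p + wint q m h p)
  (2 `^ q) e _ _ _ _) _.
- exact: powR_ge0.
- exact: (measurable_funD mF mh).
- by move=> p; rewrite addr_ge0 ?wint_ge0.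
- move=> p; rewrite /wint -mulrDl mulrA ler_wpM2r ?expR_ge0 //.
  apply: le_trans (ler_powR2 (ltW q0) (cabs_ge0 _) (cabsB _ _)) _.
  exact: powRD_le.
- rewrite AI_D //; try exact: wint_ge0.
  by rewrite -!Fpow_AI (Fpow_Fnorm q0 fF) (Fpow_Fnorm q0 fh) -EFinD -EFinM ltry.
Qed.

Lemma AI_decay_shift q x y : 0 < q ->
  (AI (fun p : T1 * T1 => (decay ((p.1 - x)%R, (p.2 - y)%R) `^ q)%R) <= ((2 / q) ^+ 2)%:E)%E.
Proof.
move=> q0; apply: le_trans (AI_decay q0).
have H := AI_shift (- x) (- y) (measurable_decay_pow q) (fun p => powR_ge0 (decay p) q).
by rewrite -[X in (_ <= X)%E]H.
Qed.

Lemma measurable_decay_shift q x y :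
  measurable_fun setT (fun p : T1 * T1 => decay (p.1 - x, p.2 - y) `^ q).
Proof. exact: measurableT_comp (measurable_decay_pow q) (measurable_shift2 (- x) (- y)). Qed.

Lemma decay_le1 (p : T1 * T1) : decay p <= 1.
Proof.
rewrite /decay -[leRHS]expR0 ler_expR oppr_le0; exact: addr_ge0.
Qed.

Lemma decay_ge0 (p : T1 * T1) : 0 <= decay p.
Proof. exact: expR_ge0. Qed.

Lemma kC_ge0 m : 0 <= kC R m.
Proof. exact: expR_ge0. Qed.

(** The majorant of k_w is a translate of a fixed function, and area measure is translation
    invariant; hence the bound is uniform in w. *)
Lemma kern_norm q m : 0 < q -> exists2 M, 0 <= M &
  forall w, inF q m (kern m w) /\ Fnorm q m (kern m w) <= M.
Proof.
move=> q0; exists (kC R m * ((2 / q) ^+ 2) `^ q^-1) => [|w].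
  by rewrite mulr_ge0 ?kC_ge0 ?powR_ge0.
have k0 : 0 <= kC R m * ((2 / q) ^+ 2) `^ q^-1 by rewrite mulr_ge0 ?kC_ge0 ?powR_ge0.
suff /(Fnorm_le q0 k0)[fin le] : (Fpow q m (kern m w) <=
    ((kC R m * ((2 / q) ^+ 2) `^ q^-1) `^ q)%:E)%E.
  by split => //; split => //; exact: kern_entire.
rewrite powRM ?powR_ge0 ?kC_ge0 // -powRrM mulVf ?gt_eqF // powRr1 ?sqr_ge0 //.
pose u := complex.Re w; pose v := complex.Im w.
apply: le_trans (@Fpow_le q m _ (fun p : T1 * T1 => decay (p.1 - u, p.2 - v) `^ q) (kC R m `^ q)
   (@kern_entire R m w) _ _ _ _) _.
- exact: powR_ge0.
- exact: measurable_decay_shift.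
- by move=> p; exact: powR_ge0.
- move=> p; rewrite (wintE m (kern m w) p q0) -(powRM q (kC_ge0 m) (decay_ge0 _)).
  have e0 : 0 <= cabs (kern m w (cpt p)) * expR (- psi m (cpt p)).
    exact: mulr_ge0 (cabs_ge0 _) (expR_ge0 _).
  apply: (ler_powR2 (ltW q0) e0); apply: le_trans (kern_decay m w p) _.
  apply: (ler_wpM2l (kC_ge0 m)); rewrite expr2.
  exact: (ler_piMl (decay_ge0 _) (decay_le1 _)).
- by rewrite EFinM lee_wpmul2l ?lee_fin ?powR_ge0 // AI_decay_shift.
Qed.

(** * Necessary conditions on the symbol *)

Lemma entire_const_outside g M r : entire g -> (forall w, r < cabs w -> cabs (g w) <= M) ->
  forall z, g z = g 0.
Proof.
move=> eg H.
pose s := `|r| + 1; have s0 : 0 < s by rewrite ltr_wpDl.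
have [M' HM'] := entire_bounded_square eg s0.
apply: (@Liouville _ _ (Num.max M M')) => // z; rewrite le_max.
have [/H ->//|h] := ltP r (cabs z).
rewrite [z in g z]complex_eta HM' ?orbT //.
  have := Re_le_cabs z; rewrite ler_norml; have := ler_norm r; rewrite /s; lra.
have := Im_le_cabs z; rewrite ler_norml; have := ler_norm r; rewrite /s; lra.
Qed.

Lemma cderiv_Ig_kern g m w z : entire g -> entire (Ig g (kern m w)) -> z != 0 ->
  cderiv (Ig g (kern m w)) z = conj w * kern m w z * g z.
Proof.
move=> eg eI z0; rewrite (Ig_deriv (@kern_entire R m w) eg eI z0).
by rewrite (cdiff_unique (kern_cdiff m w z)).
Qed.

Lemma cabs_conjMM w u v : cabs (conj w * u * v) = cabs w * cabs u * cabs v.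
Proof. by rewrite !cabsM cabs_conj. Qed.

Lemma cabs_gt0_neq0 w : 0 < cabs w -> w != 0.
Proof. by rewrite cabs_gt0. Qed.

Lemma Ig_bounded_const (p : R) q m g : 0 < p -> 0 < q -> entire g -> Ig_bounded p q m g ->
  exists c, forall z, g z = c.
Proof.
move=> p0 q0 eg [Hin [B HB]].
have [M M0 HM] := kern_norm m p0; have [K K0 HK] := deriv_bound m q0.
exists (g 0); apply: (@entire_const_outside _ (2 * (K * (`|B| * M))) 1) => // w w1.
have w0 : w != 0 by apply: cabs_gt0_neq0; exact: lt_trans ltr01 w1.
have [kin kle] := HM w; have [eI fI] := Hin _ kin.
have := HK _ w eI fI; rewrite (cderiv_Ig_kern eg eI w0) cabs_conjMM cabs_kern_diag.
have E0 := expR_gt0 (psi m w).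
have N0 := Fnorm_ge0 p m (kern m w).
(* The constant in the definition of boundedness carries no sign, hence |B|. *)
have NB : Fnorm q m (Ig g (kern m w)) <= `|B| * M.
  apply: le_trans (HB _ kin) _; apply: le_trans (_ : `|B| * Fnorm p m (kern m w) <= _).
    by rewrite ler_wpM2r // ler_norm.
  by rewrite ler_wpM2l.
move=> H; have : cabs w * expR (psi m w) * cabs (g w) <=
    K * (1 + cabs w) * expR (psi m w) * (`|B| * M).
  apply: le_trans H _; rewrite ler_wpM2l //.
  by rewrite !mulr_ge0 ?expR_ge0 // ?ltW // one_cabs_gt0.
rewrite (mulrAC (cabs w)) (mulrAC (K * _)) ler_pM2r // => {}H.
have T0 : 0 <= K * (`|B| * M) by rewrite !mulr_ge0 // ltW.
(* Since |w| > 1, 1 + |w| <= 2 |w|; this is the factor 2 in the bound for g. *)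
have H2 : cabs w * cabs (g w) <= cabs w * (2 * (K * (`|B| * M))).
  apply: le_trans H _.
  have -> : K * (1 + cabs w) * (`|B| * M) = (1 + cabs w) * (K * (`|B| * M)) by ring.
  have -> : cabs w * (2 * (K * (`|B| * M))) = (2 * cabs w) * (K * (`|B| * M)) by ring.
  by apply: (ler_wpM2r T0); move: w1; clear => w1; lra.
by move: H2; rewrite (ler_pM2l (lt_trans ltr01 w1)).
Qed.

Lemma homo_ltn_ge (phi : nat -> nat) : {homo phi : n k / (n < k)%N >-> (n < k)%N} ->
  forall n, (n <= phi n)%N.
Proof. by move=> H; elim=> // n IH; apply: leq_ltn_trans IH (H _ _ (ltnSn n)). Qed.

(** The exponent is at most |w| (|z| - |w|/2) <= -t |w|, and x e^{-t x} <= 1/t. The factor |w| is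
    included because k_w' = conj(w) k_w. *)
Lemma kern_far m w z t : 0 < t -> 2 * cabs z + 2 * t <= cabs w ->
  cabs w * cabs (kern m w z) <= t^-1.
Proof.
move=> t0 wt; have w0 := cabs_ge0 w; have z0 := cabs_ge0 z.
rewrite cabs_kern.
have H : dot w z + psi m w - cabs w ^+ 2 <= - (t * cabs w).
  have := dot_le w z; rewrite /psi.
  have : 0 <= m%:R * ln (1 + cabs w).
    by rewrite mulr_ge0 // ln_ge0 // lerDl.
  nra.
apply: le_trans (_ : cabs w * expR (- (t * cabs w)) <= _).
  by rewrite ler_wpM2l // ler_expR.
rewrite expRN ler_pdivrMr ?expR_gt0 // mulrC ler_pdivlMr //.
by have := expR_ge1Dx (t * cabs w); lra.
Qed.

Lemma Ig_compact_tends0 (p : R) q m g : 0 < p -> 0 < q -> entire g -> Ig_compact p q m g ->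
  forall e, 0 < e -> exists r, forall w, r < cabs w -> cabs (g w) <= e.
Proof.
move=> p0 q0 eg [Hin Hc] e e0; apply: contrapT => nH.
(* If g does not tend to 0, points w_n with |w_n| > n and |g(w_n)| > e can be chosen; their kernels
   form the bounded sequence tested against compactness. *)
have [w Hw] : {w : nat -> C & forall n, n%:R < cabs (w n) /\ e < cabs (g (w n))}.
  apply: (@choice nat C (fun n w => n%:R < cabs w /\ e < cabs (g w))) => n.
  apply: contrapT => nw; apply: nH; exists n%:R => w nlt.
  by rewrite leNgt; apply/negP => ew; apply: nw; exists w.
have [M M0 HM] := kern_norm m p0; have [K K0 HK] := deriv_bound m q0.
have [|| phi [mphi [h [[eh fh] cvgh]]]] := Hc (fun n => kern m (w n)).
- by move=> n; exact: (HM (w n)).1.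
- by exists M => n; exact: (HM (w n)).2.
have phin := homo_ltn_ge mphi.
have Fn k := Fnorm_ge0 q m (fun z => Ig g (kern m (w (phi k))) z - h z).
have small d : 0 < d -> exists n0, forall k, (n0 <= k)%N ->
    Fnorm q m (fun z => Ig g (kern m (w (phi k))) z - h z) <= d.
  move=> d0; move/cvgrPdist_le : cvgh => /(_ d d0) [n0 _ Hn0]; exists n0 => k /Hn0.
  by rewrite /= sub0r normrN ger0_norm.
have eI k : entire (Ig g (kern m (w (phi k)))) by exact: (Hin _ (HM _).1).1.
have fI k : (Fpow q m (Ig g (kern m (w (phi k)))) < +oo)%E by exact: (Hin _ (HM _).1).2.
have dD k z : z != 0 -> cabs (conj (w (phi k)) * kern m (w (phi k)) z * g z - cderiv h z) <=
    K * (1 + cabs z) * expR (psi m z) *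
    Fnorm q m (fun z => Ig g (kern m (w (phi k))) z - h z).
  move=> z0; have /entireP dI := eI k; have /entireP dh := eh.
  have D := cdiffB (dI z) (dh z).
  have eD : entire (fun z => Ig g (kern m (w (phi k))) z - h z).
    by apply: cdiff_entire => z'; apply: cdiffB; [exact: dI|exact: dh].
  rewrite -(cderiv_Ig_kern eg (eI k) z0) -(cdiff_unique D).
  exact: (HK _ z eD (Fpow_fin_sub q0 (eI k) eh (fI k) fh)).
(* k_w -> 0 pointwise as |w| -> oo, hence so does (I_g k_w)' = k_w' g. *)
have dh0 z : z != 0 -> cderiv h z = 0.
  move=> z0; apply/eqP; rewrite -cabs_eq0; apply/eqP.
  pose A := K * (1 + cabs z) * expR (psi m z).
  have A0 : 0 <= A by rewrite !mulr_ge0 ?expR_ge0 // ltW // one_cabs_gt0.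
  apply: (@le_eps_eq0 _ _ (cabs (g z) + A)) => // d d0.
  have [n0 Hn0] := small d d0.
  have [n1 Hn1] : exists n1 : nat, 2 * cabs z + 2 * d^-1 <= n1%:R.
    by exists (Num.truncn (2 * cabs z + 2 * d^-1)).+1; exact: ltW (truncnS_gt _).
  pose k := maxn n0 n1; have kn0 : (n0 <= k)%N by exact: leq_maxl.
  have kw : 2 * cabs z + 2 * d^-1 <= cabs (w (phi k)).
    apply: le_trans Hn1 _; apply: le_trans (ltW (Hw (phi k)).1); rewrite ler_nat.
    by apply: leq_trans (phin k); exact: leq_maxr.
  have d'0 : 0 < d^-1 by rewrite invr_gt0.
  have B1 := kern_far m d'0 kw; rewrite invrK in B1.
  have B2 := dD k z z0; have B3 := Hn0 k kn0.
  have -> : cderiv h z = conj (w (phi k)) * kern m (w (phi k)) z * g z -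
    (conj (w (phi k)) * kern m (w (phi k)) z * g z - cderiv h z) by ring.
  apply: le_trans (cabsB _ _) _; rewrite mulrDl; apply: lerD.
    by rewrite cabs_conjMM mulrC ler_wpM2l.
  by apply: le_trans B2 _; rewrite ler_wpM2l.
(* With this d the derivative bound gives |w| |g(w)| <= (1 + |w|) e / 4 <= |w| e / 2 for |w| > 1,
   against |g(w)| > e. *)
have d0 : 0 < e / (4 * K) by rewrite divr_gt0 // mulr_gt0.
have [n0 Hn0] := small _ d0.
(* The successor ensures phi(k) >= 1, hence |w_{phi(k)}| > 1. *)
pose k := n0.+1; have B3 := Hn0 k (leqnSn _).
have [w1 w2] := Hw (phi k).
have w1' : 1 < cabs (w (phi k)).
  apply: le_lt_trans w1; rewrite ler1n; apply: leq_trans (phin k); exact: ltn0Sn.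
have wn0 : w (phi k) != 0 by apply: cabs_gt0_neq0; exact: lt_trans ltr01 w1'.
have := dD k _ wn0; rewrite dh0 // subr0 cabs_conjMM cabs_kern_diag.
rewrite (mulrAC (cabs _)) (mulrAC (K * _)) ler_pM2r ?expR_gt0 // => H.
have : cabs (w (phi k)) * cabs (g (w (phi k))) <= cabs (w (phi k)) * (e / 2).
  apply: le_trans H _.
  apply: le_trans (ler_wpM2l _ B3) _; first by rewrite mulr_ge0 // ltW // one_cabs_gt0.
  have -> : K * (1 + cabs (w (phi k))) * (e / (4 * K)) = (1 + cabs (w (phi k))) * e / 4.
    by field; rewrite gt_eqF.
  by move: w1' e0; clear; set a := cabs _ => w1 e0; nra.
rewrite (ler_pM2l (lt_trans ltr01 w1')) => H2; move: H2 w2 e0; clear; lra.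
Qed.

Lemma Ig_compact_eq0 (p : R) q m g : 0 < p -> 0 < q -> entire g -> Ig_compact p q m g ->
  forall z, g z = 0.
Proof.
move=> p0 q0 eg Hc; have H := Ig_compact_tends0 p0 q0 eg Hc.
have [r1 Hr1] := H 1 ltr01.
have gc := entire_const_outside eg Hr1.
move=> z; rewrite gc; apply/eqP; rewrite -cabs_eq0; apply/eqP.
apply: (@le_eps_eq0 _ _ 1) => // e e0; have [r Hr] := H e e0.
(* g is constant, so its value may be taken at the real point |r| + 1, beyond the radius r. *)
rewrite mul1r -(gc (`|r| + 1)%:C); apply: Hr; rewrite cabs_real.
rewrite ger0_norm ?addr_ge0 //; have := ler_norm r; lra.
Qed.

(** * Sufficient conditions: zero and constant symbols *)

Lemma Fpow_0 q m : 0 < q -> Fpow q m (fun=> 0 : C) = 0%E.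
Proof.
move=> q0; rewrite Fpow_AI /AI; apply: integral0_eq => p _.
by rewrite /wint cabs0 powR0 ?gt_eqF // mul0r.
Qed.

Lemma Fnorm_0 q m : 0 < q -> Fnorm q m (fun=> 0 : C) = 0.
Proof. by move=> q0; rewrite /Fnorm Fpow_0 //= powR0 // gt_eqF // invr_gt0. Qed.

Lemma inF_0 q m : 0 < q -> inF q m (fun=> 0 : C).
Proof.
move=> q0; split; last by rewrite Fpow_0 // ltry.
by apply: (@cdiff_entire _ _ (fun=> 0)) => z; exact: cdiff_cst.
Qed.

Lemma Ig_eq0 g f : entire f -> (forall z, g z = 0) -> Ig g f = (fun=> 0).
Proof. by move=> ef g0; apply/funext => z; rewrite (Ig_cst _ ef g0) mul0r. Qed.

Lemma Ig_zero_compact (p : R) q m g : 0 < q -> (forall z, g z = 0) -> Ig_compact p q m g.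
Proof.
move=> q0 g0; split => [f [ef _]|u Hu _]; first by rewrite (Ig_eq0 ef g0); exact: inF_0.
exists id; split; first by move=> n k; exact: id.
exists (fun=> 0); split; first exact: inF_0.
have -> : (fun k => Fnorm q m (fun z => Ig g (u (id k)) z - 0)) = (fun=> 0).
  apply/funext => k; rewrite -(@Fnorm_0 q m q0); congr Fnorm.
  by apply/funext => z; rewrite (Ig_eq0 (Hu _).1 g0) subr0.
exact: cvg_cst.
Qed.

Lemma Ig_zero_bounded (p : R) q m g : 0 < q -> (forall z, g z = 0) -> Ig_bounded p q m g.
Proof.
move=> q0 g0; split => [f [ef _]|]; first by rewrite (Ig_eq0 ef g0); exact: inF_0.
by exists 0 => f [ef _]; rewrite (Ig_eq0 ef g0) (Fnorm_0 m q0) mul0r.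
Qed.

Lemma kern0 m z : kern m 0 z = 1.
Proof.
rewrite /kern /conj /= oppr0 (_ : 0 +i* 0 = 0 :> C) // mul0r cexp0 /psi cabs0 addr0 ln1.
by rewrite expr0n /= mul0r mulr0 !subr0 expR0 mulr1.
Qed.

Lemma psi_0 m : psi m (0 : C) = 0.
Proof. by rewrite /psi cabs0 addr0 ln1 expr0n /= mul0r mulr0 subr0. Qed.

(** With a = |f| e^{-psi}, the pointwise bound gives a <= K ||f||. The integral of a^q = a^{q-p} a^p
    is then at most (K ||f||)^{q-p} ||f||^p, which is homogeneous of degree q in the norm. *)
Lemma Fpow_embed (p : R) q m : 0 < p -> p <= q -> exists2 K, 0 <= K & forall f, inF p m f ->
  (Fpow q m f <= ((K * Fnorm p m f) `^ q)%:E)%E.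
Proof.
move=> p0 pq; have q0 : 0 < q by apply: lt_le_trans pq.
have [K K0 HK] := point_bound m p0.
exists (K `^ ((q - p) / q)) => [|f [ef ff]]; first exact: powR_ge0.
have N0 := Fnorm_ge0 p m f.
have k0 : 0 <= (K * Fnorm p m f) `^ (q - p) by exact: powR_ge0.
have E (a : R) : a `^ q = a `^ (q - p) * a `^ p.
  by rewrite -powRD subrK // gt_eqF.
apply: le_trans (Fpow_le ef k0 (measurable_wint p m ef) (wint_ge0 p m f) _) _.
  move=> z; rewrite (wintE _ _ _ q0) (wintE _ _ _ p0); set a := cabs _ * _.
  have a0 : 0 <= a by exact: mulr_ge0 (cabs_ge0 _) (expR_ge0 _).
  have aK : a <= K * Fnorm p m f.
    by rewrite /a expRN ler_pdivrMr ?expR_gt0 // mulrAC; exact: (HK f _ ef ff).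
  rewrite (E a) (ler_wpM2r (powR_ge0 _ _)) // ler_powR2 // subr_ge0 //.
rewrite -Fpow_AI (Fpow_Fnorm p0 ff) -EFinM lee_fin.
rewrite (powRM (q - p) (ltW K0) N0) (powRM q (powR_ge0 _ _) N0).
by rewrite -powRrM (divfK (lt0r_neq0 q0)) -mulrA -E.
Qed.

Lemma Ig_const_bounded (p : R) q m g : 0 < p -> p <= q -> (exists c, forall z, g z = c) ->
  Ig_bounded p q m g.
Proof.
move=> p0 pq [c gc]; have q0 : 0 < q by apply: lt_le_trans pq.
have [K K0 HK] := Fpow_embed m p0 pq.
have [K1 K10 HK1] := point_bound m p0.
(* The kernel at 0 is the constant 1, so constants lie in F^q; this handles the term f(0) in c (f -
   f(0)). *)
have [M M0 HM] := kern_norm m q0; have [[e1 f1] _] := HM 0.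
have k1 : kern m 0 = (fun=> 1) :> (C -> C) by apply/funext => z; rewrite kern0.
rewrite k1 in e1 f1.
pose W := Fnorm q m (fun=> 1 : C); have W0 : 0 <= W by exact: Fnorm_ge0.
pose B := cabs c * 2 * (K `^ q + (K1 * W) `^ q) `^ q^-1.
have B0 : 0 <= B by rewrite !mulr_ge0 ?powR_ge0.
have key f : inF p m f -> (Fpow q m (Ig g f) < +oo)%E /\ entire (Ig g f) /\
    Fnorm q m (Ig g f) <= B * Fnorm p m f.
  move=> [ef ff]; have N0 := Fnorm_ge0 p m f.
  have -> : Ig g f = (fun z => c * (f z - f 0)).
    by apply/funext => z; rewrite (Ig_cst z ef gc).
  have /entireP df := ef.
  have eI : entire (fun z => c * (f z - f 0)).
    apply: cdiff_entire => z; apply: cdiffM; first exact: cdiff_cst.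
    by apply: cdiffB; [exact: df|exact: cdiff_cst].
  suff /(Fnorm_le q0 (mulr_ge0 B0 N0))[fin le] :
    (Fpow q m (fun z => (c * (f z - f 0))%R) <= ((B * Fnorm p m f) `^ q)%:E)%E by [].
  have f0 : cabs (f 0) <= K1 * Fnorm p m f.
    by have := HK1 f 0 ef ff; rewrite psi_0 expR0 mulr1.
  have mf := measurable_wint q m ef; have m1 := measurable_wint q m e1.
  pose phi pt := wint q m f pt + (K1 * Fnorm p m f) `^ q * wint q m (fun=> 1) pt.
  have kk : 0 <= (cabs c * 2) `^ q by exact: powR_ge0.
  apply: le_trans (@Fpow_le q m _ phi _ eI kk _ _ _) _.
  - by apply: (measurable_funD mf); exact: measurable_funM.
  - by move=> pt; rewrite addr_ge0 ?mulr_ge0 ?wint_ge0 ?powR_ge0.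
  - move=> pt; rewrite /phi /wint cabs1 powR1 mul1r -mulrDl mulrA ler_wpM2r ?expR_ge0 //.
    rewrite cabsM powRM // (powRM q) // -mulrA ler_wpM2l ?powR_ge0 //.
    apply: le_trans (ler_powR2 (ltW q0) (cabs_ge0 _) (cabsB _ _)) _.
    apply: le_trans (powRD_le q0 (cabs_ge0 _) (cabs_ge0 _)) _.
    apply: (ler_wpM2l (powR_ge0 _ _)); rewrite lerD2l.
    exact: (ler_powR2 (ltW q0) (cabs_ge0 _) f0).
  rewrite AI_D //; last 3 first.
  - exact: measurable_funM.
  - exact: wint_ge0.
  - by move=> pt; rewrite mulr_ge0 ?wint_ge0 ?powR_ge0.
  rewrite AI_Z ?powR_ge0 //; last exact: wint_ge0.
  rewrite -!Fpow_AI [X in (_ * (_ + _ * X))%E]Fpow_Fnorm // -/W.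
  apply: le_trans (_ : ((cabs c * 2) `^ q)%:E * (((K * Fnorm p m f) `^ q)%:E +
     ((K1 * Fnorm p m f) `^ q)%:E * (W `^ q)%:E) <= _)%E.
    by rewrite lee_wpmul2l ?lee_fin // leeD2r //; exact: HK.
  rewrite -[X in (_ * (_ + X))%E]EFinM -EFinD -EFinM lee_fin /B.
  move: N0 W0 (ltW K10) B0 K0; rewrite /B; move: (Fnorm p m f) (W) => n V; clear -q0.
  move=> n0 V0 K10 B0 K0.
  have S0 : 0 <= K `^ q + (K1 * V) `^ q by exact: addr_ge0 (powR_ge0 _ _) (powR_ge0 _ _).
  have c20 : 0 <= cabs c * 2 by exact: mulr_ge0 (cabs_ge0 _) (ler0n _ 2).
  rewrite (powRM q B0 n0) (powRM q c20 (powR_ge0 _ _)) -(powRrM _ q^-1 q).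
  rewrite (mulVf (lt0r_neq0 q0)) (powRr1 S0).
  rewrite (powRM q K0 n0) (powRM q K10 n0) (powRM q K10 V0).
  by rewrite le_eqVlt; apply/orP; left; apply/eqP; ring.
split => [f /key[fin [eI _]]|]; first by split.
by exists B => f /key[_ [_ ]].
Qed.

End Operators.

(** * Sums of separated kernels *)

Section SeparatedKernels.
Variable R : realType.
Local Notation C := R[i].
Local Notation T1 := (measurableTypeR R).
Implicit Types (x y r s t q : R) (phi : T1 * T1 -> R) (f g h F : C -> C) (z v w c : C) (m N k : nat).

Lemma AI_sum N (phi : nat -> T1 * T1 -> R) :
  (forall k, measurable_fun setT (phi k)) -> (forall k pt, 0 <= phi k pt) ->
  (AI (fun pt => (\sum_(k < N) phi k pt)%R) = \sum_(k < N) AI (phi k))%E.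
Proof.
move=> mphi phi0; elim: N => [|N IH].
  rewrite big_ord0 /AI; apply: integral0_eq => pt _.
  by rewrite big_ord0.
rewrite big_ord_recr /= -IH -AI_D //.
- by congr AI; apply/funext => pt; rewrite big_ord_recr.
- by apply: measurable_sum => k; exact: mphi.
- by move=> pt; apply: sumr_ge0 => k _; exact: phi0.
Qed.

(* The spacing 4 keeps the unit boxes around the centres disjoint; starting at 4 rather
   than 0 makes [kern m (ctr k)] at [ctr k] dominate its value at 0. *)
Definition ctr k : R := 4 * k.+1%:R.

Lemma ctrE k x : x - 4 - 4 * k%:R = x - ctr k.
Proof. by rewrite /ctr -addn1 natrD; ring. Qed.

Definition kern_sum m N z : C := \sum_(k < N) kern m (ctr k)%:C z.

Lemma kern_sumS m N z : kern_sum m N.+1 z = kern_sum m N z + kern m (ctr N)%:C z.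
Proof. by rewrite /kern_sum big_ord_recr. Qed.

Lemma kern_sum_entire m N : entire (kern_sum m N).
Proof.
elim: N => [|N IH].
  apply: (@cdiff_entire _ _ (fun=> 0)) => z.
  by apply: cdiff_ext (cdiff_cst 0 z) => w; rewrite /kern_sum big_ord0.
have /entireP dN := IH; apply: cdiff_entire => z.
apply: cdiff_ext (cdiffD (dN z) (kern_cdiff m (ctr N)%:C z)) => w.
by rewrite kern_sumS.
Qed.

Lemma cabs_kern_sum m N z : cabs (kern_sum m N z) <= \sum_(k < N) cabs (kern m (ctr k)%:C z).
Proof.
elim: N => [|N IH]; first by rewrite /kern_sum !big_ord0 cabs0.
rewrite kern_sumS big_ord_recr /=; apply: le_trans (cabsD _ _) _.
by rewrite lerD2r.
Qed.

Definition kern_decays k (pt : T1 * T1) : R := decay (pt.1 - ctr k, pt.2).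

Lemma sum_decay_le N pt : \sum_(k < N) kern_decays k pt <= 6.
Proof.
apply: le_trans (sum_exp_le N (pt.1 - 4)); apply: ler_sum => k _.
by rewrite /kern_decays /decay ler_expR /= lerN2 ctrE lerDl.
Qed.

(** The constant is independent of N because the decays of separated centres sum to at most 6 at
    every point. The integral of the q-th power therefore grows at most linearly in N, for every q >
    0. *)
Lemma wint_kern_sum q m N pt : 0 < q ->
  wint q m (kern_sum m N) pt <= (kC R m * 6) `^ q * \sum_(k < N) kern_decays k pt `^ q.
Proof.
move=> q0; rewrite (wintE _ _ _ q0).
have e0 := expR_ge0 (- psi m (cpt pt)).
have a0 : 0 <= cabs (kern_sum m N (cpt pt)) * expR (- psi m (cpt pt)).
  exact: mulr_ge0 (cabs_ge0 _) e0.
have d0 k : 0 <= kern_decays k pt by exact: decay_ge0.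
have s0 : 0 <= \sum_(k < N) kern_decays k pt ^+ 2.
  by apply: sumr_ge0 => k _; exact: sqr_ge0.
apply: le_trans (_ : (kC R m * \sum_(k < N) kern_decays k pt ^+ 2) `^ q <= _).
  apply: (ler_powR2 (ltW q0) a0).
  apply: le_trans (ler_wpM2r e0 (cabs_kern_sum m N (cpt pt))) _.
  rewrite mulr_suml mulr_sumr; apply: ler_sum => k _.
  by have := kern_decay m (ctr k)%:C pt; rewrite /= subr0.
rewrite (powRM q (kC_ge0 R m) s0) (powRM q (kC_ge0 R m) (ler0n _ 6)) -mulrA.
apply: (ler_wpM2l (powR_ge0 _ _)).
exact: (@le_sum_sq_pow R N (fun k => kern_decays k pt) q 6 q0 d0 (sum_decay_le N pt)).
Qed.

Lemma kern_sum_norm q m : 0 < q -> exists2 A, 0 <= A & forall N,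
  inF q m (kern_sum m N) /\ Fnorm q m (kern_sum m N) <= A * N%:R `^ q^-1.
Proof.
move=> q0; pose I := ((2 / q) ^+ 2) `^ q^-1.
have I0 : 0 <= I by exact: powR_ge0.
have k0 : 0 <= kC R m * 6 by exact: mulr_ge0 (kC_ge0 R m) (ler0n _ 6).
exists (kC R m * 6 * I) => [|N]; first exact: mulr_ge0.
have n0 : 0 <= (N%:R : R) `^ q^-1 by exact: powR_ge0.
have A0 : 0 <= kC R m * 6 * I * N%:R `^ q^-1 by exact: mulr_ge0 (mulr_ge0 k0 I0) n0.
suff /(Fnorm_le q0 A0)[fin le] : (Fpow q m (kern_sum m N) <=
    ((kC R m * 6 * I * N%:R `^ q^-1) `^ q)%:E)%E.
  by split => //; split; [exact: kern_sum_entire|exact: fin].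
have qq (a : R) : 0 <= a -> (a `^ q^-1) `^ q = a.
  by move=> a0; rewrite -powRrM (mulVf (lt0r_neq0 q0)) powRr1.
rewrite (powRM q (mulr_ge0 k0 I0) n0) (powRM q k0 I0) qq ?ler0n // /I qq ?sqr_ge0 //.
have md k : measurable_fun setT (fun pt => kern_decays k pt `^ q).
  have -> : (fun pt => kern_decays k pt `^ q) =
     (fun pt : T1 * T1 => decay (pt.1 - ctr k, pt.2 - 0) `^ q).
    by apply/funext => pt; rewrite subr0.
  exact: measurable_decay_shift.
have p0 k (pt : T1 * T1) : 0 <= kern_decays k pt `^ q by exact: powR_ge0.
have mphi : measurable_fun setT (fun pt : T1 * T1 => \sum_(k < N) kern_decays k pt `^ q).
  by apply: measurable_sum => k; exact: md.
have phi0 (pt : T1 * T1) : 0 <= \sum_(k < N) kern_decays k pt `^ q.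
  by apply: sumr_ge0 => k _; exact: p0.
have le1 := Fpow_le (@kern_sum_entire m N) (powR_ge0 _ _) mphi phi0
  (fun pt => wint_kern_sum m N pt q0).
apply: le_trans le1 _.
rewrite (@AI_sum N (fun k pt => kern_decays k pt `^ q) md p0) -mulrA EFinM.
apply: lee_wpmul2l; first by rewrite lee_fin; exact: powR_ge0.
apply: le_trans (_ : (\sum_(k < N) ((2 / q) ^+ 2)%:E)%E <= _)%E.
  apply: lee_sum => k _; have := @AI_decay_shift R q (ctr k) 0 q0.
  by under eq_fun do rewrite subr0.
by rewrite sumEFin sumr_const card_ord mulr_natr lexx.
Qed.

Lemma Re_kern_real m (a b : R) : complex.Re (kern m a%:C b%:C) =
  expR (a * b + psi m a%:C - cabs a%:C ^+ 2).
Proof.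
rewrite /kern cReM /= !oppr0 !(mul0r, mulr0, subr0, addr0) cos0 mulr1 -expRD.
by congr expR; ring.
Qed.

(** All centres are real and positive, so on the real axis every kernel is real and increasing. Each
    difference between [ctr j] and 0 is thus nonnegative, nothing cancels, and the j-th term alone
    gives the bound, with e^{-ctr(j)^2} <= 1/2. *)
Lemma kern_sum_lower m N (j : nat) : (j < N)%N ->
  expR (psi m (ctr j)%:C) / 2 <= cabs (kern_sum m N (ctr j)%:C - kern_sum m N 0).
Proof.
move=> jN; apply: le_trans (Re_le_cabs _); apply: le_trans (ler_norm _).
have c0 k : 0 <= ctr k by rewrite /ctr mulr_ge0.
pose D k := complex.Re (kern m (ctr k)%:C (ctr j)%:C) - complex.Re (kern m (ctr k)%:C 0%:C).
have -> : complex.Re (kern_sum m N (ctr j)%:C - kern_sum m N 0) = \sum_(k < N) D k.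
  elim: N {jN} => [|N IH]; first by rewrite /kern_sum !big_ord0 subrr.
  by rewrite big_ord_recr /= -IH /D !kern_sumS !(cReD, cReN); ring.
have D0 k : 0 <= D k.
  rewrite /D !Re_kern_real subr_ge0 ler_expR !lerD2r mulr0.
  exact: mulr_ge0.
rewrite (bigD1 (Ordinal jN)) //=; apply: le_trans (_ : D j <= _); last first.
  by rewrite lerDl; apply: sumr_ge0 => k _; exact: D0.
rewrite /D !Re_kern_real cabs_real (ger0_norm (c0 j)) mulr0 add0r.
have -> : ctr j * ctr j + psi m (ctr j)%:C - ctr j ^+ 2 = psi m (ctr j)%:C by ring.
rewrite (expRD (psi m (ctr j)%:C)); set E := expR (psi _ _).
have E0 : 0 < E by exact: expR_gt0.
have j1 : (1 : R) <= j.+1%:R by rewrite ler1n.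
have h1 : 1 <= ctr j ^+ 2 by rewrite /ctr; nra.
have : expR (- ctr j ^+ 2) <= 1 / 2.
  rewrite expRN -div1r; have := expR_ge1Dx (ctr j ^+ 2) => h2.
  by rewrite ler_pdivrMr ?expR_gt0 //; lra.
nra.
Qed.

Lemma seg_le1 r x : seg r x <= 1.
Proof. by rewrite segE lern1; case: (`|x| <= r). Qed.

(** At each centre c (f - f(0)) has weighted size at least |c| / 2, and [local_bound] converts this
    into a fixed amount of integral over the unit box there. The N boxes are disjoint, so these
    amounts add up. *)
Lemma kern_sum_pow_lower q m g c : 0 < q -> (forall z, g z = c) ->
  exists2 B, 0 <= B & forall N, inF q m (Ig g (kern_sum m N)) ->
    N%:R * (cabs c / 2) `^ q <= B * Fnorm q m (Ig g (kern_sum m N)) `^ q.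
Proof.
move=> q0 gc; have [K K0 HK] := local_bound m q0.
exists K => [|N [eI fI]]; first exact: ltW.
set F := Ig g (kern_sum m N) in eI fI *.
have mw := measurable_wint q m eI.
pose phi k (pt : T1 * T1) := boxat 1 ((ctr k, 0) : T1 * T1) pt * wint q m F pt.
have mphi k : measurable_fun setT (phi k).
  exact: measurable_funM (measurable_boxat 1 _) mw.
have phi0 k pt : 0 <= phi k pt by exact: mulr_ge0 (boxat_ge0 _ _ _) (wint_ge0 _ _ _ _).
have low k : (k < N)%N -> (((cabs c / 2) `^ q)%:E <= K%:E * AI (phi k))%E.
  move=> kN; apply: le_trans (HK F (ctr k, 0) eI); rewrite lee_fin (wintE _ _ _ q0).
  have c2 : 0 <= cabs c / 2 by exact: divr_ge0.
  apply: (ler_powR2 (ltW q0) c2).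
  have -> : cpt ((ctr k, 0) : T1 * T1) = (ctr k)%:C by [].
  rewrite /F (Ig_cst _ (@kern_sum_entire m N) gc) cabsM -!mulrA.
  apply: (ler_wpM2l (cabs_ge0 c)).
  rewrite expRN ler_pdivlMr ?expR_gt0 // mulrC.
  exact: kern_sum_lower.
have sumle : (\sum_(k < N) AI (phi k) <= Fpow q m F)%E.
  rewrite -(AI_sum N mphi phi0) Fpow_AI; apply: AI_le.
  - by apply: measurable_sum => k; exact: mphi.
  - exact: mw.
  - by move=> pt; apply: sumr_ge0 => k _; exact: phi0.
  - move=> pt; rewrite /phi -mulr_suml; apply: ler_piMl; first exact: wint_ge0.
    apply: le_trans (sum_seg_le N (pt.1 - 4)); apply: ler_sum => k _.
    rewrite /boxat /box /= ctrE.
    apply: ler_piMr; first exact: seg_ge0.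
    exact: seg_le1.
rewrite -lee_fin (EFinM K) -(Fpow_Fnorm q0 fI).
apply: le_trans (_ : (K%:E * \sum_(k < N) AI (phi k) <= _)%E); last by rewrite lee_pmul2l.
rewrite ge0_sume_distrr; last by move=> k _; exact: AI_ge0.
apply: le_trans (_ : (\sum_(k < N) ((cabs c / 2) `^ q)%:E <= _)%E).
  by rewrite sumEFin sumr_const card_ord mulr_natl lexx.
by apply: lee_sum => k _; exact: low.
Qed.

Lemma Ig_bounded_eq0 (p : R) q m g : 0 < q -> q < p -> entire g -> Ig_bounded p q m g ->
  forall z, g z = 0.
Proof.
move=> q0 qp eg bg; have p0 : 0 < p by exact: lt_trans qp.
have [c gc] := Ig_bounded_const p0 q0 eg bg.
have [Hin [B HB]] := bg.
have [A A0 HA] := kern_sum_norm m p0.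
have [K K0 HK] := kern_sum_pow_lower m q0 gc.
suff c0 : c = 0 by move=> z; rewrite gc.
apply/eqP; rewrite -cabs_eq0 eq_le cabs_ge0 andbT leNgt; apply/negP => c0.
have d0 : 0 < (cabs c / 2) `^ q by apply: powR_gt0; exact: divr_gt0.
pose L := K * (`|B| * A) `^ q / (cabs c / 2) `^ q.
have BA0 : 0 <= `|B| * A by exact: mulr_ge0.
have L0 : 0 <= L by exact: divr_ge0 (mulr_ge0 K0 (powR_ge0 _ _)) (ltW d0).
(* Upper and lower estimates for I_g of the sum, both raised to the power q, give N |c/2|^q <= K
   (|B| A)^q N^{q/p}. *)
have key N : N%:R <= L * N%:R `^ (q / p).
  have [kin kle] := HA N; have Iin := Hin _ kin.
  have n0 : 0 <= (N%:R : R) `^ p^-1 by exact: powR_ge0.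
  have le1 : Fnorm q m (Ig g (kern_sum m N)) <= `|B| * A * N%:R `^ p^-1.
    apply: le_trans (HB _ kin) _.
    apply: le_trans (ler_wpM2r (Fnorm_ge0 _ _ _) (ler_norm B)) _.
    by rewrite -mulrA; apply: ler_wpM2l.
  have := HK N Iin; rewrite -ler_pdivlMr // => h; apply: le_trans h _.
  rewrite ler_pdivrMr // /L mulrAC divfK; last by rewrite gt_eqF.
  rewrite -mulrA; apply: (ler_wpM2l K0).
  apply: le_trans (ler_powR2 (ltW q0) (Fnorm_ge0 _ _ _) le1) _.
  by rewrite (powRM q BA0 n0) -powRrM (mulrC p^-1).
(* As q < p the exponent t is positive, so any N > L^{1/t} violates N^t <= L. *)
pose t := 1 - q / p; have t0 : 0 < t by rewrite subr_gt0 ltr_pdivrMr // mul1r.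
pose N := (Num.truncn (L `^ t^-1)).+1.
have NL : L `^ t^-1 < N%:R by exact: truncnS_gt.
have N0 : 0 < (N%:R : R) by rewrite ltr0n.
have : L < N%:R `^ t.
  have -> : L = (L `^ t^-1) `^ t by rewrite -powRrM (mulVf (lt0r_neq0 t0)) powRr1.
  by apply: (gt0_ltr_powR t0) => //; rewrite nnegrE ?powR_ge0 ?ltW.
apply/negP; rewrite -leNgt.
have P := powR_gt0 (q / p) N0.
rewrite -(ler_pM2r P) -powRD; last by rewrite (gt_eqF N0) implybT.
by rewrite /t subrK (powRr1 (ltW N0)); exact: key.
Qed.

End SeparatedKernels.

Theorem theorem2 (R : realType) (m : nat) (g : R[i] -> R[i]) (hg : entire g)
    (p q : R) (hp : 0 < p) (hq : 0 < q) :
  (p <= q ->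
     (Ig_bounded p q m g <-> exists c : R[i], forall z, g z = c) /\
     (Ig_compact p q m g <-> forall z, g z = 0)) /\
  (q < p ->
     (Ig_bounded p q m g <-> Ig_compact p q m g) /\
     (Ig_compact p q m g <-> forall z, g z = 0)).
Proof.
(* The characterization of compactness does not depend on the order of p and q, so it serves both
   parts. *)
have cz : Ig_compact p q m g <-> forall z, g z = 0.
  split; first exact: Ig_compact_eq0.
  exact: Ig_zero_compact.
split=> [pq|qp]; split; try exact: cz.
- split; first exact: Ig_bounded_const.
  exact: Ig_const_bounded.
(* For q < p boundedness and compactness are compared through the vanishing of g. *)
- split=> [bg|/cz g0]; last exact: Ig_zero_bounded.
  by apply/cz; exact: Ig_bounded_eq0 bg.
Qed.
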